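(* Let $G$ be a tame graph, let $f\in\mathcal{CMM}(G)$ be leo (locally eventually onto) with a countable Markov partition $\mathcal{P}$, let $M=(m_{ij})_{i,j\in\mathcal{P}}$ be the associated transition matrix, and let $\lambda>1$ be a real number. Then $f$ is conjugate to a countably affine graph map of constant slope $\lambda$ if and only if $M$ admits a $\lambda$-eigenvector.
   Context: Countable means finite or countably infinite. A continuum is a nonempty compact connected metrizable space. An arc is a space homeomorphic to $[0,1]$; for an arc $\alpha$, $E(\alpha)$ is the set of its two endpoints and $\alpha^\circ=\alpha\setminus E(\alpha)$ is called its interior. An arc $\alpha$ in a continuum $X$ is a free arc if $\alpha^\circ$ is open in $X$. The order $\operatorname{ord}(x,X)$ of a point $x\in X$ is the least cardinal $\beta$ such that $x$ has a neighborhood base of open sets whose boundaries have cardinality at most $\beta$; $E(X)$ is the set of points of order $1$ (endpoints) and $B(X)$ the set of points of order $\geq 3$ (branchpoints). A tame graph is a continuum $G$ such that $E(G)\cup B(G)$ has countable closure. A tame partition of $G$ is a countable family $\mathcal{P}$ of free arcs with pairwise disjoint interiors covering $G$ up to a countable set of points. A countable Markov partition for a continuous map $f\colon G\to G$ is a tame partition $\mathcal{P}$ of $G$ such that for every $i\in\mathcal{P}$ the map $f$ sends $i$ homeomorphically onto $f(i)$, and for all $i,j\in\mathcal{P}$, if $f(i)\cap j^\circ\neq\emptyset$ then $f(i)\supset j$. The class $\mathcal{CMM}(G)$ consists of the continuous maps $f\colon G\to G$ that admit a countably infinite Markov partition and are topologically mixing (for all nonempty open $U,V\subset G$ there is $n$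 with $f^m(U)\cap V\neq\emptyset$ for all $m\geq n$). The map $f$ is leo if for every nonempty open $U\subset G$ there is $n$ with $f^n(U)=G$. The transition matrix of $f$ with respect to $\mathcal{P}$ is $M=(m_{ij})_{i,j\in\mathcal{P}}$ with $m_{ij}=1$ if $f(i)\supset j$ and $m_{ij}=0$ otherwise. A $\lambda$-eigenvector of $M$ is a nonzero nonnegative real sequence $v=(v_i)_{i\in\mathcal{P}}$ with $\sum_{j\in\mathcal{P}}m_{ij}v_j=\lambda v_i$ for all $i\in\mathcal{P}$. A tame graph $G'\subset\mathbb{R}^3$ is countably affine if it admits a tame partition whose arcs are all line segments. A countably affine graph map is a continuous map $g\colon G'\to G'$ on such a $G'$ for which $G'$ admits a tame partition into line segments such that the restriction of $g$ to each of these segments is an affine map (onto a line segment); the slope of such a restriction is the ratio of the length of the image segment to the length of the segment. The map $g$ has constant slope $\lambda$ if all these restrictions have slope $\lambda$. Maps $f\colon G\to G$ and $g\colon G'\to G'$ are conjugate if there is a homeomorphism $\phi\colon G\to G'$ with $\phi\circ f=g\circ\phi$. *)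

(* Defs.v *)
From HB Require Import structures.
From mathcomp Require Import all_boot all_order all_algebra.
From mathcomp Require Import all_classical all_reals all_analysis.

Set Implicit Arguments.
Unset Strict Implicit.
Unset Printing Implicit Defensive.

Import Order.TTheory GRing.Theory Num.Theory.
Import numFieldNormedType.Exports.

Local Open Scope card_scope.
Local Open Scope classical_set_scope.
Local Open Scope ring_scope.

(* A subset [A] of a topological space, coerced to the type [set_type A],
   carries the subset topology; this is how a graph contained in R^3 is turned
   into a space in its own right. Conversely, [{within A, continuous h}] only
   constrains the restriction of [h] to [A], so maps between subsets are
   represented by total functions whose values outside [A] are irrelevant. *)

Section Topology.

Definition metrizable (R : realType) (X : topologicalType) : Prop :=
  exists d : X -> X -> R,
    [/\ forall x y, 0 <= d x y,
        forall x y, d x y = 0 <-> x = y,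
        forall x y, d x y = d y x,
        forall x y z, d x z <= d x y + d y z &
        forall (x : X) (A : set X),
          nbhs x A <-> exists2 e, 0 < e & [set y | d x y < e] `<=` A].

Definition continuum (R : realType) (X : topologicalType) : Prop :=
  [/\ [set: X] !=set0, compact [set: X], connected [set: X] & metrizable R X].

Definition homeomorphic_onto (X Y : topologicalType) (A : set X) (B : set Y)
    (h : X -> Y) : Prop :=
  [/\ {within A, continuous h}, h @` A = B &
      exists k : Y -> X,
        {within B, continuous k} /\ forall x, A x -> k (h x) = x].

Definition homeomorphism (X Y : topologicalType) (phi : X -> Y) : Prop :=
  continuous phi /\
  exists psi : Y -> X, [/\ continuous psi, cancel phi psi & cancel psi phi].

Definition arc_param (R : realType) (X : topologicalType) (a : set X)
    (h : R -> X) : Prop :=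
  homeomorphic_onto `[(0 : R), 1]%classic a h.

Definition arc (R : realType) (X : topologicalType) (a : set X) : Prop :=
  exists h : R -> X, arc_param a h.

Definition arc_ends (R : realType) (X : topologicalType) (a : set X) : set X :=
  [set x | exists2 h : R -> X, arc_param a h & x = h 0 \/ x = h 1].

Definition arc_int (R : realType) (X : topologicalType) (a : set X) : set X :=
  a `\` arc_ends R a.

Definition free_arc (R : realType) (X : topologicalType) (a : set X) : Prop :=
  arc R a /\ open (arc_int R a).

Definition boundary (X : topologicalType) (W : set X) : set X :=
  closure W `\` interior W.

(* Cardinals are represented by sets up to equipotence. The order of [x] is the
   least cardinal [B] such that [order_le x B]; hence it is at least [B] when
   [B] is below every admissible cardinal. *)
Definition order_le (X : topologicalType) (x : X) (U : Type) (B : set U)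
    : Prop :=
  forall V, nbhs x V ->
    exists W, [/\ open W, W x, W `<=` V & boundary W #<= B].

Definition order_ge (X : topologicalType) (x : X) (U : Type) (B : set U)
    : Prop :=
  forall (U' : Type) (C : set U'), order_le x C -> B #<= C.

Definition order_eq (X : topologicalType) (x : X) (U : Type) (B : set U)
    : Prop :=
  order_le x B /\ order_ge x B.

Definition endpoints (X : topologicalType) : set X :=
  [set x : X | order_eq x `I_1].

Definition branchpoints (X : topologicalType) : set X :=
  [set x : X | order_ge x `I_3].

Definition tame_graph (R : realType) (G : topologicalType) : Prop :=
  continuum R G /\ countable (closure (@endpoints G `|` @branchpoints G)).

Definition tame_partition (R : realType) (G : topologicalType)
    (P : set (set G)) : Prop :=
  [/\ countable P,
      forall a, P a -> free_arc R a,
      trivIset P (@arc_int R G) &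
      countable (~` \bigcup_(a in P) a)].

End Topology.

Section Dynamics.

Definition mixing (G : topologicalType) (f : G -> G) : Prop :=
  forall U V : set G, open U -> U !=set0 -> open V -> V !=set0 ->
    exists n, forall m, (n <= m)%N -> (iter m f @` U) `&` V !=set0.

Definition leo (G : topologicalType) (f : G -> G) : Prop :=
  forall U : set G, open U -> U !=set0 -> exists n, iter n f @` U = [set: G].

Definition countable_Markov_partition (R : realType) (G : topologicalType)
    (f : G -> G) (P : set (set G)) : Prop :=
  [/\ tame_partition R P,
      forall i, P i -> homeomorphic_onto i (f @` i) f &
      forall i j, P i -> P j ->
        (f @` i) `&` arc_int R j !=set0 -> j `<=` f @` i].

Definition CMM (R : realType) (G : topologicalType) (f : G -> G) : Prop :=
  [/\ continuous f,
      exists2 P : set (set G),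
        infinite_set P & countable_Markov_partition R f P &
      mixing f].

Definition transition_matrix (R : realType) (G : topologicalType)
    (f : G -> G) (i j : set G) : R :=
  if `[< j `<=` f @` i >] then 1 else 0.

(* Matrices and vectors indexed by [P] are given by functions on the ambient
   type; only their values on [P] matter. *)
Definition eigenvector (R : realType) (I : choiceType) (P : set I)
    (M : I -> I -> R) (lambda : R) (v : I -> R) : Prop :=
  [/\ forall i, P i -> 0 <= v i,
      exists2 i, P i & v i != 0 &
      forall i, P i ->
        \esum_(j in P) (M i j * v j)%:E = (lambda * v i)%:E].

Definition conjugate (G G' : topologicalType) (f : G -> G) (g : G' -> G')
    : Prop :=
  exists2 phi : G -> G', homeomorphism phi & phi \o f = g \o phi.

End Dynamics.

Section Affine.
Variable R : realType.

(* The norm provided by the library on row vectors is the sup norm, which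
   induces the right topology but not the Euclidean length. *)
Definition euclidean_dist (x y : 'rV[R]_3) : R :=
  Num.sqrt (\sum_(k < 3) (x ord0 k - y ord0 k) ^+ 2).

Definition line_segment (S : set 'rV[R]_3) (a b : 'rV[R]_3) : Prop :=
  a <> b /\ S = [set (1 - t) *: a + t *: b | t in `[(0 : R), 1]%classic].

Variable G : set 'rV[R]_3.

Definition segment_of (s : set G) (a b : 'rV[R]_3) : Prop :=
  line_segment (set_val @` s) a b.

Definition is_segment (s : set G) : Prop := exists a b, segment_of s a b.

Definition affine_on (g : G -> G) (s : set G) : Prop :=
  forall (x y z : G) (t : R), s x -> s y -> s z -> 0 <= t <= 1 ->
    set_val z = (1 - t) *: set_val x + t *: set_val y ->
    set_val (g z) = (1 - t) *: set_val (g x) + t *: set_val (g y).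

Definition slope_on (g : G -> G) (s : set G) (lambda : R) : Prop :=
  exists a b c d,
    [/\ segment_of s a b, segment_of (g @` s) c d &
        lambda = euclidean_dist c d / euclidean_dist a b].

Definition affine_partition (g : G -> G) (P : set (set G)) : Prop :=
  tame_partition R P /\
  forall s, P s -> [/\ is_segment s, affine_on g s & is_segment (g @` s)].

Definition countably_affine : Prop :=
  tame_graph R G /\
  exists P : set (set G), tame_partition R P /\ forall s, P s -> is_segment s.

Definition countably_affine_map (g : G -> G) : Prop :=
  [/\ countably_affine, continuous g & exists P, affine_partition g P].

(* The slopes do not depend on the partition: two segments of two affine
   partitions either meet in a countable set or overlap in a segment. *)
Definition constant_slope (g : G -> G) (lambda : R) : Prop :=
  exists2 P, affine_partition g P & forall s, P s -> slope_on g s lambda.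

End Affine.

(* Main.v *)
Require Import Defs.
From HB Require Import structures.
From mathcomp Require Import all_boot all_order all_algebra.
From mathcomp Require Import all_classical all_reals all_analysis.
From mathcomp Require Import finmap ring lra.
Set Implicit Arguments.
Unset Strict Implicit.
Unset Printing Implicit Defensive.
Import Order.TTheory GRing.Theory Num.Theory.
Import numFieldNormedType.Exports.
Local Open Scope classical_set_scope.
Local Open Scope ring_scope.

(** A map of constant slope multiplies lengths by the slope, and the Markov
    property says that the image of an arc is, up to countably many points, the
    union of the arcs it covers. So lengths of arcs and eigenvectors are the
    same data; the work is to pass from one to the other.

    From a map to an eigenvector. Let the model be cut into countably many
    segments on which the map is affine of slope lambda. These segments need not
    be related to the Markov partition, so the length of a set is defined as the
    sum over all segments of the Lebesgue measure of its trace on them ([ell]).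
    This length does not depend on the segment used to measure a piece
    ([seglen_independent]), is countably additive up to countable overlaps
    ([ell_countable_additive]), and is multiplied by lambda under the map where
    the map is injective ([ell_image_inj]). Applied to a Markov arc this is the
    eigenvector equation. Lengths are finite because some iterate maps a single
    segment onto the whole space ([ell_finite]).

    From an eigenvector to a map. Since every arc is mapped onto the whole space
    by an iterate, the eigenvector is positive and summable
    ([leo_eigenvector_gt0], [leo_eigenvector_summable]). Its entries are to
    become the lengths of the arcs, and the length of the part of an arc mapped
    onto an arc j must be v_j / lambda. This prescribes the distribution of
    length along each arc as a fixed point of a transfer operator, which
    contracts by the factor 1 / lambda ([transfer_contracts],
    [self_similar_distribution]). The distribution is strictly increasing,
    since a subarc of length zero would spread over the space, and so gives each
    arc a coordinate in which the map has slope lambda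
    ([length_charts_exist]).

    It remains to realize these lengths in space. The skeleton, that is what is
    left after removing the interiors of the arcs, is countable, and around each
    of its points there are small neighbourhoods cutting only finitely many arcs
    ([trapping_neighbourhood]). Adding up the characteristic functions of such
    neighbourhoods with rapidly decreasing weights embeds the skeleton in a
    line so that the ends of each arc i are closer than v_i
    ([skeleton_coordinate]). Each arc is then drawn as a tent of length v_i over
    the segment joining its ends, the tents standing in distinct half planes
    bounded by the line ([tame_embedding]); as the lengths are summable the
    tents shrink, which makes the drawing continuous at the skeleton. An arc is
    thus straight on each half, and cutting the halves further according to the
    half arc that receives them gives segments on which the conjugate map is
    affine of slope lambda ([pieces_tame], [affine_model]). *)


(** * Countable sets, compact sets and relative continuity *)

Section Countable.
Context {T U : Type}.

Lemma countableU (A B : set T) :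
  countable A -> countable B -> countable (A `|` B).
Proof.
move=> cA cB; have -> : A `|` B = \bigcup_(b in [set: bool]) (if b then A else B).
  by apply/seteqP; split=> [x [Ax|Bx]|x [[] _]]; [exists true|exists false|left|right].
by apply: bigcup_countable => // -[].
Qed.

Lemma countable_image (f : T -> U) (A : set T) :
  countable A -> countable (f @` A).
Proof. by apply: sub_countable; exact: card_image_le. Qed.

Lemma countableS (A B : set T) : A `<=` B -> countable B -> countable A.
Proof. by move=> AB; apply: sub_countable; exact: subset_card_le. Qed.

Lemma countable_preimage_inj (f : T -> U) (A : set T) (B : set U) :
  {in A &, injective f} -> countable B -> countable (A `&` f @^-1` B).
Proof.
move=> fi cB; apply/countable_injP.
have /countable_injP[g gi] := cB.
exists (g \o f) => x y /set_mem [Ax Bx] /set_mem [Ay By] /= /gi e.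
by apply: fi; [exact/mem_set|exact/mem_set|apply: e; exact/mem_set].
Qed.

End Countable.

Section RealUncountable.
Context {R : realType}.

Lemma itv_uncountable (a b : R) : a < b -> ~ countable `]a, b[%classic.
Proof.
move=> ab /countable_lebesgue_measure0.
rewrite lebesgue_measure_itv /= lte_fin ab => /eqP; rewrite -EFinD eqe subr_eq0.
by rewrite gt_eqF.
Qed.

Lemma open_meets_segment (a b t : R) (U : set R) : a < b -> open U -> U t ->
  t \in `[a, b] -> exists c d, [/\ a <= c, c < d, d <= b & `]c, d[ `<=` U].
Proof.
move=> ab oU Ut /[!in_itv]/= /andP[at_ tb].
have /nbhs_ballP[e /= e0 sU] : nbhs t U by exact: open_nbhs_nbhs.
exists (Num.max a (t - e)), (Num.min b (t + e)); split.
- by rewrite le_max lexx.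
- rewrite lt_min !gt_max ab /=; apply/and3P; split; first lra.
  + lra.
  + lra.
- by rewrite ge_min lexx.
- move=> x /=; rewrite in_itv/= gt_max lt_min => /andP[/andP[ax tx] /andP[xb xt]].
  by apply: sU; rewrite /ball/= ltr_norml; apply/andP; split; lra.
Qed.

End RealUncountable.

Section CompactHausdorff.

(** An element of a nonempty set turns the space into a pointed one. *)
Lemma compact_covers (X : topologicalType) (K : set X) :
  compact K -> cover_compact K.
Proof.
have [->|/set0P[x0 _]] := eqVneq K set0.
  by move=> _ I D F oF _; exists fset0.
pose pX : ptopologicalType := HB.pack X (isPointed.Build X x0).
move=> cK; suff : @cover_compact pX K by [].
by rewrite -(congr1 (fun f => f K) (@compact_cover pX)).
Qed.

Lemma within_closedP {X Y : topologicalType} (A : set X) (h : X -> Y) :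
  closed A ->
  ({within A, continuous h} <->
   forall B, closed B -> closed (A `&` h @^-1` B)).
Proof.
move=> cA; split=> [/continuous_closedP ch B cB|ch].
  by have := ch B cB; rewrite -(closed_setSI _ cA).
apply/continuous_closedP => B /ch.
by move=> ?; rewrite -(closed_setSI _ cA).
Qed.

Lemma within_openP {X Y : topologicalType} (A : set X) (h : X -> Y) (U : set Y) :
  {within A, continuous h} -> open U ->
  exists2 V : set X, open V & A `&` h @^-1` U = A `&` V.
Proof.
move=> /continuousP /[apply] /open_subspaceP[V oV e]; exists V => //.
by rewrite setIC -e setIC.
Qed.

Lemma within_continuous_compose {X Y Z : topologicalType} (A : set X) (B : set Y)
    (f : X -> Y) (g : Y -> Z) :
  closed A -> closed B -> f @` A `<=` B ->
  {within A, continuous f} -> {within B, continuous g} ->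
  {within A, continuous (g \o f)}.
Proof.
move=> clA clB fAB cf cg; apply/(within_closedP _ clA) => C cC.
have cBC := (within_closedP _ clB).1 cg _ cC.
have := (within_closedP _ clA).1 cf _ cBC.
suff -> : A `&` f @^-1` (B `&` g @^-1` C) = A `&` (g \o f) @^-1` C by [].
apply/seteqP; split=> x /= [Ax]; first by case.
by move=> Cx; split=> //; split=> //; apply: fAB; exists x.
Qed.

(** Closed subsets of a compact set are compact, so their images are closed. *)
Lemma compact_inj_homeo {X Y : topologicalType} (A : set X) (h : X -> Y)
    (k : Y -> X) : hausdorff_space Y -> compact A ->
  {within A, continuous h} -> (forall x, A x -> k (h x) = x) ->
  {within h @` A, continuous k}.
Proof.
move=> hY cA ch hk.
have clhA : closed (h @` A).
  by apply: compact_closed => //; exact: continuous_compact.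
apply/(within_closedP _ clhA) => B cB.
have -> : h @` A `&` k @^-1` B = h @` (A `&` B).
  apply/seteqP; split=> y /= => [[[x Ax <-]]|[x [Ax Bx] <-]].
    by rewrite hk // => Bx; exists x.
  by split; [exists x|rewrite hk].
apply: (compact_closed hY); apply: continuous_compact.
  by apply: continuous_subspaceW ch => x [].
exact: compact_closedI.
Qed.

Lemma metrizable_hausdorff (R : realType) (X : topologicalType) :
  metrizable R X -> hausdorff_space X.
Proof.
move=> [d [d0 d1 dC dT dn]]; rewrite open_hausdorff => x y xy.
have dxy : 0 < d x y.
  by rewrite lt_neqAle d0 andbT eq_sym; apply: contra_neqN xy => /eqP/d1.
have nb z : nbhs z [set w | d z w < d x y / 2].
  by apply/dn; exists (d x y / 2) => //; lra.
have [oA oB] := (open_interior [set w | d x w < d x y / 2],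
                 open_interior [set w | d y w < d x y / 2]).
exists ([set w | d x w < d x y / 2]^°, [set w | d y w < d x y / 2]^°).
  by split; apply/mem_set; exact: nb.
split=> //=; apply/eqP/seteqP; split=> // w [/interior_subset /= h1 /interior_subset /= h2].
by have := dT x w y; rewrite (dC w y); lra.
Qed.

Lemma segment_closed (R : realType) (a b : R) : closed `[a, b]%classic.
Proof. exact: itv_closed. Qed.

End CompactHausdorff.

Arguments segment_closed {R} a b.

(** * Arcs and their interiors *)

Section Arcs.
Context {R : realType}.

Lemma segment_subset_le (a b c d : R) : a <= b ->
  `[a, b]%classic `<=` `[c, d]%classic -> c <= a /\ b <= d.
Proof.
move=> ab s; have /= := s a; have /= := s b.
rewrite !in_itv /= !lexx !ab /= => /(_ isT)/andP[cb bd] /(_ isT)/andP[ca ad].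
by split.
Qed.

Lemma segment_inj_ends (a b c d : R) (s : R -> R) : a <= b -> c <= d ->
  {within `[a, b], continuous s} -> {in `[a, b] &, injective s} ->
  s @` `[a, b] = `[c, d]%classic ->
  (s a = c /\ s b = d) \/ (s a = d /\ s b = c).
Proof.
move=> ab cd sc si e; have := continuous_inj_image_segment ab sc si.
rewrite e; have [sab|/ltW sba] := leP (s a) (s b).
  move=> /seteqP[s1 s2].
  have [? ?] := segment_subset_le cd s1; have [? ?] := segment_subset_le sab s2.
  by left; split; apply/eqP; rewrite eq_le; apply/andP.
move=> /seteqP[s1 s2].
have [? ?] := segment_subset_le cd s1; have [? ?] := segment_subset_le sba s2.
by right; split; apply/eqP; rewrite eq_le; apply/andP.
Qed.

Context {X : topologicalType}.
Hypothesis hX : hausdorff_space X.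
Implicit Types (a : set X) (h : R -> X).

Lemma arc_param_inj a h : arc_param a h -> {in `[0, 1] &, injective h}.
Proof.
by move=> [_ _ [k [_ hk]]] x y x01 y01 e; rewrite -(hk x) // -(hk y) // e.
Qed.

Lemma arc_param_of_inj h : {within `[0, 1], continuous h} ->
  {in `[0, 1] &, injective h} -> arc_param (h @` `[0, 1]) h.
Proof.
move=> hc hi; split=> //.
have [k hk] : exists k : X -> R, forall t, t \in `[0, 1] -> k (h t) = t.
  have /choice[k kP] : forall x, exists t : R,
      (h @` `[0, 1]) x -> t \in `[0, 1] /\ h t = x.
    move=> x; have [[t t01 <-]|?] := pselect ((h @` `[0, 1]) x).
      by exists t.
    by exists 0.
  exists k => t t01; have [|kt e] := kP (h t); first by exists t.
  exact: hi.
exists k; split=> //.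
by apply: (compact_inj_homeo hX) => //; exact: segment_compact.
Qed.

(** The change of parameter is a continuous injection of the unit interval onto
    itself, hence monotone. So the two endpoints, and with them the interior,
    can be read off from any parametrization. *)
Lemma arc_param_ends a h h' : arc_param a h -> arc_param a h' ->
  (h' 0 = h 0 /\ h' 1 = h 1) \/ (h' 0 = h 1 /\ h' 1 = h 0).
Proof.
move=> ph ph'; have [hc ha [k [kc hk]]] := ph.
have [hc' ha' [k' [kc' hk']]] := ph'.
have clS := segment_closed (0 : R) 1.
have cla : closed a.
  by rewrite -ha; apply: (compact_closed hX);
    apply: continuous_compact hc _; exact: segment_compact.
have kh' t : t \in `[0, 1] -> h (k (h' t)) = h' t /\ k (h' t) \in `[0, 1].
  move=> t01; have : a (h' t) by rewrite -ha'; exists t.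
  by rewrite -ha => -[u u01 <-]; rewrite hk.
have [i0 i1] : (0 : R) \in `[0, 1] /\ (1 : R) \in `[0, 1].
  by rewrite !in_itv /= !lexx ler01.
have sc : {within `[0, 1], continuous (k \o h')}.
  apply: (within_continuous_compose clS cla) => //.
  by rewrite ha'.
have si : {in `[0, 1] &, injective (k \o h')}.
  move=> x y x01 y01 /= e; apply: (arc_param_inj ph') => //.
  by have [<- _] := kh' x x01; have [<- _] := kh' y y01; rewrite e.
have := segment_inj_ends ler01 ler01 sc si.
have -> : (k \o h') @` `[0, 1] = `[0, 1]%classic.
  apply/seteqP; split=> [_ [t t01 <-]|t t01]; first exact: (kh' t t01).2.
  have : a (h t) by rewrite -ha; exists t.
  by rewrite -ha' => -[u u01 e]; exists u => //=; rewrite e hk.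
have [<- _] := kh' _ i0; have [<- _] := kh' _ i1.
by move=> /(_ erefl) /= [] [-> ->]; [left|right].
Qed.

Lemma arc_endsE a h : arc_param a h -> arc_ends R a = [set h 0; h 1].
Proof.
move=> ph; apply/seteqP; split=> [x [h' ph' e]|x [] ->]; last 2 first.
- by exists h; [|left].
- by exists h; [|right].
by have [[e0 e1]|[e0 e1]] := arc_param_ends ph ph';
  case: e => ->; rewrite ?e0 ?e1; (left + right); done.
Qed.

Lemma arc_intE a h : arc_param a h -> arc_int R a = h @` `]0, 1[.
Proof.
move=> ph; rewrite /arc_int (arc_endsE ph); have [_ <- _] := ph.
have [i0 i1] : (0 : R) \in `[0, 1] /\ (1 : R) \in `[0, 1].
  by rewrite !in_itv /= !lexx ler01.
apply/seteqP; split=> [_ [[t /= t01 <-]]|_ [t t01 <-]].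
  move=> /not_orP[n0 n1]; exists t => //=; move: t01; rewrite !in_itv /=.
  rewrite !le_eqVlt => /andP[/orP[/eqP t0|->] /orP[/eqP t1|->]] //.
  - by move: n0; rewrite t0.
  - by move: n0; rewrite t0.
  - by move: n1; rewrite t1.
have t01' : t \in `[0, 1] by apply: subset_itv_oo_cc t01.
split; first by exists t.
move: t01; rewrite /= in_itv /= => /andP[t0 t1].
by case=> /(arc_param_inj ph) e; [move: t0|move: t1]; rewrite e ?ltxx.
Qed.

Lemma arc_param_closed a h : arc_param a h -> closed a.
Proof.
move=> [hc <- _]; apply: (compact_closed hX).
by apply: continuous_compact hc _; exact: segment_compact.
Qed.

Lemma arc_param_connected a h : arc_param a h -> connected a.
Proof.
move=> [hc <- _]; apply: connected_continuous_connected hc.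
exact: segment_connected.
Qed.

Lemma inj_image_uncountable (h : R -> X) (c d : R) : c < d ->
  {in `]c, d[ &, injective h} -> ~ countable (h @` `]c, d[).
Proof.
move=> cd hi; have inj : {in `]c, d[%classic &, injective h}.
  by move=> x y /set_mem x1 /set_mem y1; exact: hi.
move=> /(countable_preimage_inj inj) ct.
by apply: (itv_uncountable cd); apply: countableS ct => t tcd; split=> //; exists t.
Qed.

Lemma open_meets_arc a h (U : set X) : arc_param a h -> open U ->
  U `&` a !=set0 ->
  exists c d, [/\ 0 <= c, c < d, d <= 1 & h @` `]c, d[ `<=` U `&` a].
Proof.
move=> ph oU [x [Ux]]; have [hc ha _] := ph.
have [V oV e] := within_openP hc oU; rewrite -ha => -[t t01 tx].
have Vt : V t.
  have : (`[0, 1]%classic `&` h @^-1` U) t by split; rewrite //= tx.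
  by rewrite e => -[].
have [c [d [c0 cd d1 cdV]]] := open_meets_segment ltr01 oV Vt t01.
exists c, d; split=> // _ [u ucd <-].
have u01 : `[0, 1]%classic u.
  move: ucd; rewrite /= !in_itv /= => /andP[cu ud]; apply/andP; split; lra.
split; last by exists u.
have : (`[0, 1]%classic `&` V) u by split=> //; apply: cdV.
by rewrite -e => -[].
Qed.

(** The standard way below to show that two arcs coincide: distinct arcs of a
    tame partition have countable intersection. *)
Lemma open_meets_arc_uncountable a (U : set X) : Defs.arc R a -> open U ->
  U `&` a !=set0 -> ~ countable (U `&` a).
Proof.
move=> [h ph] oU /(open_meets_arc ph oU) [c [d [c0 cd d1 s]]].
move=> /(countableS s); apply: inj_image_uncountable => // x y x1 y1.
have sub : {subset `]c, d[ <= `[0, 1]}.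
  by move=> t; rewrite !in_itv /= => /andP[? ?]; apply/andP; split; lra.
by apply: (arc_param_inj ph); exact: sub.
Qed.

Lemma arc_ends_countable a : Defs.arc R a -> countable (arc_ends R a).
Proof.
by move=> [h ph]; rewrite (arc_endsE ph); apply: countableU; exact: countable1.
Qed.

End Arcs.

Section SubArc.
Context {R : realType} {X : topologicalType}.
Hypothesis hX : hausdorff_space X.

Definition affine_itv (a b t : R) := a + t * (b - a).

Lemma affine_itv_image (a b : R) : a < b ->
  affine_itv a b @` `[0, 1] = `[a, b]%classic /\
  affine_itv a b @` `]0, 1[ = `]a, b[%classic.
Proof.
move=> ab; have ba : 0 < b - a by rewrite subr_gt0.
have K x : affine_itv a b ((x - a) / (b - a)) = x.
  by rewrite /affine_itv divfK ?gt_eqF //; lra.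
split; apply/seteqP; split=> [_ /= [t /[!in_itv]/= /andP[t0 t1] <-]|x /= /[!in_itv]/= /andP[xa xb]].
- by rewrite /affine_itv; apply/andP; split; nra.
- by exists ((x - a) / (b - a)) => //=; rewrite in_itv /= divr_ge0 ?ler_pdivrMr //; lra.
- by rewrite /affine_itv; apply/andP; split; nra.
- by exists ((x - a) / (b - a)) => //=; rewrite in_itv /= divr_gt0 ?ltr_pdivrMr //; lra.
Qed.

Lemma affine_itv_continuous (a b : R) : continuous (affine_itv a b).
Proof.
by move=> t; apply: cvgD; [exact: cvg_cst|apply: cvgM; [exact: cvg_id|exact: cvg_cst]].
Qed.

Lemma arc_of_segment (h : R -> X) (a b : R) : a < b ->
  {within `[a, b], continuous h} -> {in `[a, b] &, injective h} ->
  arc_param (h @` `[a, b]) (h \o affine_itv a b) /\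
  arc_int R (h @` `[a, b]) = h @` `]a, b[.
Proof.
move=> ab hc hi; have [ecc eoo] := affine_itv_image ab.
have ph : arc_param (h @` `[a, b]) (h \o affine_itv a b).
  have -> : h @` `[a, b] = (h \o affine_itv a b) @` `[0, 1].
    by rewrite -ecc image_comp.
  apply: arc_param_of_inj => //.
    refine (@within_continuous_compose _ _ _ _ `[a,b]%classic (affine_itv a b) h (segment_closed (0 : R) 1) (segment_closed a b) _ _ _) => //.
      by rewrite ecc.
    by apply: continuous_subspaceT; exact: affine_itv_continuous.
  move=> x y x01 y01 /= /hi e.
  have : affine_itv a b x = affine_itv a b y.
    by apply: e; [have /seteqP[+ _] := ecc|have /seteqP[+ _] := ecc];
      apply; [exists x|exists y].
  rewrite /affine_itv => /addrI/mulIf; apply.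
  by rewrite subr_eq0 gt_eqF.
by split=> //; rewrite (arc_intE hX ph) -eoo image_comp.
Qed.

End SubArc.

(** * Infinite sums and uniform limits *)

Section DominatedSums.
Context {R : realType} {I : choiceType}.
Variables (D : set I) (v : I -> R) (S : R).
Hypothesis vS : \esum_(j in D) (v j)%:E = S%:E.

Definition dominated (x : I -> R) := forall j, D j -> 0 <= x j <= v j.

Definition rsum (x : I -> R) : R := fine (\esum_(j in D) (x j)%:E).

Lemma rsumE x : dominated x -> \esum_(j in D) (x j)%:E = (rsum x)%:E.
Proof.
move=> dx; rewrite /rsum fineK // ge0_fin_numE; last first.
  by apply: esum_ge0 => j Dj; rewrite lee_fin; case/andP: (dx j Dj).
apply: (@le_lt_trans _ _ S%:E); last by rewrite ltry.
by rewrite -vS; apply: le_esum => j Dj; rewrite lee_fin; case/andP: (dx j Dj).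
Qed.

Lemma rsum_le x y : dominated x -> dominated y ->
  (forall j, D j -> x j <= y j) -> rsum x <= rsum y.
Proof.
move=> dx dy xy; rewrite -lee_fin -!rsumE //.
by apply: le_esum => j Dj; rewrite lee_fin; exact: xy.
Qed.

Lemma rsum_eq x y : (forall j, D j -> x j = y j) -> rsum x = rsum y.
Proof. by move=> xy; congr fine; apply: eq_esum => j Dj; rewrite xy. Qed.

Lemma esum_split_finite (s : seq I) (x : I -> R) : uniq s ->
  (forall j, j \in s -> D j) -> (forall j, D j -> 0 <= x j) ->
  \esum_(j in D) (x j)%:E =
    ((\sum_(j <- s) x j)%:E + \esum_(j in D `&` ~` [set` s]) (x j)%:E)%E.
Proof.
move=> us sD dx; rewrite (esumID [set` s]); last by move=> j Dj; rewrite lee_fin dx.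
congr (_ + _)%E; have -> : D `&` [set` s] = [set` s].
  by apply/seteqP; split=> [j []|j js] //; split=> //; exact: sD.
rewrite esum_fset; last first.
- by move=> j /set_mem js; rewrite lee_fin dx //; exact: sD.
- exact: finite_seq.
by rewrite -fsbig_seq // sumEFin.
Qed.

(** Subtraction of infinite sums, in the only case needed: all terms but one
    cancel. *)
Lemma rsum_diff1 j0 x y : D j0 -> dominated x -> dominated y ->
  (forall j, D j -> j <> j0 -> x j = y j) ->
  rsum x - rsum y = x j0 - y j0.
Proof.
move=> Dj0 dx dy xy.
have sD j : j \in [:: j0] -> D j by rewrite inE => /eqP->.
have E z : dominated z -> (rsum z)%:E =
    ((z j0)%:E + \esum_(j in D `&` ~` [set` [:: j0]]) (z j)%:E)%E.
  move=> dz; rewrite -rsumE // (@esum_split_finite [:: j0]) //; first by rewrite big_seq1.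
  by move=> j /dz/andP[].
have := E x dx; have := E y dy.
have -> : \esum_(j in D `&` ~` [set` [:: j0]]) (y j)%:E =
          \esum_(j in D `&` ~` [set` [:: j0]]) (x j)%:E.
  apply: eq_esum => j [Dj /= jj0]; rewrite xy // => jE; apply: jj0.
  by rewrite jE inE.
case: (\esum_(j in _) _) => [r| |] //; rewrite -!EFinD => -[->] [->]; lra.
Qed.

(** The tail of a dominated family is at most the tail of the dominating one,
    so one finite set of indices serves all dominated families. *)
Lemma rsum_approx (e : R) : 0 < e -> (forall j, D j -> 0 <= v j) ->
  exists s : seq I, [/\ uniq s, forall j, j \in s -> D j &
    forall x, dominated x -> `|rsum x - \sum_(j <- s) x j| <= e].
Proof.
move=> e0 v0.
have Sfin : \esum_(j in D) (v j)%:E \is a fin_num by rewrite vS.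
have [_ [A [finA AD] <-]] := ub_ereal_sup_adherent e0 Sfin.
rewrite -/(esum D _) vS => SA.
pose s := finmap.enum_fset (fset_set A).
have sA j : j \in s -> D j.
  by move=> js; apply: AD; apply/set_mem; rewrite -(in_fset_set finA).
have us : uniq s by exact: finmap.fset_uniq.
exists s; split=> // x dx.
have := esum_split_finite us sA (fun j Dj => proj1 (andP (dx j Dj))).
have := esum_split_finite us sA v0; rewrite vS rsumE //.
have := @le_esum R I (D `&` ~` [set` s]) (fun j => (x j)%:E) (fun j => (v j)%:E).
have : (0 <= \esum_(j in D `&` ~` [set` s]) (x j)%:E)%E.
  by apply: esum_ge0 => j [Dj _]; rewrite lee_fin; case/andP: (dx j Dj).
move: SA; rewrite fsbig_finite // sumEFin -/s -EFinB lte_fin.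
case: (\esum_(j in _) (x j)%:E) => [r| |] //; case: (\esum_(j in _) (v j)%:E) => [q| |] //.
rewrite -!EFinD !lee_fin => SA r0 rq [E1] [E2].
have {}rq : r <= q by apply: rq => j [Dj _]; rewrite lee_fin; case/andP: (dx j Dj).
by rewrite ler_norml; apply/andP; split; lra.
Qed.

End DominatedSums.

Section UniformLimits.
Context {R : realType} {X : topologicalType}.

Lemma within_epsP (A : set X) (F : X -> R) :
  {within A, continuous F} <->
  forall x, A x -> forall e : R, 0 < e ->
    exists2 V, nbhs x V & forall y, V y -> A y -> `|F x - F y| < e.
Proof.
split=> [/subspace_continuousP Fc x Ax e e0|H].
  have /cvgrPdist_lt /(_ e e0) := Fc x Ax.
  by rewrite !near_withinE => H; eexists; [exact: H|].
apply/subspace_continuousP => x Ax; apply/cvgrPdist_lt => e e0.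
have [V Vx VF] := H x Ax e e0.
by rewrite !near_withinE; apply: filterS Vx => y /VF.
Qed.

Lemma uniform_approx_continuous (A : set X) (F : X -> R) :
  (forall e : R, 0 < e -> exists2 g : X -> R, {within A, continuous g} &
     forall t, A t -> `|F t - g t| <= e) ->
  {within A, continuous F}.
Proof.
move=> ap; apply/within_epsP => x Ax e e0.
have [|g gc Fg] := ap (e / 3); first lra.
have [|V Vx Vg] := (within_epsP _ _).1 gc x Ax (e / 3); first lra.
exists V => // y Vy Ay; have := Fg x Ax; have := Fg y Ay; have := Vg y Vy Ay.
rewrite !ltr_norml !ler_norml => /andP[? ?] /andP[? ?] /andP[? ?].
by apply/andP; split; lra.
Qed.

Lemma within_continuous_sum (I : eqType) (A : set X) (s : seq I)
    (w : I -> X -> R) : (forall j, j \in s -> {within A, continuous (w j)}) ->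
  {within A, continuous (fun t => \sum_(j <- s) w j t)}.
Proof.
elim: s => [_|j s IH H].
  have -> : (fun t => \sum_(j <- [::]) w j t) = (fun=> 0).
    by apply/funext => t; rewrite big_nil.
  by apply: continuous_subspaceT => ?; exact: cvg_cst.
have -> : (fun t => \sum_(i <- j :: s) w i t) =
          (fun t => w j t + \sum_(i <- s) w i t).
  by apply/funext => t; rewrite big_cons.
move=> t; apply: cvgD; first by apply: H; rewrite mem_head.
by apply: IH => i si; apply: H; rewrite inE si orbT.
Qed.

End UniformLimits.

(** * The self-similar distribution of length *)

Section SelfSimilar.
(** The index [i] stands for an arc with parameter in the unit interval, and
    [D i] for the arcs covered by its image. [A i j] is the set of parameters
    sent into the arc [j], and [r i j] is the position in [j] of the image,
    frozen at an end of [j] outside [A i j]. *)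
Context {R : realType} {I : choiceType}.
Variables (P : set I) (D : I -> set I) (v : I -> R) (lam V : R).
Variables (A : I -> I -> set R) (r : I -> I -> R -> R).
Hypothesis DP : forall i j, P i -> D i j -> P j.
Hypothesis lam1 : 1 < lam.
Hypothesis v0 : forall i, P i -> 0 < v i.
Hypothesis vV : forall i, P i -> v i <= V.
Hypothesis eig : forall i, P i ->
  \esum_(j in D i) (v j)%:E = (lam * v i)%:E.

Local Notation "'U'" := (`[(0 : R), 1]%classic).
Definition is_end (x : R) := x = 0 \/ x = 1.

Hypothesis r01 : forall i j t, P i -> D i j -> U t -> U (r i j t).
Hypothesis rc : forall i j, P i -> D i j -> {within U, continuous (r i j)}.
Hypothesis rmono : forall i j, P i -> D i j ->
  [/\ r i j 0 = 0, r i j 1 = 1 &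
      forall x y, U x -> U y -> x <= y -> r i j x <= r i j y] \/
  [/\ r i j 0 = 1, r i j 1 = 0 &
      forall x y, U x -> U y -> x <= y -> r i j y <= r i j x].
Hypothesis rends : forall i j k t, P i -> D i j -> D i k -> j <> k -> U t ->
  is_end (r i j t) \/ is_end (r i k t).
Hypothesis AU : forall i j, P i -> D i j -> A i j `<=` U.
Hypothesis rA : forall i j k t t', P i -> D i j -> D i k -> k <> j ->
  A i j t -> A i j t' -> r i k t = r i k t'.

Definition distribution_on (i : I) (F : R -> R) :=
  [/\ F 0 = 0, F 1 = v i,
      forall x y, U x -> U y -> x <= y -> F x <= F y &
      {within U, continuous F}].

Definition distributions (F : I -> R -> R) := forall i, P i -> distribution_on i (F i).

(** The length of the part of [j] already covered by the image of the initial
    segment of [i] up to [t]; the absolute value takes care of arcs [j] that are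
    run through backwards. *)
Definition pulled (F : I -> R -> R) i j t := `|F j (r i j t) - F j (r i j 0)|.

(** An arc is to be stretched by the factor [lam], so the length of an initial
    segment is the length of its image divided by [lam]. *)
Definition transfer (F : I -> R -> R) i t : R :=
  rsum (D i) (fun j => pulled F i j t) / lam.

Let U0 : U 0. Proof. by rewrite /= in_itv /= lexx ler01. Qed.
Let U1 : U 1. Proof. by rewrite /= in_itv /= lexx ler01. Qed.
Let lam0 : 0 < lam. Proof. exact: lt_trans ltr01 lam1. Qed.

Lemma distribution_bounds i F t : distribution_on i F -> U t -> 0 <= F t <= v i.
Proof.
move=> [F0 F1 Fm _] Ut; rewrite -F0 -F1; have /= := Ut; rewrite in_itv /= => /andP[? ?].
by apply/andP; split; apply: Fm.
Qed.

Lemma pulledE F i j : distributions F -> P i -> D i j ->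
  (forall t, U t -> pulled F i j t = F j (r i j t)) \/
  (forall t, U t -> pulled F i j t = v j - F j (r i j t)).
Proof.
move=> gF Pi Dij; have Fd := gF j (DP Pi Dij); have [F0 F1 _ _] := Fd.
have [[r0 _ _]|[r0 _ _]] := rmono Pi Dij; [left|right] => t Ut;
  have /andP[? ?] := distribution_bounds Fd (r01 Pi Dij Ut);
  rewrite /pulled r0 ?F0 ?F1.
- by rewrite subr0 ger0_norm.
- by rewrite distrC ger0_norm // subr_ge0.
Qed.

Lemma pulled_dominated F i t : distributions F -> P i -> U t ->
  dominated (D i) v (fun j => pulled F i j t).
Proof.
move=> gF Pi Ut j Dij; have Fd := gF j (DP Pi Dij).
have /andP[? ?] := distribution_bounds Fd (r01 Pi Dij Ut).
by have [->|->] // := pulledE gF Pi Dij; apply/andP; split; lra.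
Qed.

Lemma pulled_le F i j x y : distributions F -> P i -> D i j -> U x -> U y -> x <= y ->
  pulled F i j x <= pulled F i j y.
Proof.
move=> gF Pi Dij Ux Uy xy; have Fd := gF j (DP Pi Dij); have [F0 F1 Fm _] := Fd.
have := distribution_bounds Fd (r01 Pi Dij Ux).
have := distribution_bounds Fd (r01 Pi Dij Uy).
rewrite /pulled; have [[-> _ rm]|[-> _ rm]] := rmono Pi Dij.
- rewrite F0 !subr0 => /andP[? _] /andP[? _]; rewrite !ger0_norm //.
  by apply: Fm; rewrite ?rm //; exact: r01.
- rewrite F1 => /andP[_ ?] /andP[_ ?]; rewrite !ler0_norm ?subr_le0 //.
  by rewrite lerN2 lerD2r; apply: Fm; rewrite ?rm //; exact: r01.
Qed.

Lemma pulled_continuous F i j : distributions F -> P i -> D i j ->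
  {within U, continuous (pulled F i j)}.
Proof.
move=> gF Pi Dij; have [F0 F1 Fm Fc] := gF j (DP Pi Dij).
have Frc : {within U, continuous (F j \o r i j)}.
  apply: (@within_continuous_compose _ _ _ U U); [exact: segment_closed..| |exact: rc|by []].
  by move=> _ [t Ut <-]; exact: r01.
apply/within_epsP => x Ux e e0; have [W Wx HW] := (within_epsP _ _).1 Frc x Ux e e0.
exists W => // y Wy Uy; apply: le_lt_trans (HW y Wy Uy) => /=.
have [E|E] := pulledE gF Pi Dij; rewrite !E //.
have -> : v j - F j (r i j x) - (v j - F j (r i j y)) =
          - (F j (r i j x) - F j (r i j y)) by lra.
by rewrite normrN.
Qed.

Lemma transfer_distributions F : distributions F -> distributions (transfer F).
Proof.
move=> gF i Pi; have dom t (Ut : U t) := pulled_dominated gF Pi Ut; split.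
- rewrite /transfer [rsum _ _](_ : _ = 0) ?mul0r // /rsum esum1 //.
  by move=> j Dij; rewrite /pulled subrr normr0.
- rewrite /transfer /rsum (_ : \esum_(j in D i) _ = (lam * v i)%:E) /=; last first.
    rewrite -eig //; apply: eq_esum => j Dij; congr EFin.
    have [F0 F1 _ _] := gF j (DP Pi Dij); rewrite /pulled.
    have vj0 := v0 (DP Pi Dij).
    have [[-> -> _]|[-> -> _]] := rmono Pi Dij; rewrite F0 F1 ?subr0 ?sub0r ?normrN;
      by rewrite gtr0_norm.
  by rewrite mulrAC divff ?mul1r // gt_eqF.
- move=> x y Ux Uy xy; rewrite /transfer ler_pM2r ?invr_gt0 //.
  apply: (rsum_le (eig Pi)); [exact: dom..|].
  by move=> j Dij; exact: pulled_le.
- apply: uniform_approx_continuous => e e0.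
  have [s [us sD sP]] := rsum_approx (eig Pi) e0 (fun j Dij => ltW (v0 (DP Pi Dij))).
  exists (fun t => (\sum_(j <- s) pulled F i j t) / lam).
    have sc : {within U, continuous (fun t => \sum_(j <- s) pulled F i j t)}.
      apply: within_continuous_sum => j js; apply: pulled_continuous => //.
      exact: sD.
    by move=> t; apply: cvgM; [exact: sc|exact: cvg_cst].
  move=> t Ut; rewrite /transfer -mulrBl normrM (gtr0_norm (x := lam^-1)) ?invr_gt0 //.
  rewrite ler_pdivrMr //; apply: le_trans (sP _ (dom t Ut)) _.
  by rewrite ler_peMr // ltW.
Qed.

(** At a point of the arc at most one target arc is partially covered; the
    completely covered and the missed ones contribute the same to all
    distributions. Hence the transfer operator contracts by the slope. *)
Lemma transfer_contracts F F' (delta : R) : distributions F -> distributions F' -> 0 <= delta ->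
  (forall j t, P j -> U t -> `|F j t - F' j t| <= delta) ->
  forall i t, P i -> U t -> `|transfer F i t - transfer F' i t| <= delta / lam.
Proof.
move=> gF gF' d0 FF' i t Pi Ut.
rewrite /transfer -mulrBl normrM (gtr0_norm (x := lam^-1)) ?invr_gt0 //.
rewrite ler_pM2r ?invr_gt0 //.
have endE j x : P j -> is_end x -> F j x = F' j x.
  by move=> Pj; have [F0 F1 _ _] := gF j Pj; have [F0' F1' _ _] := gF' j Pj;
     case=> ->; rewrite ?F0 ?F1.
have end0 j : D i j -> F j (r i j 0) = F' j (r i j 0).
  move=> Dij; apply: endE; first exact: DP Dij.
  by have [[-> _ _]|[-> _ _]] := rmono Pi Dij; [left|right].
have [[j0 [Dj0 nj0]]|nex] := pselect (exists j0, D i j0 /\ ~ is_end (r i j0 t)).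
  rewrite (rsum_diff1 (eig Pi) Dj0); last first.
  - move=> j Dij jj0; rewrite /pulled end0 // (endE j) //; first exact: DP Dij.
    by have [|//] := rends Pi Dij Dj0 jj0 Ut.
  - exact: pulled_dominated.
  - exact: pulled_dominated.
  apply: le_trans (ler_dist_dist _ _) _; rewrite end0 //.
  have -> : F j0 (r i j0 t) - F' j0 (r i j0 0) - (F' j0 (r i j0 t) - F' j0 (r i j0 0))
     = F j0 (r i j0 t) - F' j0 (r i j0 t) by lra.
  by apply: FF'; [exact: DP Dj0|exact: r01].
rewrite (@rsum_eq _ _ _ _ (fun j => pulled F' i j t)) ?subrr ?normr0 //.
move=> j Dij; rewrite /pulled end0 // (endE j) //; first exact: DP Dij.
by apply: contrapT => nj; apply: nex; exists j.
Qed.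

Definition iterate n : I -> R -> R := iter n transfer (fun i t => v i * t).

Lemma iterate_distributions n : distributions (iterate n).
Proof.
elim: n => [|n IH]; last exact: transfer_distributions.
move=> i Pi; have vi0 := v0 Pi; split; rewrite /iterate /= ?mulr0 ?mulr1 //.
- by move=> x y _ _ xy; rewrite ler_pM2l.
- apply: continuous_subspaceT => t.
  by apply: cvgM; [exact: cvg_cst|exact: cvg_id].
Qed.

Let q := lam^-1.
Let q0 : 0 < q. Proof. by rewrite invr_gt0. Qed.
Let q1 : q < 1. Proof. by rewrite invf_lt1. Qed.

Lemma iterate_step n i t : P i -> U t ->
  `|iterate n.+1 i t - iterate n i t| <= V * q ^+ n.
Proof.
elim: n i t => [|n IH] i t Pi Ut.
  rewrite expr0 mulr1.
  have /andP[? ?] := distribution_bounds (iterate_distributions 1 Pi) Ut.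
  have /andP[? ?] := distribution_bounds (iterate_distributions 0 Pi) Ut.
  by have ? := vV Pi; rewrite ler_norml; apply/andP; split; lra.
rewrite exprSr mulrA.
apply: (transfer_contracts (iterate_distributions n.+1) (iterate_distributions n)) => //.
by apply: mulr_ge0; [apply: le_trans (vV Pi); exact/ltW/v0|exact/exprn_ge0/ltW].
Qed.

(* Summing the steps [V * q ^+ n] gives tails [c * q ^+ n]. *)
Let c := V / (1 - q).

(** Widening the iterates by their tails gives nested intervals. *)
Lemma iterate_tail n m i t : P i -> U t -> (n <= m)%N ->
  iterate n i t - c * q ^+ n <= iterate m i t - c * q ^+ m /\
  iterate m i t + c * q ^+ m <= iterate n i t + c * q ^+ n.
Proof.
move=> Pi Ut /subnK <-; elim: (m - n)%N => [//|k [IH1 IH2]].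
have := iterate_step (k + n) Pi Ut; rewrite addSn ler_norml => /andP[h1 h2].
have E : c * q ^+ (k + n) - c * q ^+ (k + n).+1 = V * q ^+ (k + n).
  rewrite exprS /c; field; apply: lt0r_neq0.
    by rewrite subr_gt0.
by split; lra.
Qed.

Definition transfer_limit i t := sup [set iterate n i t - c * q ^+ n | n in [set: nat]].

Let c0 i : P i -> 0 <= c.
Proof.
move=> Pi; apply: divr_ge0; last by rewrite subr_ge0 ltW.
by apply: le_trans (vV Pi); exact/ltW/v0.
Qed.

Lemma transfer_limit_near n i t : P i -> U t -> `|transfer_limit i t - iterate n i t| <= c * q ^+ n.
Proof.
move=> Pi Ut; pose E := [set iterate n i t - c * q ^+ n | n in [set: nat]].
have ubE m : ubound E (iterate m i t + c * q ^+ m).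
  move=> _ [k _ <-]; have [km|/ltnW mk] := leqP k m.
    have [h _] := iterate_tail Pi Ut km; apply: le_trans h _.
    have : 0 <= c * q ^+ m by apply: mulr_ge0; [exact: c0 Pi|exact/exprn_ge0/ltW].
    by lra.
  have [_ h] := iterate_tail Pi Ut mk; apply: le_trans _ h.
  have : 0 <= c * q ^+ k by apply: mulr_ge0; [exact: c0 Pi|exact/exprn_ge0/ltW].
  by lra.
have E0 : E !=set0 by exists (iterate 0 i t - c * q ^+ 0), 0%N.
have h1 : transfer_limit i t <= iterate n i t + c * q ^+ n by exact: ge_sup.
have h2 : iterate n i t - c * q ^+ n <= transfer_limit i t.
  by apply: ub_le_sup; [exists (iterate 0 i t + c * q ^+ 0); exact: ubE|exists n].
by rewrite ler_norml; apply/andP; split; lra.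
Qed.

Lemma geometric_small (a e : R) : 0 < e -> exists n, a * q ^+ n < e.
Proof.
move=> e0; have : (fun n => a * q ^+ n) @ \oo --> (a * 0 : R).
  by apply: cvgM; [exact: cvg_cst|apply: cvg_expr; rewrite gtr0_norm].
rewrite mulr0 => /cvgrPdist_lt /(_ e e0) [n _ /(_ n (leqnn _))] /=.
by rewrite sub0r normrN => /ltr_normlW; exists n.
Qed.

Lemma le_geometric (a x y : R) : (forall n, x <= y + a * q ^+ n) -> x <= y.
Proof.
move=> H; apply/ler_addgt0Pr => e e0; have [n /ltW hn] := geometric_small a e0.
by apply: le_trans (H n) _; rewrite lerD2l.
Qed.

Lemma transfer_limit_distributions : distributions transfer_limit.
Proof.
move=> i Pi; have near n t (Ut : U t) := transfer_limit_near n Pi Ut.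
have eqlim t x : U t -> (forall n, iterate n i t = x) -> transfer_limit i t = x.
  move=> Ut H; apply/eqP; rewrite eq_le; apply/andP; split; apply: (@le_geometric c) => n;
  by have := near n t Ut; rewrite H ler_norml => /andP[? ?]; lra.
split.
- by apply: eqlim => // n; have [] := iterate_distributions n Pi.
- by apply: eqlim => // n; have [] := iterate_distributions n Pi.
- move=> x y Ux Uy xy; apply: (@le_geometric (c + c)) => n.
  have [_ _ /(_ _ _ Ux Uy xy) h _] := iterate_distributions n Pi.
  have := near n x Ux; have := near n y Uy; rewrite !ler_norml => /andP[? ?] /andP[? ?].
  by rewrite mulrDl; lra.
- apply: uniform_approx_continuous => e e0; have [n /ltW hn] := geometric_small c e0.
  exists (iterate n i); first by have [] := iterate_distributions n Pi.
  by move=> t Ut; apply: le_trans (near n t Ut) hn.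
Qed.

Lemma transfer_limit_fixed i t : P i -> U t -> transfer transfer_limit i t = transfer_limit i t.
Proof.
move=> Pi Ut.
have H n : `|transfer transfer_limit i t - transfer_limit i t| <= (c + c) * q ^+ n.
  have cn0 k : 0 <= c * q ^+ k by apply: mulr_ge0; [exact: c0 Pi|exact/exprn_ge0/ltW].
  have := transfer_contracts transfer_limit_distributions (iterate_distributions n) (cn0 n)
     (fun j t Pj Ut => transfer_limit_near n Pj Ut) Pi Ut.
  have := transfer_limit_near n.+1 Pi Ut; rewrite -[iterate n.+1]/(transfer (iterate n)).
  rewrite -/q exprSr mulrA !ler_norml => /andP[? ?] /andP[? ?].
  have : c * q ^+ n * q <= c * q ^+ n by rewrite ler_piMr // ltW.
  by rewrite mulrDl => ?; apply/andP; split; lra.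
apply/eqP; rewrite eq_le; apply/andP; split; apply: (@le_geometric (c + c)) => n;
  by have := H n; rewrite ler_norml => /andP[? ?]; lra.
Qed.

(** Between two parameters sent into [j] no other covered arc is touched, so in
    the fixed point equation all terms but that of [j] cancel. *)
Lemma self_similar_distribution : exists F : I -> R -> R, distributions F /\
  forall i j t t', P i -> D i j -> A i j t -> A i j t' ->
    `|F j (r i j t) - F j (r i j t')| = lam * `|F i t - F i t'|.
Proof.
exists transfer_limit; split; first exact: transfer_limit_distributions.
move=> i j t t' Pi Dij At At'; have Ut := AU Pi Dij At; have Ut' := AU Pi Dij At'.
rewrite -(transfer_limit_fixed Pi Ut) -(transfer_limit_fixed Pi Ut') /transfer -mulrBl normrM.
rewrite (gtr0_norm (x := lam^-1)) ?invr_gt0 // mulrCA divff ?mulr1 ?gt_eqF //.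
rewrite (rsum_diff1 (eig Pi) Dij); last first.
- by move=> k Dik kj; rewrite /pulled (rA Pi Dij Dik kj At At').
- exact: (pulled_dominated transfer_limit_distributions).
- exact: (pulled_dominated transfer_limit_distributions).
have [E|E] := pulledE transfer_limit_distributions Pi Dij; rewrite !E //.
have -> : v j - transfer_limit j (r i j t) - (v j - transfer_limit j (r i j t')) =
          - (transfer_limit j (r i j t) - transfer_limit j (r i j t')) by lra.
by rewrite normrN.
Qed.

End SelfSimilar.

(** * Tame and Markov partitions *)

Section EsumSets.
Context {R : realType}.

Lemma esum_subset {T : choiceType} (A B : set T) (a : T -> \bar R) :
  A `<=` B -> (forall j, B j -> 0 <= a j)%E ->
  (\esum_(j in A) a j <= \esum_(j in B) a j)%E.
Proof.
move=> AB a0; rewrite (esumID A B) // (_ : B `&` A = A); last exact/setIidPr.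
by apply: leeDl; apply: esum_ge0 => j [Bj _]; exact: a0.
Qed.

Lemma esum_pZl {T : choiceType} (A : set T) (a : T -> \bar R) (c : R) :
  0 < c -> (forall j, A j -> 0 <= a j)%E ->
  (\esum_(j in A) (c%:E * a j) = c%:E * \esum_(j in A) a j)%E.
Proof.
move=> c0 a0; rewrite /esum -ereal_sup_pZl // image_comp; congr ereal_sup.
apply: eq_imagel => X [finX XA] /=; rewrite !fsbig_finite //= big_seq [in RHS]big_seq.
rewrite ge0_sume_distrr //.
move=> j; rewrite in_fset_set // => /set_mem /XA; exact: a0.
Qed.

(** Choosing for every element of the union one of the sets containing it embeds
    the union in the disjoint sum. *)
Lemma esum_bigcup_le {T K : choiceType} (D : set K) (J : K -> set T)
    (a : T -> \bar R) :
  (forall k j, D k -> J k j -> 0 <= a j)%E ->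
  (\esum_(j in \bigcup_(k in D) J k) a j <=
   \esum_(k in D) \esum_(j in J k) a j)%E.
Proof.
move=> a0; rewrite esum_esum //.
have [->|/set0P[_ [k0 _ _]]] := eqVneq (\bigcup_(k in D) J k) set0.
  by rewrite esum_set0; apply: esum_ge0 => -[k j] [] /=; exact: a0.
have /choice[s sP] : forall j, exists k,
    (\bigcup_(k in D) J k) j -> D k /\ J k j.
  move=> j; have [[k Dk Jkj]|?] := pselect ((\bigcup_(k in D) J k) j).
    by exists k.
  by exists k0.
have := @reindex_esum R _ _ (\bigcup_(k in D) J k)
  ((fun j => (s j, j)) @` \bigcup_(k in D) J k) (fun j => (s j, j))
  (fun kj => a kj.2).
rewrite /= => <-; last first.
  split=> [j Uj|i j _ _ [_ ->]|_ [j Uj <-]] //; exists j => //.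
apply: esum_subset => [_ [j Uj <-]|[k j] []] /=; first exact: sP.
exact: a0.
Qed.

End EsumSets.

Section TamePartitions.
Context {R : realType} {G : topologicalType}.
Hypothesis hG : hausdorff_space G.
Variable P : set (set G).
Hypothesis tP : tame_partition R P.

Definition skeleton := ~` \bigcup_(a in P) arc_int R a.

Lemma tame_arc a : P a -> exists h : R -> G, arc_param a h.
Proof. by move=> Pa; have [_ /(_ a Pa) [? _] _ _] := tP. Qed.

Lemma tame_int_open a : P a -> open (arc_int R a).
Proof. by move=> Pa; have [_ /(_ a Pa) [_ ?] _ _] := tP. Qed.

Lemma arc_int_subset (a : set G) : arc_int R a `<=` a.
Proof. by move=> x []. Qed.

Lemma skeleton_countable : countable skeleton.
Proof.
have [cP fa _ cC] := tP.
apply: (@countableS _ _ ((~` \bigcup_(a in P) a) `|`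
    \bigcup_(a in P) arc_ends R a)); last first.
  apply: countableU => //; apply: bigcup_countable => // a /fa[? _].
  exact: arc_ends_countable.
move=> x nx; have [[a Pa ax]|?] := pselect ((\bigcup_(a in P) a) x); last by left.
right; exists a => //; apply: contrapT => nex; apply: nx; exists a => //.
Qed.

(** An end of an arc in the open interior of another arc would bring uncountably
    many points of the first arc into the second. *)
Lemma tame_ends_skeleton a : P a -> arc_ends R a `<=` skeleton.
Proof.
move=> Pa x ex [b Pb [bx nbx]].
have [_ _ tr _] := tP; have [h ph] := tame_arc Pa.
have ax : a x.
  move: ex; rewrite (arc_endsE hG ph); have [_ <- _] := ph.
  by case=> ->; [exists 0|exists 1]; rewrite //= in_itv /= lexx ler01.
have nc := open_meets_arc_uncountable (ex_intro _ h ph) (tame_int_open Pb)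
  (ex_intro _ x (conj (conj bx nbx) ax)).
suff ba : b = a by move: nbx; rewrite ba.
apply: tr => //; apply: contrapT => e; apply: nc.
apply: (@countableS _ _ (arc_ends R a)).
  move=> y [by_ ay]; apply: contrapT => ney; apply: e; exists y; split=> //.
by apply: arc_ends_countable => //; exists h.
Qed.

(** The ends of an arc are in the skeleton, so a point of [a] interior to [b] is
    interior to both. *)
Lemma tame_meets_int a b : P a -> P b -> a `&` arc_int R b !=set0 -> a = b.
Proof.
move=> Pa Pb [x [ax bx]]; have [_ _ tr _] := tP; apply: tr => //.
exists x; split=> //; split=> // /(tame_ends_skeleton Pa); apply.
by exists b.
Qed.

Lemma tame_meet_skeleton a b : P a -> P b -> a <> b -> a `&` b `<=` skeleton.
Proof.
move=> Pa Pb ab x [ax bx]; have [ex|nex] := pselect (arc_ends R b x).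
  exact: tame_ends_skeleton ex.
by case: ab; apply: tame_meets_int => //; exists x.
Qed.

Lemma tame_int_uncountable a : P a -> ~ countable (arc_int R a).
Proof.
move=> Pa; have [h ph] := tame_arc Pa; rewrite (arc_intE hG ph).
apply: inj_image_uncountable => // x y x01 y01.
by apply: (arc_param_inj ph); exact: subset_itv_oo_cc.
Qed.

Lemma tame_skeletonP x : skeleton x \/ exists2 a, P a & arc_int R a x.
Proof.
by have [[a Pa ax]|] := pselect ((\bigcup_(a in P) arc_int R a) x); [right; exists a|left].
Qed.

End TamePartitions.

Section Leo.
Context {R : realType} {G : topologicalType}.
Hypothesis hG : hausdorff_space G.
Variables (f : G -> G) (P : set (set G)) (lam : R) (v : set G -> R).
Hypothesis fleo : leo f.
Hypothesis mP : countable_Markov_partition R f P.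
Hypothesis lam0 : 0 < lam.

Let tP : tame_partition R P. Proof. by case: mP. Qed.

(** The nonzero entries of the row [i] of the transition matrix. *)
Definition covered (i : set G) := [set j | P j /\ j `<=` f @` i].

Lemma image_covered i : P i ->
  f @` i `<=` (\bigcup_(j in covered i) j) `|` skeleton (R := R) P.
Proof.
move=> Pi y iy; have [?|[j Pj jy]] := tame_skeletonP (R := R) P y; first by right.
left; exists j; last by case: jy.
by split=> //; have [_ _ ] := mP; apply=> //; exists y.
Qed.

Lemma eigenvector_covered : eigenvector P (transition_matrix R f) lam v <->
  [/\ forall i, P i -> 0 <= v i, exists2 i, P i & v i != 0 &
      forall i, P i -> \esum_(j in covered i) (v j)%:E = (lam * v i)%:E].
Proof.
suff E i : \esum_(j in P) (transition_matrix R f i j * v j)%:E =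
           \esum_(j in covered i) (v j)%:E.
  by split=> -[? ? H]; split=> // i Pi; rewrite -H ?E.
rewrite [covered i](_ : _ = P `&` [set j | j `<=` f @` i]) // esum_mkcondr.
apply: eq_esum => j Pj; rewrite /transition_matrix; case: asboolP => jD.
  by rewrite mul1r mem_set.
by rewrite mul0r memNset.
Qed.

(** The nonzero entries of the row [i] of the [n]-th power of the transition
    matrix. *)
Fixpoint reach (n : nat) (i : set G) : set (set G) :=
  if n is m.+1 then \bigcup_(k in reach m i) covered k else [set i].

Lemma reach_sub n i : P i -> reach n i `<=` P.
Proof.
by move=> Pi; case: n => [j ->|n j [k _ []]].
Qed.

Lemma iter_reach n i : P i ->
  countable (iter n f @` i `\` \bigcup_(k in reach n i) k).
Proof.
move=> Pi; elim: n => [|n IH].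
  apply: (@countableS _ _ set0) => // x [[y iy <-] []]; exists i => //.
apply: (@countableS _ _ (f @` (iter n f @` i `\` \bigcup_(k in reach n i) k)
    `|` skeleton (R := R) P)); last first.
  by apply: countableU; [exact: countable_image|exact: skeleton_countable].
move=> _ [[x ix <-] nx].
have [[k kr kx]|nk] := pselect ((\bigcup_(k in reach n i) k) (iter n f x)).
  have fk : (f @` k) (f (iter n f x)) by exists (iter n f x).
  have [[j kj jx]|?] := image_covered (reach_sub Pi kr) fk.
  - by case: nx; exists j => //; exists k.
  - by right.
by left; exists (iter n f x) => //; split=> //; exists x.
Qed.

(** Some iterate maps the arc onto the space, and up to countably many points
    its image is contained in the arcs reached. *)
Lemma leo_reach i : P i -> exists n, reach n i = P.
Proof.
move=> Pi; have [|n nG] := fleo (tame_int_open tP Pi).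
  have [e|/set0P //] := eqVneq (arc_int R i) set0.
  by case: (tame_int_uncountable hG tP Pi); rewrite e.
exists n; apply/seteqP; split; first exact: reach_sub.
move=> j Pj; apply: contrapT => nj.
apply: (tame_int_uncountable hG tP Pj).
apply: (@countableS _ _ ((iter n f @` i `\` \bigcup_(k in reach n i) k) `|`
   skeleton (R := R) P)); last first.
  by apply: countableU; [exact: iter_reach|exact: skeleton_countable].
move=> x jx; left; split.
  by have : [set: G] x by []; rewrite -nG => -[y [? _] <-]; exists y.
move=> [k kr kx]; apply: nj; rewrite -(tame_meets_int hG tP (reach_sub Pi kr) Pj) //.
by exists x.
Qed.

Hypothesis ev : eigenvector P (transition_matrix R f) lam v.

Lemma reach_sum n i : P i ->
  (\esum_(j in reach n i) (v j)%:E <= (lam ^+ n * v i)%:E)%E.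
Proof.
have [v0 _ ve] := eigenvector_covered.1 ev.
move=> Pi; elim: n => [|n IH].
  by rewrite expr0 mul1r esum_set1 // lee_fin v0.
apply: (@le_trans _ _ (\esum_(k in reach n i) \esum_(j in covered k) (v j)%:E)%E).
  by apply: esum_bigcup_le => k j _ [Pj _]; rewrite lee_fin v0.
rewrite (eq_esum (b := fun k => lam%:E * (v k)%:E)%E); last first.
  by move=> k /(reach_sub Pi) Pk; rewrite ve.
rewrite exprS -mulrA EFinM.
have -> : (\esum_(k in reach n i) (lam%:E * (v k)%:E) =
          lam%:E * \esum_(k in reach n i) (v k)%:E)%E.
  by rewrite esum_pZl // => k /(reach_sub Pi) Pk; rewrite lee_fin v0.
by rewrite lee_pmul2l // lte_fin.
Qed.

Lemma esum_ge_term {T : choiceType} (A : set T) (a : T -> \bar R) j :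
  A j -> (forall j, A j -> 0 <= a j)%E -> (a j <= \esum_(j in A) a j)%E.
Proof.
move=> Aj a0; rewrite -(esum_set1 (a0 j Aj)).
by apply: esum_subset => // k ->.
Qed.

(** Starting from one arc all arcs are reached in some number [n] of steps, so
    their total weight is at most [lam ^+ n] times the weight of that arc. *)
Lemma leo_eigenvector_summable :
  exists S : R, \esum_(j in P) (v j)%:E = S%:E.
Proof.
have [v0 [i Pi _] _] := eigenvector_covered.1 ev.
have [n rn] := leo_reach Pi; have := reach_sum n Pi; rewrite rn.
have : (0 <= \esum_(j in P) (v j)%:E)%E.
  by apply: esum_ge0 => j Pj; rewrite lee_fin v0.
by case: (\esum_(j in P) _) => // r _ _; exists r.
Qed.

(** By the same estimate the weight of any arc bounds a multiple of the nonzero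
    entry. *)
Lemma leo_eigenvector_gt0 i : P i -> 0 < v i.
Proof.
have [v0 [j Pj vj] _] := eigenvector_covered.1 ev.
move=> Pi; have [n rn] := leo_reach Pi; have := reach_sum n Pi; rewrite rn => h.
have := @esum_ge_term _ P (fun j => (v j)%:E) j Pj.
move=> /(_ (fun j Pj => v0 j Pj)) h'.
have := le_trans h' h; rewrite lee_fin.
rewrite lt_neqAle v0 // andbT; apply: contraTneq => <-; rewrite mulr0 -ltNge.
by rewrite lt_neqAle eq_sym vj v0.
Qed.

End Leo.

(** * Parametrized Markov arcs *)

Section Clip.
Context {R : realType}.
Variables (a b : R).
Hypothesis ab : a < b.

Definition clip (t : R) := Num.max a (Num.min t b).

Lemma clip_itv t : clip t \in `[a, b].
Proof. by rewrite in_itv /= /clip le_max lexx /= ge_max (ltW ab) /= ge_min lexx orbT. Qed.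

Lemma clip_id t : t \in `[a, b] -> clip t = t.
Proof.
by rewrite in_itv /= /clip => /andP[at_ tb]; rewrite (min_idPl tb) (max_idPr at_).
Qed.

Lemma clip_le t : t <= a -> clip t = a.
Proof. by move=> ta; rewrite /clip (min_idPl _) ?(max_idPl ta) // (le_trans ta) // ltW. Qed.

Lemma clip_ge t : b <= t -> clip t = b.
Proof. by move=> bt; rewrite /clip (min_idPr bt) (max_idPr _) // ltW. Qed.

Lemma clip_mono x y : x <= y -> clip x <= clip y.
Proof.
move=> xy; rewrite /clip ge_max le_max lexx /= le_max; apply/orP; right.
by rewrite le_min ge_min xy /= ge_min lexx orbT.
Qed.

Lemma clip_continuous : continuous clip.
Proof.
move=> t; apply: (@continuous_max _ _ (fun=> a) (fun t => Num.min t b)).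
  exact: cvg_cst.
by apply: (@continuous_min _ _ id (fun=> b)); [exact: cvg_id|exact: cvg_cst].
Qed.

End Clip.

Section Charts.
Context {R : realType} {G : topologicalType}.
Hypothesis hG : hausdorff_space G.
Variables (f : G -> G) (P : set (set G)) (lam : R) (v : set G -> R).
Hypothesis fleo : leo f.
Hypothesis mP : countable_Markov_partition R f P.
Hypothesis lam1 : 1 < lam.
Hypothesis ev : eigenvector P (transition_matrix R f) lam v.

Let lam0 : 0 < lam. Proof. exact: lt_trans lam1. Qed.
Let tP : tame_partition R P. Proof. by case: mP. Qed.
Local Notation "'U'" := (`[(0 : R), 1]%classic).
Local Notation D := (covered f P).
Local Notation skel := (skeleton (R := R) P).

Lemma markov_inj i : P i -> {in i &, injective f}.
Proof.
move=> Pi; have [_ /(_ i Pi) [_ _ [g [_ gK]]] _] := mP.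
by move=> x y /set_mem ix /set_mem iy e; rewrite -(gK x) // -(gK y) // e.
Qed.

Lemma arc_coordinates : exists (h : set G -> R -> G) (k : set G -> G -> R),
  forall i, P i -> [/\ arc_param i (h i), {within i, continuous k i},
    forall t, U t -> k i (h i t) = t,
    forall x, i x -> U (k i x) /\ h i (k i x) = x &
    forall x, i x -> is_end (k i x) <-> arc_ends R i x].
Proof.
suff /choice[hk H] : forall i, exists hk : (R -> G) * (G -> R), P i ->
    [/\ arc_param i hk.1, {within i, continuous hk.2},
    forall t, U t -> hk.2 (hk.1 t) = t,
    forall x, i x -> U (hk.2 x) /\ hk.1 (hk.2 x) = x &
    forall x, i x -> is_end (hk.2 x) <-> arc_ends R i x].
  by exists (fun i => (hk i).1), (fun i => (hk i).2).
move=> i; have [Pi|nPi] := pselect (P i); last first.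
  have [/set0P[x _]|/negbNE/eqP e] := boolP ([set: G] != set0).
    by exists (fun=> x, fun=> 0).
  exfalso; have [_ [j Pj _] _] := ev; have [h _] := tame_arc tP Pj.
  by have : [set: G] (h 0) by []; rewrite e.
have [h ph] := tame_arc tP Pi; have [hc hi [k [kc kh]]] := ph.
exists (h, k) => _ /=; split=> //.
  by move=> x; rewrite -{1}hi => -[t Ut <-]; rewrite kh.
move=> x; rewrite -{1}hi => -[t Ut <-]; rewrite kh // (arc_endsE hG ph).
have [U0 U1] : U 0 /\ U 1 by rewrite /= !in_itv /= !lexx ler01.
split=> -[e|e]; [left|right|left|right]; rewrite /= ?e //.
- exact: (arc_param_inj ph).
- exact: (arc_param_inj ph).
Qed.

Section Coordinates.
Variables (h : set G -> R -> G) (k : set G -> G -> R).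
Hypothesis hk : forall i, P i -> [/\ arc_param i (h i), {within i, continuous k i},
    forall t, U t -> k i (h i t) = t,
    forall x, i x -> U (k i x) /\ h i (k i x) = x &
    forall x, i x -> is_end (k i x) <-> arc_ends R i x].

Definition sent_into i j := [set t | U t /\ j (f (h i t))].
Definition image_coordinate i j t := k j (f (h i t)).

Lemma param_in_arc i t : P i -> U t -> i (h i t).
Proof.
move=> Pi Ut; have [[_ hi _] _ _ _ _] := hk Pi.
by have : (h i @` U) (h i t) by [exists t]; rewrite hi.
Qed.

Lemma image_param_inj i t t' : P i -> U t -> U t' -> f (h i t) = f (h i t') -> t = t'.
Proof.
move=> Pi Ut Ut' /(markov_inj Pi) e; have [ph _ kh _ _] := hk Pi.
by apply: (arc_param_inj ph) => //; apply: e; apply/mem_set; exact: param_in_arc.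
Qed.

(** The part of an arc sent into a covered arc is a subarc, as it is the image
    of the covered arc under the inverse of the map. *)
Lemma sent_segment i j : P i -> D i j ->
  exists a b : R, [/\ 0 <= a, a < b, b <= 1 & sent_into i j = `[a, b]%classic].
Proof.
move=> Pi [Pj ji]; have [[hc hi _] kc kh ki _] := hk Pi.
have [phj _ _ kj _] := hk Pj; have [hjc hj _] := phj.
have [_ /(_ i Pi) [fc _ [g [gc gK]]] _] := mP.
have cli := arc_param_closed hG (proj1 (conj (And3 hc hi (ex_intro _ (k i) (conj kc kh))) I)).
have cfi : closed (f @` i).
  apply: (compact_closed hG); apply: continuous_compact fc _.
  by rewrite -hi; apply: continuous_compact hc _; exact: segment_compact.
pose s t := k i (g (h j t)).
have sP t : U t -> U (s t) /\ f (h i (s t)) = h j t.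
  move=> Ut; have [x ix e] : (f @` i) (h j t) by apply: ji; exact: param_in_arc.
  by rewrite /s -e gK //; have [? ->] := ki _ ix.
have sc : {within U, continuous s}.
  have clU := segment_closed (0 : R) 1.
  apply: (@within_continuous_compose _ _ _ U i (g \o h j) (k i)) => //.
    move=> _ [t Ut <-] /=.
    have [x ix e] : (f @` i) (h j t) by apply: ji; exact: param_in_arc.
    by rewrite -e gK.
  apply: (@within_continuous_compose _ _ _ U (f @` i)) => //.
  by move=> _ [t Ut <-]; apply: ji; exact: param_in_arc.
have si : {in U &, injective s}.
  move=> x y /set_mem Ux /set_mem Uy e; apply: (arc_param_inj phj) => //.
  by have [_ <-] := sP x Ux; have [_ <-] := sP y Uy; rewrite e.
have simg : sent_into i j = s @` U.
  apply/seteqP; split=> [t [Ut jt]|_ [t Ut <-]].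
    have [U' e] := kj _ jt; exists (k j (f (h i t))) => //.
    apply: (image_param_inj Pi) => //; first exact: (sP _ U').1.
    by rewrite (sP _ U').2.
  by have [Us fs] := sP t Ut; split=> //; rewrite fs; exact: param_in_arc.
have si' : {in `[0, 1] &, injective s}.
  by move=> x y x1 y1; apply: si; apply/mem_set.
have U0 : U 0 by rewrite /= in_itv /= lexx ler01.
have U1 : U 1 by rewrite /= in_itv /= lexx ler01.
have s01 : s 0 <> s 1 by move=> /si' e; have := ltr01 (R := R); rewrite {1}e ?ltxx.
have [Us0 _] := sP 0 U0; have [Us1 _] := sP 1 U1.
move: Us0 Us1; rewrite /= !in_itv /= => /andP[a0 a1] /andP[b0 b1].
rewrite simg (continuous_inj_image_segment ler01 sc si').
have [s0s1|s1s0|//] := ltrgtP (s 0) (s 1).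
- by exists (s 0), (s 1); split=> //; rewrite inc_segment_image // ltW.
- by exists (s 1), (s 0); split=> //; rewrite dec_segment_image // ltW.
Qed.

Lemma sent_bounds : exists al be : set G -> set G -> R,
  forall i j, P i -> D i j -> [/\ 0 <= al i j, al i j < be i j, be i j <= 1 &
    sent_into i j = `[al i j, be i j]%classic].
Proof.
suff /choice[ab H] : forall ij : set G * set G, exists ab : R * R,
    P ij.1 -> D ij.1 ij.2 -> [/\ 0 <= ab.1, ab.1 < ab.2, ab.2 <= 1 &
    sent_into ij.1 ij.2 = `[ab.1, ab.2]%classic].
  exists (fun i j => (ab (i, j)).1), (fun i j => (ab (i, j)).2) => i j.
  exact: (H (i, j)).
move=> [i j] /=; have [[Pi Dij]|n] := pselect (P i /\ D i j); last first.
  by exists (0, 0) => Pi Dij; case: n.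
by have [a [b H]] := sent_segment Pi Dij; exists (a, b).
Qed.

Section Bounds.
Variables (al be : set G -> set G -> R).
Hypothesis ab : forall i j, P i -> D i j -> [/\ 0 <= al i j, al i j < be i j,
  be i j <= 1 & sent_into i j = `[al i j, be i j]%classic].

Definition retract i j t := image_coordinate i j (clip (al i j) (be i j) t).

Lemma clip_sent i j t : P i -> D i j -> sent_into i j (clip (al i j) (be i j) t).
Proof. by move=> Pi Dij; have [_ lt _ ->] := ab Pi Dij; exact: clip_itv. Qed.

Lemma image_coordinate_itv i j t : P i -> D i j -> sent_into i j t -> U (image_coordinate i j t).
Proof.
by move=> Pi [Pj _] [_ jt]; have [_ _ _ kj _] := hk Pj; have [] := kj _ jt.
Qed.

Lemma retract_itv i j t : P i -> D i j -> U (retract i j t).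
Proof. by move=> Pi Dij; apply: image_coordinate_itv => //; exact: clip_sent. Qed.

Lemma image_coordinate_continuous i j : P i -> D i j ->
  {within sent_into i j, continuous (image_coordinate i j)}.
Proof.
move=> Pi Dij; have [_ _ _ se] := ab Pi Dij; have [Pj _] := Dij.
have [phi _ _ _ _] := hk Pi; have [phj kjc _ _ _] := hk Pj.
have [hc hi _] := phi; have [_ /(_ i Pi) [fc _ _] _] := mP.
have cls : closed (sent_into i j) by rewrite se; exact: segment_closed.
have cli := arc_param_closed hG phi; have clj := arc_param_closed hG phj.
apply: (@within_continuous_compose _ _ _ _ j (f \o h i) (k j)) => //.
  by move=> _ [t [_ ?] <-].
apply: (@within_continuous_compose _ _ _ _ i (h i) f) => //.
  by move=> _ [t [Ut _] <-]; exact: param_in_arc.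
by apply: continuous_subspaceW hc => t [].
Qed.

Lemma image_coordinate_inj i j : P i -> D i j -> {in sent_into i j &, injective (image_coordinate i j)}.
Proof.
move=> Pi [Pj _] x y /set_mem[Ux jx] /set_mem[Uy jy] e.
have [_ _ _ kj _] := hk Pj; apply: (image_param_inj Pi) => //.
by have [_ <-] := kj _ jx; have [_ <-] := kj _ jy; congr (h j _); exact: e.
Qed.

Lemma image_coordinate_surj i j : P i -> D i j -> image_coordinate i j @` sent_into i j = U.
Proof.
move=> Pi Dij; have [Pj ji] := Dij.
apply/seteqP; split=> [_ [t st <-]|t Ut]; first exact: image_coordinate_itv.
have [x ix e] : (f @` i) (h j t) by apply: ji; exact: param_in_arc.
have [_ _ _ ki _] := hk Pi; have [Ux hx] := ki x ix.
have [_ _ kj _ _] := hk Pj.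
exists (k i x); last by rewrite /image_coordinate hx e kj.
by split=> //; rewrite hx e; exact: param_in_arc.
Qed.

Lemma retract_continuous i j : P i -> D i j ->
  {within U, continuous (retract i j)}.
Proof.
move=> Pi Dij; have [_ _ _ se] := ab Pi Dij.
apply: (@within_continuous_compose _ _ _ _ (sent_into i j) (clip (al i j) (be i j)) (image_coordinate i j)).
- exact: segment_closed.
- by rewrite se; exact: segment_closed.
- by move=> _ [t _ <-]; exact: clip_sent.
- by apply: continuous_subspaceT; exact: clip_continuous.
- exact: image_coordinate_continuous.
Qed.

Lemma retract_mono i j : P i -> D i j ->
  [/\ retract i j 0 = 0, retract i j 1 = 1 &
      forall x y, U x -> U y -> x <= y -> retract i j x <= retract i j y] \/
  [/\ retract i j 0 = 1, retract i j 1 = 0 &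
      forall x y, U x -> U y -> x <= y -> retract i j y <= retract i j x].
Proof.
move=> Pi Dij; have [a0 altb b1 se] := ab Pi Dij.
have mc := image_coordinate_continuous Pi Dij; have mi := image_coordinate_inj Pi Dij.
have ms := image_coordinate_surj Pi Dij; rewrite se in mc mi ms.
have mi' : {in `[al i j, be i j] &, injective (image_coordinate i j)}.
  by move=> x y x1 y1; apply: mi; apply/mem_set.
have cl t : clip (al i j) (be i j) t \in `[al i j, be i j] by exact: clip_itv.
rewrite /retract (clip_le altb a0) (clip_ge altb b1).
have [[ma mb]|[ma mb]] := segment_inj_ends (ltW altb) ler01 mc mi' ms; [left|right];
  split=> // x y _ _ xy.
- rewrite (segment_continuous_inj_le _ mc mi') ?cl ?ma ?mb //; exact: clip_mono.
- rewrite (segment_continuous_inj_ge _ mc mi') ?cl ?ma ?mb //; exact: clip_mono.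
Qed.

(** A parameter whose image is inside both arcs would send a point into the
    interior of one arc and into the other. *)
Lemma retract_ends i j l t : P i -> D i j -> D i l -> j <> l -> U t ->
  is_end (retract i j t) \/ is_end (retract i l t).
Proof.
move=> Pi Dij Dil jl Ut; apply: contrapT => /not_orP[nj nl].
have inner m : D i m -> ~ is_end (retract i m t) ->
    m (f (h i t)) /\ ~ arc_ends R m (f (h i t)).
  move=> Dim; have [a0 altb b1 se] := ab Pi Dim; have [Pm _] := Dim.
  rewrite /retract => ne.
  have st : sent_into i m t.
    rewrite se /= in_itv /=; apply/andP; split; rewrite leNgt; apply/negP => lt; apply: ne.
      rewrite (clip_le altb (ltW lt)).
      by have := retract_mono Pi Dim; rewrite /retract (clip_le altb a0);
        case=> -[-> _ _]; [left|right].
    rewrite (clip_ge altb (ltW lt)).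
    by have := retract_mono Pi Dim; rewrite /retract (clip_ge altb b1);
      case=> -[_ -> _]; [right|left].
  have [_ mt] := st; split=> //; have [_ _ _ _ ke] := hk Pm.
  by move=> /(ke _ mt); rewrite se in st; rewrite (clip_id st) in ne.
have [jt nej] := inner j Dij nj; have [lt _] := inner l Dil nl.
have [Pj _] := Dij; have [Pl _] := Dil; case: jl; apply/esym.
by apply: (tame_meets_int hG tP) => //; exists (f (h i t)).
Qed.

(** Otherwise the interval between the two parameters would overlap with the
    interval sent into [l], and the overlap would be mapped injectively into the
    countable skeleton. *)
Lemma retract_const i j l t t' : P i -> D i j -> D i l -> l <> j ->
  sent_into i j t -> sent_into i j t' -> retract i l t = retract i l t'.
Proof.
move=> Pi Dij Dil lj; wlog tt' : t t' / t < t'.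
  move=> H st st'; have [lt|lt|-> //] := ltrgtP t t'; first exact: H.
  by apply/esym/H.
move=> st st'; have [aj0 ajb bj1 sj] := ab Pi Dij; have [al0 alb bl1 sl] := ab Pi Dil.
have [Pj _] := Dij; have [Pl _] := Dil.
rewrite sj in st st'; move: st st'; rewrite /= !in_itv /= => /andP[at_ tb] /andP[at' tb'].
rewrite /retract; have [h1|h1] := leP t' (al i l).
  by rewrite !clip_le // (le_trans _ h1) // ltW.
have [h2|h2] := leP (be i l) t.
  by rewrite !clip_ge // (le_trans h2) // ltW.
exfalso; pose c := Num.max t (al i l); pose d := Num.min t' (be i l).
have cd : c < d by rewrite lt_min !gt_max tt' h1 h2 alb.
apply: (itv_uncountable cd).
have inj : {in `]c, d[%classic &, injective (f \o h i)}.
  have sub x : x \in `]c, d[%classic -> U x.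
    move=> /set_mem; rewrite /= !in_itv /= gt_max lt_min => /andP[/andP[? ?] /andP[? ?]].
    by apply/andP; split; lra.
  by move=> x y /sub Ux /sub Uy /=; exact: image_param_inj.
apply: countableS (countable_preimage_inj inj (skeleton_countable hG tP)) => x xcd.
split=> //; move: (xcd); rewrite /= in_itv /= gt_max lt_min => /andP[/andP[? ?] /andP[? ?]].
have [_ jx] : sent_into i j x by rewrite sj /= in_itv /=; apply/andP; split; lra.
have [_ lx] : sent_into i l x by rewrite sl /= in_itv /=; apply/andP; split; lra.
exact: (tame_meet_skeleton hG tP Pl Pj lj).
Qed.

End Bounds.
End Coordinates.
End Charts.

(** * Coordinates in which the map has constant slope *)

Section LengthCharts.
Context {R : realType} {G : topologicalType}.
Hypothesis hG : hausdorff_space G.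
Variables (f : G -> G) (P : set (set G)) (lam : R) (v : set G -> R).
Hypothesis fleo : leo f.
Hypothesis mP : countable_Markov_partition R f P.
Hypothesis lam1 : 1 < lam.
Hypothesis ev : eigenvector P (transition_matrix R f) lam v.

Let lam0 : 0 < lam. Proof. exact: lt_trans lam1. Qed.
Let tP : tame_partition R P. Proof. by case: mP. Qed.
Local Notation "'U'" := (`[(0 : R), 1]%classic).
Local Notation D := (covered f P).
Local Notation skel := (skeleton (R := R) P).

(** Coordinates measuring length along the arcs: onto [`[0, v i]], with the map
    expanding by [lam], and with convex preimages of the covered arcs. *)
Definition length_charts (s : set G -> G -> R) :=
  [/\ forall i, P i -> [/\ {within i, continuous (s i)}, {in i &, injective (s i)},
        s i @` i = `[0, v i]%classic &
        forall x, i x -> (0 < s i x < v i <-> arc_int R i x)],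
      forall i j, P i -> D i j -> forall x y, i x -> i y -> j (f x) -> j (f y) ->
        `|s j (f x) - s j (f y)| = lam * `|s i x - s i y| &
      forall i j, P i -> D i j -> forall x y z, i x -> i y -> i z ->
        j (f x) -> j (f y) -> s i x <= s i z <= s i y -> j (f z)].

Section Thin.
Variable s : set G -> G -> R.
Hypothesis sscale : forall i j, P i -> D i j -> forall x y, i x -> i y ->
  j (f x) -> j (f y) -> `|s j (f x) - s j (f y)| = lam * `|s i x - s i y|.

(** A notion of being of length zero that needs no measure. *)
Definition thin (B : set G) := forall j, P j -> countable (s j @` (B `&` j)).

(** Along an arc the coordinate of the image is determined by the coordinate up
    to a sign; the arcs that are not covered, and the skeleton, contribute
    countable sets. *)
Lemma thin_image B : thin B -> thin (f @` B).
Proof.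
move=> tB j Pj.
pose Z i := s j @` (f @` (B `&` i) `&` j).
apply: (@countableS _ _ (s j @` (f @` skel `|` skel) `|`
    \bigcup_(i in [set i | P i /\ D i j]) Z i)).
  move=> _ [_ [[x Bx <-] jx] <-].
  have [sx|[i Pi [ix _]]] := tame_skeletonP (R := R) P x.
    by left; exists (f x) => //; left; exists x.
  have [Dij|nD] := pselect (D i j).
    by right; exists i => //; exists (f x) => //; split=> //; exists x.
  left; exists (f x) => //; right => -[l Pl lx].
  have [_ _ /(_ i l Pi Pl)] := mP.
  move=> /(_ (ex_intro _ _ (conj (ex_intro2 _ _ x ix erefl) lx))) li.
  apply: nD; rewrite (_ : j = l) //.
  by apply: (tame_meets_int hG tP) => //; exists (f x).
apply: countableU.
  apply: countable_image; apply: countableU; last exact: skeleton_countable.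
  by apply: countable_image; exact: skeleton_countable.
apply: bigcup_countable => [|i [Pi Dij]].
  by have [cP _ _ _] := tP; apply: countableS cP => i [].
have [->|/set0P[_ [_ [[x0 [Bx0 ix0] <-] jx0] _]]] := eqVneq (Z i) set0.
  exact: countable0.
apply: (@countableS _ _
  ((fun u => s j (f x0) + lam * (u - s i x0)) @` (s i @` (B `&` i)) `|`
   (fun u => s j (f x0) - lam * (u - s i x0)) @` (s i @` (B `&` i)))); last first.
  by apply: countableU; apply: countable_image; exact: tB.
move=> _ [_ [[x [Bx ix] <-] jx] <-].
have := sscale Pi Dij ix ix0 jx jx0; rewrite -{1}(gtr0_norm lam0) -normrM.
move=> /eqP; rewrite eqr_norm2 => /orP[] /eqP e; [left|right];
  by exists (s i x); [exists x|lra].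
Qed.

(** A thin open set would spread over the whole space under iteration,
    although no arc of positive length is thin. This makes the coordinates
    injective. *)
Lemma open_not_thin (W : set G) i : P i -> s i @` i = `[0, v i]%classic -> 0 < v i ->
  open W -> W !=set0 -> ~ thin W.
Proof.
move=> Pi si vi oW W0 tW; have [n nG] := fleo oW W0.
have : thin (iter n f @` W).
  elim: n {nG} => [|n IH]; first by rewrite [X in thin X]image_id.
  have -> : iter n.+1 f @` W = f @` (iter n f @` W) by rewrite image_comp.
  exact: thin_image.
rewrite nG => /(_ i Pi); rewrite setTI si => /(countableS (@subset_itv_oo_cc _ _ _ _)).
exact: itv_uncountable.
Qed.

End Thin.

Lemma length_charts_exist : exists s, length_charts s.
Proof.
have [h [k hk]] := arc_coordinates hG mP ev.
have [al [be ab]] := sent_bounds hG mP hk.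
have [S Ssum] := leo_eigenvector_summable hG fleo mP lam0 ev.
have v0 i (Pi : P i) := leo_eigenvector_gt0 hG fleo mP lam0 ev Pi.
have [_ _ eig] := (eigenvector_covered _ _ _ _).1 ev.
have vS i : P i -> v i <= S.
  move=> Pi; rewrite -lee_fin -Ssum.
  by apply: (@esum_ge_term _ _ P (fun j => (v j)%:E)) => // j /v0 /ltW.
have DP i j : P i -> D i j -> P j by move=> _ [].
have [F [gF Fs]] := @self_similar_distribution R (set G) P D v lam S
  (sent_into f h) (retract f h k al be) DP lam1 v0 vS eig
  (fun i j t Pi Dij _ => retract_itv hk ab t Pi Dij)
  (retract_continuous hG mP hk ab) (retract_mono hG mP hk ab)
  (fun i j l t Pi Dij Dil jl Ut => @retract_ends _ _ hG _ _ mP _ _ hk _ _ ab i j l t Pi Dij Dil jl Ut)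
  (fun i j _ _ t st => proj1 st)
  (fun i j l t t' Pi Dij Dil lj => @retract_const _ _ hG _ _ mP _ _ hk _ _ ab i j l t t' Pi Dij Dil lj).
pose s i x := F i (k i x).
have sscale i j : P i -> D i j -> forall x y, i x -> i y -> j (f x) -> j (f y) ->
    `|s j (f x) - s j (f y)| = lam * `|s i x - s i y|.
  move=> Pi Dij x y ix iy jx jy; have [_ _ _ ki _] := hk i Pi.
  have mv z : i z -> j (f z) -> sent_into f h i j (k i z) /\
      retract f h k al be i j (k i z) = k j (f z).
    move=> iz jz; have [Uz hz] := ki z iz.
    have st : sent_into f h i j (k i z) by split=> //; rewrite hz.
    split=> //; have [_ _ _ se] := ab i j Pi Dij.
    by rewrite /retract clip_id /image_coordinate ?hz //; rewrite se in st.
  have [sx ex] := mv x ix jx; have [sy ey] := mv y iy jy.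
  by have := Fs i j _ _ Pi Dij sx sy; rewrite ex ey.
have U0 : U 0 by rewrite /= in_itv /= lexx ler01.
have U1 : U 1 by rewrite /= in_itv /= lexx ler01.
have smono i : P i -> forall t t', U t -> U t' -> t < t' -> F i t < F i t'.
  move=> Pi t t' Ut Ut' tt'; have [F0 F1 Fm _] := gF i Pi.
  have := Fm t t' Ut Ut' (ltW tt'); rewrite le_eqVlt => /orP[/eqP e|//]; exfalso.
  have [ph kc kh ki ke] := hk i Pi; have [hc hi _] := ph.
  have oint := tame_int_open tP Pi.
  pose W := h i @` `]t, t'[.
  have W' : W = arc_int R i `&` (k i) @^-1` `]t, t'[.
    apply/seteqP; split=> [_ [u utt <-]|x [[ix nex] /= kx]]; last first.
      by exists (k i x) => //; have [] := ki x ix.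
    move: (utt); rewrite /= in_itv /= => /andP[tu ut].
    move: Ut Ut'; rewrite /= !in_itv /= => /andP[? ?] /andP[? ?].
    have Uu : U u by rewrite /= in_itv /=; apply/andP; split; lra.
    split; last by rewrite /= kh.
    rewrite (arc_intE hG ph); exists u => //=; rewrite in_itv /=; apply/andP; split; lra.
  have oW : open W.
    have oI : open `]t, t'[%classic by exact: itv_open.
    have [V oV eV] := within_openP kc oI.
    rewrite W' (_ : _ `&` _ = arc_int R i `&` V); first exact: openI.
    apply/seteqP; split=> x [[ix ex] xV]; split=> //.
      by have [] : (i `&` V) x by rewrite -eV.
    by have [] : (i `&` k i @^-1` `]t, t'[) x by rewrite eV.
  have W0 : W !=set0.
    by exists (h i ((t + t') / 2)), ((t + t') / 2) => //=; rewrite in_itv /=; apply/andP; split; lra.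
  have s0 : s i @` i = `[0, v i]%classic.
    have [_ _ _ Fc] := gF i Pi.
    apply/seteqP; split=> [_ [x ix <-]|y /= yv].
      by have [Ux _] := ki x ix; have := distribution_bounds (gF i Pi) Ux; rewrite /= in_itv.
    have [|u Uu <-] := IVT ler01 Fc (v := y).
      by rewrite F0 F1 (min_idPl (ltW (v0 i Pi))) (max_idPr (ltW (v0 i Pi))).
    by exists (h i u); [exact: (param_in_arc hk)|rewrite /s kh].
  apply: (open_not_thin sscale Pi s0 (v0 i Pi) oW W0) => j Pj.
  apply: (@countableS _ _ [set F i t]); last exact: countable1.
  move=> _ [x [Wx jx] <-] /=; move: (Wx); rewrite W' => -[ix /= kx].
  have ji : j = i by apply: (tame_meets_int hG tP) => //; exists x.
  move: kx; rewrite ji in_itv /= => /andP[tk kt].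
  have [Ux _] := ki x (arc_int_subset ix).
  apply/eqP; rewrite eq_le; apply/andP; split; last by apply: Fm => //; exact: ltW.
  by rewrite e; apply: Fm => //; exact: ltW.
have smono' i : P i -> forall t t', U t -> U t' -> (F i t < F i t') = (t < t').
  move=> Pi t t' Ut Ut'; apply/idP/idP; last exact: smono.
  have [_ _ Fm _] := gF i Pi.
  by move=> lt; rewrite ltNge; apply: contraTN lt => le; rewrite -leNgt Fm.
exists s; split.
- move=> i Pi; have [F0 F1 Fm Fc] := gF i Pi; have [ph kc kh ki ke] := hk i Pi.
  have cli := arc_param_closed hG ph.
  split.
  + apply: (@within_continuous_compose _ _ _ i U (k i) (F i)) => //.
      exact: segment_closed.
    by move=> _ [x ix <-]; have [] := ki x ix.
  + move=> x y /set_mem ix /set_mem iy; have [Ux hx] := ki x ix; have [Uy hy] := ki y iy.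
    rewrite /s => e; rewrite -hx -hy; congr (h i _); apply/eqP; rewrite eq_le !leNgt.
    by rewrite -(smono' i Pi _ _ Ux Uy) -(smono' i Pi _ _ Uy Ux) e ltxx.
  + apply/seteqP; split=> [_ [x ix <-]|y /= yv].
      by have [Ux _] := ki x ix; have := distribution_bounds (gF i Pi) Ux; rewrite /= in_itv.
    have [|u Uu <-] := IVT ler01 Fc (v := y).
      by rewrite F0 F1 (min_idPl (ltW (v0 i Pi))) (max_idPr (ltW (v0 i Pi))).
    by exists (h i u); [exact: (param_in_arc hk)|rewrite /s kh].
  + move=> x ix; have [Ux hx] := ki x ix.
    rewrite /s -{1}F0 -F1 !(smono' i Pi) //.
    split=> [/andP[k0 k1]|[_ nex]].
      by split=> // /(ke x ix) [] e; move: k0 k1; rewrite e ltxx.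
    have : ~ is_end (k i x) by move/(ke x ix).
    move=> /not_orP[n0 n1]; have := Ux; rewrite /= in_itv /= !le_eqVlt eq_sym.
    by move=> /andP[/orP[/eqP//|->] /orP[/eqP//|->]].
- exact: sscale.
- move=> i j Pi Dij x y z ix iy iz jx jy /andP[xz zy].
  have [ph kc kh ki ke] := hk i Pi.
  have [Ux hx] := ki x ix; have [Uy hy] := ki y iy; have [Uz hz] := ki z iz.
  have le_ t t' : U t -> U t' -> F i t <= F i t' -> t <= t'.
    by move=> Ut Ut'; rewrite !leNgt (smono' i Pi).
  have [_ _ _ se] := ab i j Pi Dij.
  have : sent_into f h i j (k i x) by split=> //; rewrite hx.
  have : sent_into f h i j (k i y) by split=> //; rewrite hy.
  rewrite se /= !in_itv /= => /andP[_ yb] /andP[ax _].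
  have : sent_into f h i j (k i z).
    rewrite se /= in_itv /=; apply/andP; split.
      by apply: (le_trans ax); exact: le_.
    by apply: le_trans yb; exact: le_.
  by case; rewrite hz.
Qed.

End LengthCharts.

(** * Embedding the skeleton in a line *)

Section BinaryCode.
Context {R : realType}.
Variable delta : nat -> R.
Hypothesis delta0 : forall n, 0 < delta n.

(** The [n]-th weight is this minimum divided by [3 ^ n.+1]: it is below the
    required bounds and exceeds the sum of all later weights. *)
Fixpoint running_min n : R :=
  if n is m.+1 then Num.min (running_min m) (delta n) else Num.min 1 (delta 0).

Lemma running_min_gt0 n : 0 < running_min n.
Proof. by elim: n => [|n IH] /=; rewrite lt_min ?ltr01 ?IH delta0. Qed.

Lemma running_min_le n : running_min n <= delta n /\ running_min n <= 1.
Proof.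
elim: n => [|n [_ IH]] /=; rewrite !ge_min !lexx ?orbT /=; split=> //.
by rewrite IH.
Qed.

(* [tau n] bounds the sum of the weights [eps] from index [n] on. *)
Let tau n := running_min n * 3^-1 ^+ n / 2.
Let eps n := running_min n * 3^-1 ^+ n.+1.

Let p3 n : 0 < (3^-1 : R) ^+ n. Proof. by apply: exprn_gt0; rewrite invr_gt0. Qed.

Let tau_gt0 n : 0 < tau n.
Proof. by rewrite divr_gt0 // mulr_gt0 // running_min_gt0. Qed.

Let eps_gt0 n : 0 < eps n. Proof. by rewrite mulr_gt0 // running_min_gt0. Qed.

Let tauS n : tau n.+1 <= eps n / 2.
Proof.
rewrite /tau /eps ler_pM2r ?invr_gt0 // ler_pM2r //=.
by rewrite ge_min lexx.
Qed.

Let tau_eps n : eps n / 2 + eps n = tau n.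
Proof. by rewrite /tau /eps exprS; field. Qed.

Definition code_sum (x : nat -> bool) n := \sum_(k < n) (if x k then eps k else 0).
Definition code x := sup [set code_sum x n | n in [set: nat]].

Lemma code_sumS x n : code_sum x n.+1 = code_sum x n + (if x n then eps n else 0).
Proof. by rewrite /code_sum big_ord_recr. Qed.

Lemma code_sum_mono x m n : (m <= n)%N ->
  code_sum x m <= code_sum x n /\ code_sum x n + tau n <= code_sum x m + tau m.
Proof.
move=> /subnK <-; elim: (n - m)%N => [//|k [IH1 IH2]].
rewrite addSn code_sumS; have := eps_gt0 (k + m); have := tauS (k + m).
by have := tau_eps (k + m); case: ifP => _; split; lra.
Qed.

Lemma code_bounds x n : code_sum x n <= code x <= code_sum x n + tau n.
Proof.
have ub m : ubound [set code_sum x n | n in [set: nat]] (code_sum x m + tau m).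
  move=> _ [k _ <-]; have := tau_gt0 m; have := tau_gt0 k.
  have [km|/ltnW mk] := leqP k m.
    by have [h _] := code_sum_mono x km; lra.
  by have [_ h] := code_sum_mono x mk; lra.
apply/andP; split.
  by apply: ub_le_sup; [exists (code_sum x 0 + tau 0); exact: ub|exists n].
by apply: ge_sup; [exists (code_sum x 0), 0%N|exact: ub].
Qed.

(** The weights decrease so fast that the first digit in which two sequences
    differ decides which code is larger. *)
Lemma binary_code : exists cd : (nat -> bool) -> R,
  [/\ forall x y, cd x = cd y -> x =1 y &
      forall x y n, (forall k, (k < n)%N -> x k = y k) ->
        `|cd x - cd y| < delta n /\ `|cd x - cd y| <= 3^-1 ^+ n].
Proof.
have sumE x y n : (forall k, (k < n)%N -> x k = y k) -> code_sum x n = code_sum y n.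
  by move=> H; apply: eq_bigr => k _; rewrite H.
have sep (x y : nat -> bool) n : (forall k, (k < n)%N -> x k = y k) -> x n -> ~~ y n ->
    code y < code x.
  move=> H xn yn; have /andP[h1 _] := code_bounds x n.+1.
  have /andP[_ h2] := code_bounds y n.+1.
  move: h1 h2; rewrite !code_sumS (sumE x y n H) xn (negbTE yn).
  by have := tauS n; have := eps_gt0 n; lra.
exists code; split.
- move=> x y e; suff H n : forall k, (k < n)%N -> x k = y k by move=> k; exact: (H k.+1).
  elim: n => [//|n IH] k; rewrite ltnS leq_eqVlt => /orP[/eqP ->|/IH //].
  case xn: (x n); case yn: (y n) => //.
    by have := sep x y n IH xn (negbT yn); rewrite e ltxx.
  have IH' l : (l < n)%N -> y l = x l by move=> /IH.
  by have := sep y x n IH' yn (negbT xn); rewrite e ltxx.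
- move=> x y n H; have := code_bounds x n; have := code_bounds y n.
  rewrite (sumE x y n H) => /andP[? ?] /andP[? ?].
  have d : `|code x - code y| <= tau n by rewrite ler_norml; apply/andP; split; lra.
  have [r1 r2] := running_min_le n; have q1 : (3^-1 : R) ^+ n <= 1.
    by apply: exprn_ile1; [rewrite invr_ge0|rewrite invf_le1 // ler1n].
  have := p3 n; have := running_min_gt0 n; have := delta0 n.
  by split; apply: (le_lt_trans d) || apply: (le_trans d); rewrite /tau; nra.
Qed.

End BinaryCode.

Section SmallBalls.
Context {R : realType} {G : topologicalType}.
Hypothesis cG : compact [set: G].
Hypothesis mG : metrizable R G.
Variable P : set (set G).
Hypothesis tP : tame_partition R P.
Local Notation skel := (skeleton (R := R) P).

Let hG : hausdorff_space G. Proof. exact: (metrizable_hausdorff mG). Qed.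

(** The form in which the arcs of a tame partition being a null sequence is
    used. The open set [O'] makes the trace of [O] on the skeleton closed, so
    that its characteristic function is continuous there. *)
Definition traps_arcs (O : set G) (F : set (set G)) :=
  [/\ open O, exists2 O', open O' & O' `&` O = set0 /\ skel `\` O `<=` O',
      finite_set F & forall i, P i -> F i \/ i `<=` O \/ i `&` O = set0].

(** A ball will do if its sphere avoids the countable skeleton. The sphere is
    then compact and covered by the disjoint open interiors of arcs, so it meets
    finitely many arcs, and the others, being connected, cannot leave the ball. *)
Lemma trapping_neighbourhood (c : G) (V : set G) : nbhs c V ->
  exists O F, [/\ traps_arcs O F, O c & O `<=` V].
Proof.
have [d [d0 d1 dC dT dn]] := mG; move=> /dn[e e0 eV].
have dc : continuous (d c).
  apply/continuous_subspace_setT; apply/within_epsP => x _ r r0.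
  exists [set y | d x y < r]; first by apply/dn; exists r.
  move=> y /= xy _; have := dT c x y; have := dT c y x; rewrite (dC y x).
  by rewrite ltr_norml => ? ?; apply/andP; split; lra.
(* The radii of spheres through points of the skeleton are countably many. *)
have [r re nr] : exists2 r, 0 < r < e & forall x, skel x -> d c x <> r.
  apply: contrapT => nex; apply: (itv_uncountable e0).
  apply: (@countableS _ _ (d c @` skel)); last first.
    by apply: countable_image; exact: (skeleton_countable hG tP).
  move=> r /=; rewrite in_itv /= => r0e; apply: contrapT => nr; apply: nex.
  by exists r => // x sx xr; apply: nr; exists x.
have /andP[r0 re'] := re.
have oO : open [set y | d c y < r].
  have -> : [set y | d c y < r] = d c @^-1` [set x | x < r] by [].
  by apply: open_comp; [move=> x _; exact: dc|exact: open_lt].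
have oO' : open [set y | r < d c y].
  have -> : [set y | r < d c y] = d c @^-1` [set x | r < x] by [].
  by apply: open_comp; [move=> x _; exact: dc|exact: open_gt].
have cK : compact [set y | d c y = r].
  apply: (subclosed_compact _ cG) => //.
  have -> : [set y | d c y = r] = d c @^-1` [set r] by [].
  by apply: preimage_closed; [move=> x _; exact: dc|exact: closed_eq].
have [D DP KD] : finite_subset_cover P (arc_int R (X := G)) [set y | d c y = r].
  apply: (compact_covers cK); first by move=> i Pi; exact: (tame_int_open tP Pi).
  by move=> y /= yr; have [/nr|[i Pi iy]] := tame_skeletonP (R := R) P y; [|exists i].
exists [set y | d c y < r], [set` D]; split; last 2 first.
- by rewrite /= (d1 c c).2.
- by move=> y /= yr; apply: eV => /=; lra.
split=> //.
- exists [set y | r < d c y] => //; split.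
    by apply/seteqP; split=> // y [/= ? ?]; lra.
  move=> y [sy /= ny]; have := nr y sy; move: ny => /negP; rewrite -leNgt.
  by rewrite le_eqVlt => /orP[/eqP ->|].
- move=> i Pi; apply: contrapT => /not_orP[nD /not_orP[nO nd]].
  have [x ix xr] : exists2 x, i x & d c x < r.
    apply: contrapT => nex; apply: nd; apply/seteqP; split=> // x [ix /= xr].
    by apply: nex; exists x.
  have [y iy yr] : exists2 y, i y & r <= d c y.
    apply: contrapT => nex; apply: nO => y iy /=.
    by rewrite ltNge; apply/negP => yr; apply: nex; exists y.
  have [h ph] := tame_arc tP Pi.
  have ic : connected (d c @` i).
    apply: connected_continuous_connected; first exact: (arc_param_connected ph).
    by apply: continuous_subspaceT; exact: dc.
  have [z iz zr] : (d c @` i) r.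
    have /connected_intervalP ii := ic.
    by apply: (ii (d c x) (d c y)); [exists x|exists y|rewrite (ltW xr)].
  have [j Dj jz] := KD z zr; apply: nD => /=.
  have Pj : P j by apply/set_mem; exact: DP.
  by rewrite (tame_meets_int hG tP Pi Pj) //; exists z.
Qed.

(** One neighbourhood for each pair of points of the countable skeleton. *)
Lemma skeleton_separating_sequence : exists (W : nat -> set G) (F : nat -> set (set G)),
  (forall n, traps_arcs (W n) (F n)) /\
  forall c c', skel c -> skel c' -> c <> c' -> exists n, W n c /\ ~ W n c'.
Proof.
have traps_arcs0 : traps_arcs set0 set0.
  split; [exact: open0| |exact: finite_set0|].
    by exists setT; [exact: openT|rewrite setI0].
  by move=> i _; right; right; rewrite setI0.
have /countable_injP[g gi] := skeleton_countable hG tP.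
suff /choice[WF H] : forall n : nat, exists WF : set G * set (set G),
    traps_arcs WF.1 WF.2 /\ forall c c', skel c -> skel c' -> c <> c' ->
      choice.pickle (g c, g c') = n -> WF.1 c /\ ~ WF.1 c'.
  exists (fun n => (WF n).1), (fun n => (WF n).2).
  split=> [n|c c' sc sc' cc']; first exact: (H n).1.
  by exists (choice.pickle (g c, g c')); exact: (H _).2.
move=> n; have [[c [c' [sc sc' cc' e]]]|nex] := pselect (exists c c',
    [/\ skel c, skel c', c <> c' & choice.pickle (g c, g c') = n]); last first.
  exists (set0, set0); split=> // c c' sc sc' cc' e.
  by case: nex; exists c, c'.
have Vc : nbhs c (~` [set c']).
  apply: open_nbhs_nbhs; split; last by [].
  by apply: closed_openC; apply: compact_closed => //; exact: compact_set1.
have [Q [F [cO Oc OV]]] := trapping_neighbourhood Vc.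
exists (Q, F); split=> // b b' sb sb' _ e'.
have [e1 e2] : (g b, g b') = (g c, g c') by apply: (pcan_inj choice.pickleK); rewrite e.
have -> : b = c by apply: gi => //; exact/mem_set.
have -> : b' = c' by apply: gi => //; exact/mem_set.
by split=> // /OV; exact.
Qed.

(** A point is coded by the sets of the separating sequence that contain it. As
    every such set cuts only finitely many arcs, its weight can be chosen so
    small that the ends of each arc are as close as wanted. *)
Lemma skeleton_coordinate (w : set G -> R) : (forall i, P i -> 0 < w i) ->
  exists e : G -> R, [/\ {in skel &, injective e},
    forall c, skel c -> forall r, 0 < r ->
      exists2 W, nbhs c W & forall c', skel c' -> W c' -> `|e c - e c'| < r &
    forall i a b, P i -> i a -> i b -> skel a -> skel b -> a <> b -> `|e a - e b| < w i].
Proof.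
move=> w0; have [W [F [cW sW]]] := skeleton_separating_sequence.
have /choice[delta dP] : forall n, exists r : R, 0 < r /\
    forall i, P i -> F n i -> r <= w i.
  move=> n; have [_ _ finF _] := cW n.
  pose s := finmap.enum_fset (fset_set (F n)).
  exists (\big[Num.min/1]_(i <- s) (if `[< P i >] then w i else 1)); split.
    by apply: lt_bigmin => // i _; case: asboolP => // /w0.
  move=> i Pi Fi; have si : i \in s.
    by have := in_fset_set finF i; rewrite (mem_set Fi).
  apply: bigmin_inf_seq si _ _ => //.
  by case: asboolP.
have [cd [cdi cdd]] := binary_code (fun n => (dP n).1).
exists (fun c => cd (fun n => `[< W n c >])); split.
- move=> a b /set_mem sa /set_mem sb /cdi e; apply: contrapT => ab.
  have [n [Wa nWb]] := sW a b sa sb ab; apply: nWb.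
  by apply/asboolP; rewrite -(e n); apply/asboolP.
- move=> c sc r r0.
  have [n nr] : exists n, (3^-1 : R) ^+ n < r.
    have : (fun n => (3^-1 : R) ^+ n) @ \oo --> (0 : R).
      by apply: cvg_expr; rewrite gtr0_norm ?invr_gt0 // invf_lt1 // ltr1n.
    move=> /cvgrPdist_lt /(_ r r0) [n _ /(_ n (leqnn _))] /=.
    by rewrite sub0r normrN => /ltr_normlW; exists n.
  have /choice[Q OP] : forall k, exists O, nbhs c O /\
      forall c', skel c' -> O c' -> `[< W k c >] = `[< W k c' >].
    move=> k; have [oW [B oB [BW sB]] _ _] := cW k.
    have [Wc|nWc] := pselect (W k c).
      exists (W k); split; first exact: open_nbhs_nbhs.
      by move=> c' sc' Wc'; rewrite !asboolT.
    exists B; split; first by apply: open_nbhs_nbhs; split=> //; apply: sB.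
    move=> c' sc' Oc'; rewrite !asboolF // => Wc'.
    by have : (B `&` W k) c' by []; rewrite BW.
  exists (\bigcap_(k in [set k | (k < n)%N]) Q k).
    pose I := [fset k in iota 0 n]%fset.
    have B : nbhs c (\bigcap_(k in [set` I]) Q k).
      by apply: filter_bigI => k _; exact: (OP k).1.
    by apply: filterS B => x H k kn; apply: H; rewrite /= !inE /= mem_iota.
  move=> c' sc' Oc'; apply: le_lt_trans nr.
  apply: (cdd _ _ _ _).2 => k kn; apply: (OP k).2 => //.
  exact: Oc'.
- move=> i a b Pi ia ib sa sb ab.
  have [n [nab nP]] : exists n, `[< W n a >] <> `[< W n b >] /\
      forall k, (k < n)%N -> `[< W k a >] = `[< W k b >].
    have ex : exists n, `[< W n a >] != `[< W n b >].
      have [n [Wa nWb]] := sW a b sa sb ab; exists n.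
      by rewrite (asboolT Wa) (asboolF nWb).
    exists (ex_minn ex); case: ex_minnP => m /eqP mab mmin; split=> // k km.
    by apply/eqP; apply: contraTT km => /mmin; rewrite -leqNgt.
  apply: lt_le_trans ((cdd _ _ _ nP).1) _; apply: (dP n).2 => //.
  have [_ _ _ /(_ i Pi) [//|[iW|iW]]] := cW n; case: nab.
    by rewrite !asboolT; [|exact: iW|exact: iW].
  rewrite !asboolF // => Wx.
    by have : (i `&` W n) b by []; rewrite iW.
  by have : (i `&` W n) a by []; rewrite iW.
Qed.

End SmallBalls.

(** * Embedding a tame graph with prescribed lengths *)

Lemma finite_large_terms {R : realType} {I : choiceType} (P : set I) (v : I -> R) (S r : R) :
  \esum_(j in P) (v j)%:E = S%:E -> (forall j, P j -> 0 <= v j) -> 0 < r ->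
  finite_set [set j | P j /\ r <= v j].
Proof.
move=> vS v0 r0; have r2 : 0 < r / 2 by rewrite divr_gt0.
have [s [us sP sH]] := rsum_approx vS r2 v0.
apply: (@sub_finite_set _ _ [set` s]); last exact: finite_seq.
move=> j [Pj rj] /=; apply: contrapT => /negP js.
pose x k := if k \in s then 0 else v k.
have dx : dominated P v x.
  by move=> k Pk; rewrite /x; case: ifP => _; rewrite ?lexx ?v0.
have := sH x dx; rewrite big_seq big1 ?subr0; last by move=> k ks; rewrite /x ks.
move=> /ler_normlW h; have : ((v j)%:E <= (rsum P x)%:E)%E.
  rewrite -(rsumE vS dx); have -> : v j = x j by rewrite /x (negbTE js).
  apply: (@esum_ge_term _ _ P (fun k => (x k)%:E)) => // k Pk.
  by rewrite lee_fin; case/andP: (dx k Pk).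
rewrite lee_fin; lra.
Qed.

Section Embedding.
Context {R : realType} {G : topologicalType}.
Hypothesis mG : metrizable R G.
Variable P : set (set G).
Hypothesis tP : tame_partition R P.
Variables (v : set G -> R) (s : set G -> G -> R).
Hypothesis v0 : forall i, P i -> 0 < v i.
Hypothesis sP : forall i, P i -> [/\ {within i, continuous (s i)}, {in i &, injective (s i)},
  s i @` i = `[0, v i]%classic & forall x, i x -> (0 < s i x < v i <-> arc_int R i x)].
Local Notation skel := (skeleton (R := R) P).
Let hG : hausdorff_space G. Proof. exact: (metrizable_hausdorff mG). Qed.

Lemma chart_itv i x : P i -> i x -> 0 <= s i x <= v i.
Proof.
move=> Pi ix; have [_ _ si _] := sP Pi.
have : (s i @` i) (s i x) by exists x.
by rewrite si /= in_itv.
Qed.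

Lemma skeleton_of_end i x : P i -> i x -> ~ arc_int R i x -> skel x.
Proof.
move=> Pi ix nx [j Pj jx]; apply: nx.
by rewrite (tame_meets_int hG tP Pi Pj) //; exists x.
Qed.

Lemma chart_ends : G -> exists lohi : set G -> G * G, forall i, P i ->
  [/\ i (lohi i).1 /\ s i (lohi i).1 = 0, i (lohi i).2 /\ s i (lohi i).2 = v i,
      skel (lohi i).1, skel (lohi i).2 &
      forall x, i x -> skel x -> x = (lohi i).1 \/ x = (lohi i).2].
Proof.
move=> x0; pose Q i (lh : G * G) := P i -> [/\ i lh.1 /\ s i lh.1 = 0,
  i lh.2 /\ s i lh.2 = v i, skel lh.1, skel lh.2 &
  forall x, i x -> skel x -> x = lh.1 \/ x = lh.2].
suff /choice[lh H] : forall i, exists lh, Q i lh by exists lh => i; exact: H.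
move=> i; have [Pi|nPi] := pselect (P i); last by exists (x0, x0).
have [_ sinj si sint] := sP Pi; have vi := v0 Pi.
have [a ia sa] : (s i @` i) 0 by rewrite si /= in_itv /= lexx ltW.
have [b ib sb] : (s i @` i) (v i) by rewrite si /= in_itv /= lexx ltW.
exists (a, b) => _; split=> //=.
- by apply: (skeleton_of_end Pi ia) => /(sint a ia); rewrite sa ltxx.
- by apply: (skeleton_of_end Pi ib) => /(sint b ib); rewrite sb ltxx andbF.
move=> x ix sx; have nx : ~ arc_int R i x by move=> xi; apply: sx; exists i.
have /andP[] := chart_itv Pi ix; rewrite !le_eqVlt => /orP[/eqP e0|e0].
  by left; apply: sinj; [exact/mem_set|exact/mem_set|rewrite sa -e0].
move=> /orP[/eqP e1|e1].
  by right; apply: sinj; [exact/mem_set|exact/mem_set|rewrite sb e1].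
by case: nx; apply/(sint x ix); rewrite e0.
Qed.

Variable lohi : set G -> G * G.
Hypothesis lohiP : forall i, P i ->
  [/\ i (lohi i).1 /\ s i (lohi i).1 = 0, i (lohi i).2 /\ s i (lohi i).2 = v i,
      skel (lohi i).1, skel (lohi i).2 &
      forall x, i x -> skel x -> x = (lohi i).1 \/ x = (lohi i).2].

Lemma interior_arc : exists home : G -> set G,
  forall x, ~ skel x -> P (home x) /\ arc_int R (home x) x.
Proof.
suff /choice[home H] : forall x, exists i, ~ skel x -> P i /\ arc_int R i x.
  by exists home.
move=> x; have [sx|[i Pi ix]] := tame_skeletonP (R := R) P x.
  by exists set0.
by exists i.
Qed.

Variable home : G -> set G.
Hypothesis homeP : forall x, ~ skel x -> P (home x) /\ arc_int R (home x) x.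

Section Gluing.
Variables (b : G -> R) (phi : set G -> R -> R).
Hypothesis phi_lo : forall i, P i -> phi i 0 = b (lohi i).1.
Hypothesis phi_hi : forall i, P i -> phi i (v i) = b (lohi i).2.
Hypothesis phi_cont : forall i, P i -> continuous (phi i).

Definition piecewise x := if `[< skel x >] then b x else phi (home x) (s (home x) x).

Lemma piecewise_skeleton x : skel x -> piecewise x = b x.
Proof. by move=> sx; rewrite /piecewise asboolT. Qed.

Lemma piecewise_arc i x : P i -> i x -> piecewise x = phi i (s i x).
Proof.
move=> Pi ix; have [[_ s0] [_ s1] sl sh ends] := lohiP Pi.
rewrite /piecewise; case: asboolP => [sx|nsx].
  by have [->|->] := ends x ix sx; rewrite ?s0 ?s1 ?phi_lo ?phi_hi.
have [Pj jx] := homeP nsx; rewrite (_ : home x = i) //; apply/esym.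
by apply: (tame_meets_int hG tP) => //; exists x.
Qed.

(** Near a point of the skeleton the finitely many exceptional arcs can be
    treated one at a time, by continuity along each of them, and the others
    uniformly. *)
Lemma piecewise_continuous :
  (forall c, skel c -> forall r, 0 < r -> exists W F, [/\ nbhs c W, finite_set F,
    forall c', skel c' -> W c' -> `|b c - b c'| < r &
    forall i x, P i -> ~ F i -> i x -> W x -> `|b c - phi i (s i x)| < r]) ->
  continuous piecewise.
Proof.
move=> H; have arc_cont i : P i -> {within i, continuous piecewise}.
  move=> Pi; have [sc _ _ _] := sP Pi; have [h ph] := tame_arc tP Pi.
  have c : {within i, continuous (phi i \o s i)}.
    apply: (@within_continuous_compose _ _ _ _ setT (s i) (phi i)) => //.
    - exact: (arc_param_closed hG ph).
    - by apply: continuous_subspaceT => t; apply: (phi_cont Pi).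
  apply/within_epsP => x ix r r0; have [W Wx HW] := (within_epsP _ _).1 c x ix r r0.
  by exists W => // y Wy iy; rewrite (piecewise_arc Pi ix) (piecewise_arc Pi iy); exact: HW.
apply/continuous_subspace_setT; apply/within_epsP => c _ r r0.
have [sc|[i Pi ic]] := tame_skeletonP (R := R) P c; last first.
  have [W Wc HW] := (within_epsP _ _).1 (arc_cont i Pi) c (arc_int_subset ic) r r0.
  exists (W `&` arc_int R i); last by move=> y [Wy [iy _]] _; exact: HW.
  apply: filterI => //; apply: open_nbhs_nbhs; split=> //.
  exact: (tame_int_open tP Pi).
have [W [F [Wc finF Wb Wphi]]] := H c sc r r0.
have /choice[Q QP] : forall i, exists Q, nbhs c Q /\
    (P i -> forall y, Q y -> i y -> `|piecewise c - piecewise y| < r).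
  move=> i; have [Pi|nPi] := pselect (P i); last by exists setT; split=> //; exact: filterT.
  have [ic|nic] := pselect (i c).
    have [Q Qc HQ] := (within_epsP _ _).1 (arc_cont i Pi) c ic r r0.
    by exists Q; split=> // _ y Qy iy; exact: HQ.
  exists (~` i); split; last by move=> _ y.
  apply: open_nbhs_nbhs; split=> //; apply: closed_openC.
  by have [h ph] := tame_arc tP Pi; exact: (arc_param_closed hG ph).
have Qc : nbhs c (\bigcap_(i in [set` fset_set F]) Q i).
  by apply: filter_bigI => i _; exact: (QP i).1.
exists (W `&` \bigcap_(i in [set` fset_set F]) Q i); first exact: filterI.
move=> y [Wy Qy] _; have [sy|[i Pi iy]] := tame_skeletonP (R := R) P y.
  by rewrite !piecewise_skeleton //; exact: Wb.
have iy' := arc_int_subset iy.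
have [Fi|nFi] := pselect (F i).
  apply: (QP i).2 => //; apply: Qy => /=.
  by rewrite in_fset_set //; exact/mem_set.
by rewrite (piecewise_skeleton sc) (piecewise_arc Pi iy'); exact: Wphi.
Qed.

End Gluing.

End Embedding.

Section Vectors.
Context {R : realType}.

Definition vec3 (a b c : R) : 'rV[R]_3 := \row_k [:: a; b; c]`_k.

Lemma vec3_inj a b c a' b' c' : vec3 a b c = vec3 a' b' c' ->
  [/\ a = a', b = b' & c = c'].
Proof.
move=> /rowP e; have := e (inord 0); have := e (inord 1); have := e (inord 2).
by rewrite !mxE !inordK //= => -> -> ->.
Qed.

Lemma vec3_line a b c a' b' c' t :
  vec3 a b c + t *: vec3 a' b' c' = vec3 (a + t * a') (b + t * b') (c + t * c').
Proof. by apply/rowP => k; rewrite !mxE; case: k => -[|[|[]]]. Qed.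

Lemma vec3_continuous (X : topologicalType) (p q r : X -> R) :
  continuous p -> continuous q -> continuous r ->
  continuous (fun x => vec3 (p x) (q x) (r x)).
Proof.
move=> pc qc rc x A [B Bn BA].
pose W k := (fun y => vec3 (p y) (q y) (r y) ord0 k) @^-1` B ord0 k.
have Wn k : nbhs x (W k).
  pose T k := B ord0 k; have := Bn ord0 k; rewrite /W -/(T k).
  case: k => -[|[|[|//]]] kl /=; rewrite mxE /= => Bk.
  - have h : nbhs x (p @^-1` T (Ordinal kl)) by exact: pc.
    by apply: filterS h => y; rewrite /preimage /= mxE.
  - have h : nbhs x (q @^-1` T (Ordinal kl)) by exact: qc.
    by apply: filterS h => y; rewrite /preimage /= mxE.
  - have h : nbhs x (r @^-1` T (Ordinal kl)) by exact: rc.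
    by apply: filterS h => y; rewrite /preimage /= mxE.
have h : nbhs x (W (inord 0) `&` (W (inord 1) `&` W (inord 2))).
  by do 2?apply: filterI => //.
suff : nbhs x ((fun x => vec3 (p x) (q x) (r x)) @^-1` A) by [].
apply: filterS h => y [W0 [W1 W2]]; apply: BA => i k; rewrite (ord1 i).
have kE : k = inord k by rewrite inord_val.
by rewrite kE; case: k {kE} => -[|[|[|//]]] kl /=.
Qed.

Lemma vec3_norm a b c : \sum_(k < 3) (vec3 a b c ord0 k) ^+ 2 = a ^+ 2 + b ^+ 2 + c ^+ 2.
Proof. by rewrite !big_ord_recl big_ord0 !mxE /= addr0 addrA. Qed.

(** The rational parametrization of the circle. *)
Definition circle_x (t : R) := (1 - t ^+ 2) / (1 + t ^+ 2).
Definition circle_y (t : R) := (2 * t) / (1 + t ^+ 2).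

Let den (t : R) : 0 < 1 + t ^+ 2. Proof. by have := sqr_ge0 t; lra. Qed.

Lemma circle_norm t : circle_x t ^+ 2 + circle_y t ^+ 2 = 1.
Proof. by rewrite /circle_x /circle_y; field; apply: lt0r_neq0. Qed.

Lemma circle_inj t u : circle_x t = circle_x u -> circle_y t = circle_y u -> t = u.
Proof.
have E w : circle_x w + 1 = 2 / (1 + w ^+ 2).
  by rewrite /circle_x; field; apply: lt0r_neq0.
have F w : circle_y w = w * (circle_x w + 1).
  by rewrite E /circle_y; field; apply: lt0r_neq0.
have N w : circle_x w + 1 != 0.
  by rewrite E; apply: lt0r_neq0; rewrite divr_gt0.
by move=> ex; rewrite !F ex => /mulIf; apply.
Qed.

End Vectors.

Section Tents.
Context {R : realType} {G : topologicalType}.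
Hypothesis cG : compact [set: G].
Hypothesis mG : metrizable R G.
Variable P : set (set G).
Hypothesis tP : tame_partition R P.
Variables (v : set G -> R) (s : set G -> G -> R) (S : R).
Hypothesis vS : \esum_(j in P) (v j)%:E = S%:E.
Hypothesis v0 : forall i, P i -> 0 < v i.
Hypothesis sP : forall i, P i -> [/\ {within i, continuous (s i)}, {in i &, injective (s i)},
  s i @` i = `[0, v i]%classic & forall x, i x -> (0 < s i x < v i <-> arc_int R i x)].
Hypothesis P0 : P !=set0.
Local Notation skel := (skeleton (R := R) P).
Let hG : hausdorff_space G. Proof. exact: (metrizable_hausdorff mG). Qed.

Definition in_half i (upper : bool) (t : R) :=
  if upper then v i / 2 <= t <= v i else 0 <= t <= v i / 2.

(** Each arc becomes a tent over a segment of the line carrying the skeleton: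
    it has the prescribed length, and distinct arcs live in distinct half
    planes bounded by that line, which keeps them apart. The two sides of the
    tent are of equal length, so each half of an arc becomes straight, with the
    chart as arc length: the direction [D] is a unit vector. *)
Lemma tame_embedding : exists Phi : G -> 'rV[R]_3,
  [/\ continuous Phi, injective Phi &
      forall i (u : bool), P i -> exists A D : 'rV[R]_3,
        \sum_(k < 3) (D ord0 k) ^+ 2 = 1 /\
        forall x, i x -> in_half i u (s i x) -> Phi x = A + s i x *: D].
Proof.
have [i0 Pi0] := P0; have [arc0 _] := tame_arc tP Pi0.
have [e [einj econt eclose]] := skeleton_coordinate cG mG tP v0.
have [lohi lohiP] := chart_ends mG tP v0 sP (arc0 0).
have [home homeP] := interior_arc P (R := R).
have [cP _ _ _] := tP; have /countable_injP[g gi] := cP.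
pose Delta i := e (lohi i).2 - e (lohi i).1.
(* [a i] is the slope of the tent along the line and [H i] its slope upwards. *)
pose a i := Delta i / v i.
pose H i := Num.sqrt (1 - a i ^+ 2).
(* Numbering the arcs gives each its own direction of half plane. *)
pose cx i := circle_x (g i)%:R : R; pose cy i := circle_y (g i)%:R : R.
have neq i : P i -> (lohi i).1 <> (lohi i).2.
  move=> Pi; have [[_ s0] [_ s1] _ _ _] := lohiP i Pi => E.
  by have := v0 Pi; rewrite -s1 -E s0 ltxx.
have Dlt i : P i -> `|Delta i| < v i.
  move=> Pi; have [[l0 _] [l1 _] sl sh _] := lohiP i Pi.
  by rewrite /Delta distrC; apply: eclose => //; exact: neq.
have a1 i : P i -> a i ^+ 2 < 1.
  move=> Pi; have vi := v0 Pi; rewrite -real_normK ?num_real // expr_lt1 //.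
  by rewrite normrM normfV (gtr0_norm vi) ltr_pdivrMr // mul1r Dlt.
have a0 i : P i -> a i != 0.
  move=> Pi; have vi := v0 Pi; apply: mulf_neq0; last by rewrite invr_neq0 // gt_eqF.
  have [_ _ sl sh _] := lohiP i Pi.
  rewrite subr_eq0; apply/eqP => E; apply: (neq i Pi).
  by apply: einj; [exact/mem_set|exact/mem_set|rewrite E].
have H0 i : P i -> 0 < H i by move=> Pi; rewrite sqrtr_gt0 subr_gt0 a1.
have HH i : P i -> a i ^+ 2 + H i ^+ 2 = 1.
  by move=> Pi; rewrite sqr_sqrtr; [lra|rewrite subr_ge0 ltW ?a1].
pose p0 := piecewise P s home e (fun i t => e (lohi i).1 + t * a i) (R := R).
pose tent (c : set G -> R) i t := c i * Num.min t (v i - t).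
pose p c := piecewise P s home (fun=> 0) (tent c) (R := R).
have min_itv i t : 0 <= t <= v i -> 0 <= Num.min t (v i - t) <= v i.
  move=> /andP[t0 t1]; rewrite le_min t0 subr_ge0 t1 /=.
  by rewrite ge_min t1.
have tent_lo c i : P i -> tent c i 0 = 0.
  by move=> Pi; rewrite /tent subr0 (min_idPl (ltW (v0 Pi))) mulr0.
have tent_hi c i : P i -> tent c i (v i) = 0.
  by move=> Pi; rewrite /tent subrr (min_idPr (ltW (v0 Pi))) mulr0.
have p0_lo i : P i -> e (lohi i).1 + 0 * a i = e (lohi i).1.
  by move=> _; rewrite mul0r addr0.
have p0_hi i : P i -> e (lohi i).1 + v i * a i = e (lohi i).2.
  by move=> Pi; rewrite /a /Delta mulrCA divff ?mulr1 ?gt_eqF ?v0 //; lra.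
have p0c : continuous p0.
  apply: (piecewise_continuous mG tP sP lohiP homeP p0_lo p0_hi).
    move=> i Pi t; apply: cvgD; first exact: cvg_cst.
    by apply: cvgM; [exact: cvg_id|exact: cvg_cst].
  move=> c sc r r0; have [W Wc HW] := econt c sc r r0.
  have [Q [F [[oQ _ finF QP] Qc QW]]] := trapping_neighbourhood cG mG tP Wc.
  exists Q, F; split=> //; first exact: open_nbhs_nbhs.
    by move=> c' sc' /QW; exact: HW.
  move=> i x Pi nFi ix Qx.
  have [[l0 _] [l1 _] sl sh _] := lohiP i Pi.
  have [//|[iQ|iQ]] := QP i Pi; last by have : (i `&` Q) x by []; rewrite iQ.
  have h0 := HW _ sl (QW _ (iQ _ l0)); have h1 := HW _ sh (QW _ (iQ _ l1)).
  have vi := v0 Pi; have /andP[t0 t1] := chart_itv sP Pi ix.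
  have -> : e (lohi i).1 + s i x * a i =
      e (lohi i).1 + (s i x / v i) * Delta i by rewrite /a; field; apply: lt0r_neq0.
  have th0 : 0 <= s i x / v i by rewrite divr_ge0 // ltW.
  have th1 : s i x / v i <= 1 by rewrite ler_pdivrMr // mul1r.
  move: h0 h1; rewrite /Delta !ltr_norml => /andP[? ?] /andP[? ?].
  (* The value on the arc is a convex combination of the values at its ends. *)
  have conv x1 x2 th : 0 <= th <= 1 -> 0 < x1 -> 0 < x2 -> 0 < (1 - th) * x1 + th * x2 :> R.
    move=> /andP[h0 h1] g1 g2; have [->|n1] := eqVneq th 1; first lra.
    have lt1 : th < 1 by rewrite lt_neqAle n1.
    by apply: ltr_wpDr; [rewrite mulr_ge0 // ltW|rewrite mulr_gt0 // subr_gt0].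
  have th01 : 0 <= s i x / v i <= 1 by rewrite th0.
  have := conv (r + (e c - e (lohi i).1)) (r + (e c - e (lohi i).2)) _ th01.
  have := conv (r - (e c - e (lohi i).1)) (r - (e c - e (lohi i).2)) _ th01.
  move: (s i x / v i) => th u1 u2; apply/andP; split.
    by have : 0 < r + (e c - e (lohi i).1) by [lra]; move=> /u2 k; have := k ltac:(lra); lra.
  by have : 0 < r - (e c - e (lohi i).1) by [lra]; move=> /u1 k; have := k ltac:(lra); lra.
have pc c : (forall i, P i -> `|c i| <= 1) -> continuous (p c).
  move=> c1; apply: (piecewise_continuous mG tP sP lohiP homeP (tent_lo c) (tent_hi c)).
    move=> i Pi t; apply: cvgM; first exact: cvg_cst.
    apply: (@continuous_min _ _ id (fun t => v i - t)); first exact: cvg_id.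
    by apply: cvgB; [exact: cvg_cst|exact: cvg_id].
  move=> x sx r r0; exists setT, [set i | P i /\ r <= v i]; split.
  - exact: filterT.
  - by apply: (finite_large_terms vS) => // j /v0/ltW.
  - by move=> c' _ _; rewrite subrr normr0.
  move=> i y Pi nFi iy _.
  have /andP[m0 m1] := min_itv i _ (chart_itv sP Pi iy).
  rewrite sub0r normrN normrM (ger0_norm m0).
  have vr : v i < r by rewrite ltNge; apply/negP => rv; apply: nFi.
  apply: le_lt_trans vr; apply: le_trans m1.
  by rewrite -[leRHS]mul1r ler_wpM2r // c1.
pose hx i := H i * cx i; pose hy i := H i * cy i.
have cc i : cx i ^+ 2 + cy i ^+ 2 = 1 by exact: circle_norm.
have h1 i : P i -> hx i ^+ 2 + hy i ^+ 2 = H i ^+ 2.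
  by move=> Pi; rewrite -[RHS]mulr1 -(cc i) /hx /hy; ring.
have H1 i : P i -> H i ^+ 2 <= 1.
  by move=> Pi; have := HH i Pi; have := sqr_ge0 (a i); lra.
have le1 (z : R) : z ^+ 2 <= 1 -> `|z| <= 1.
  by move=> z1; rewrite -(@expr_le1 _ 2) // real_normK ?num_real.
have hxc : continuous (p hx).
  apply: pc => i Pi; apply: le1; have := h1 i Pi; have := H1 i Pi.
  by have := sqr_ge0 (hy i); lra.
have hyc : continuous (p hy).
  apply: pc => i Pi; apply: le1; have := h1 i Pi; have := H1 i Pi.
  by have := sqr_ge0 (hx i); lra.
have p0E i x : P i -> i x -> p0 x = e (lohi i).1 + s i x * a i.
  exact: (piecewise_arc mG tP lohiP homeP p0_lo p0_hi).
have pE c i x : P i -> i x -> p c x = tent c i (s i x).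
  exact: (piecewise_arc mG tP lohiP homeP (tent_lo c) (tent_hi c)).
exists (fun x => vec3 (p0 x) (p hx x) (p hy x)); split.
- exact: vec3_continuous.
- pose m i x := Num.min (s i x) (v i - s i x).
  have m_gt0 i x : P i -> arc_int R i x -> 0 < m i x.
    move=> Pi ix; have [_ _ _ /(_ x (arc_int_subset ix)) si] := sP Pi.
    by have /andP[? ?] := si.2 ix; rewrite lt_min subr_gt0; apply/andP.
  have height i x : P i -> arc_int R i x -> p hx x ^+ 2 + p hy x ^+ 2 = (H i * m i x) ^+ 2.
    move=> Pi /arc_int_subset ix; rewrite !(pE _ _ _ Pi ix) /tent -/(m i x).
    by rewrite -[RHS]mulr1 -(cc i) /hx /hy; ring.
  have flat x : skel x -> p hx x ^+ 2 + p hy x ^+ 2 = 0.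
    by move=> sx; rewrite /p !piecewise_skeleton // !expr0n addr0.
  have pos i x : P i -> arc_int R i x -> 0 < H i * m i x.
    by move=> Pi ix; rewrite mulr_gt0 ?H0 ?m_gt0.
  move=> x y /vec3_inj[e0 e1 e2].
  have [sx|[i Pi ix]] := tame_skeletonP (R := R) P x;
    have [sy|[j Pj jy]] := tame_skeletonP (R := R) P y.
  + move: e0; rewrite /p0 !piecewise_skeleton // => e0.
    by apply: einj => //; exact/mem_set.
  + have := flat x sx; rewrite e1 e2 (height j) //.
    by move=> /eqP; rewrite sqrf_eq0 gt_eqF ?pos.
  + have := flat y sy; rewrite -e1 -e2 (height i) //.
    by move=> /eqP; rewrite sqrf_eq0 gt_eqF ?pos.
  have eh : H i * m i x = H j * m j y.
    apply/eqP; rewrite -(@eqrXn2 _ 2) ?ltW ?pos //.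
    by rewrite -(height i) // -(height j) // e1 e2.
  have [ix' jy'] := (arc_int_subset ix, arc_int_subset jy).
  have ij : i = j.
    move: e1 e2; rewrite !(pE _ _ _ Pi ix') !(pE _ _ _ Pj jy') /tent -/(m i x) -/(m j y).
    move=> e1 e2; have nz : H j * m j y != 0 by rewrite gt_eqF ?pos.
    have E1 : H j * m j y * cx i = H j * m j y * cx j.
      by rewrite -{1}eh (mulrAC (H i)) (mulrAC (H j)); exact: e1.
    have E2 : H j * m j y * cy i = H j * m j y * cy j.
      by rewrite -{1}eh (mulrAC (H i)) (mulrAC (H j)); exact: e2.
    have := circle_inj (mulfI nz E1) (mulfI nz E2); move=> /eqP; rewrite eqr_nat => /eqP.
    by apply: gi; exact/mem_set.
  subst j; move: e0; rewrite (p0E _ _ Pi ix') (p0E _ _ Pi jy') => /addrI /mulIf.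
  move=> /(_ (a0 i Pi)); have [_ si _ _] := sP Pi.
  by apply: si; exact/mem_set.
- move=> i u Pi; exists (vec3 (e (lohi i).1) (if u then hx i * v i else 0) (if u then hy i * v i else 0)).
  exists (vec3 (a i) (if u then - hx i else hx i) (if u then - hy i else hy i)); split.
    rewrite vec3_norm -(HH i Pi) -(h1 i Pi) -addrA; congr (_ + _).
    by case: u; rewrite ?sqrrN.
  move=> x ix hu; rewrite vec3_line (p0E _ _ Pi ix) !(pE _ _ _ Pi ix) /tent.
  case: u hu => /= /andP[t0 t1]; congr vec3.
  + by rewrite (min_idPr _); [ring|lra].
  + by rewrite (min_idPr _); [ring|lra].
  + by rewrite (min_idPl _); [ring|lra].
  + by rewrite (min_idPl _); [ring|lra].
Qed.

End Tents.

(** * Invariance under homeomorphisms *)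

Section Transport.
Context {R : realType} {X Y : topologicalType}.
Variables (phi : X -> Y) (psi : Y -> X).
Hypothesis phic : continuous phi.
Hypothesis psic : continuous psi.
Hypothesis phiK : cancel phi psi.
Hypothesis psiK : cancel psi phi.

Lemma image_homeo (A : set X) : phi @` A = psi @^-1` A.
Proof.
apply/seteqP; split=> [_ [x Ax <-]|y Ay]; first by rewrite /preimage /= phiK.
by exists (psi y) => //; rewrite psiK.
Qed.

Lemma homeo_open (A : set X) : open A -> open (phi @` A).
Proof. by rewrite image_homeo => oA; apply: open_comp => // x _; exact: psic. Qed.

Lemma homeo_closed (A : set X) : closed A -> closed (phi @` A).
Proof. by rewrite image_homeo => cA; apply: preimage_closed => // x _; exact: psic. Qed.

Lemma homeo_nbhs (x : X) (V : set Y) : nbhs (phi x) V -> nbhs x (phi @^-1` V).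
Proof. exact: phic. Qed.

Lemma homeo_arc_param a (h : R -> X) : arc_param a h -> arc_param (phi @` a) (phi \o h).
Proof.
move=> [hc ha [k [kc kh]]]; split.
- move=> t; apply: (@continuous_comp (subspace _) X Y h phi); first exact: hc.
  exact: phic.
- by rewrite -ha image_comp.
exists (k \o psi); split; last by move=> t Ut /=; rewrite phiK kh.
apply/continuousP => U oU.
have [V oV e] := within_openP kc oU.
apply/open_subspaceP; exists (psi @^-1` V).
  by apply: open_comp => // x _; exact: psic.
rewrite !image_homeo; apply/seteqP; split=> y [/= h1 h2]; split=> //.
  by have [] : (a `&` k @^-1` U) (psi y) by rewrite e.
by have [] : (a `&` V) (psi y) by rewrite -e.
Qed.

Lemma homeo_arc a : Defs.arc R a -> Defs.arc R (phi @` a).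
Proof. by move=> [h ph]; exists (phi \o h); exact: homeo_arc_param. Qed.

Lemma homeo_closure (A : set X) : closure (phi @` A) = phi @` closure A.
Proof.
apply/seteqP; split.
  have /closure_id -> := homeo_closed (@closed_closure _ A).
  by apply: closureS; apply: image_subset; exact: subset_closure.
move=> _ [x xA <-] V /phic /xA [z [Az Vz]].
by exists (phi z); split=> //; exists z.
Qed.

Lemma homeo_interior (A : set X) : (phi @` A)^° = phi @` A^°.
Proof.
apply/seteqP; split=> [y iy|_ [x ix <-]].
  exists (psi y); last exact: psiK.
  have : nbhs (phi (psi y)) (phi @` A) by rewrite psiK.
  move=> /homeo_nbhs; apply: filterS => z /= [w Aw /(can_inj phiK) <-] //.
have : nbhs (psi (phi x)) A by rewrite phiK.
by move=> /psic; rewrite image_homeo.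
Qed.

Lemma homeo_boundary (A : set X) : boundary (phi @` A) = phi @` boundary A.
Proof.
rewrite /boundary homeo_closure homeo_interior !image_homeo.
by apply/seteqP; split.
Qed.

Lemma homeo_order_le (x : X) (U : Type) (B : set U) :
  order_le x B -> order_le (phi x) B.
Proof.
move=> H V /phic /H [W [oW Wx WV bW]]; exists (phi @` W); split.
- exact: homeo_open.
- by exists x.
- by move=> _ [w /WV ? <-].
by rewrite homeo_boundary; apply: card_le_trans bW; exact: card_image_le.
Qed.

Lemma homeo_metrizable : metrizable R X -> metrizable R Y.
Proof.
move=> [d [d0 d1 dC dT dn]]; exists (fun y z => d (psi y) (psi z)); split=> //.
- by move=> y z; rewrite d1; split=> [/(can_inj psiK)|->].
- move=> y A; split=> [|[e e0 H]].
    rewrite -{1}(psiK y) => /phic /dn[e e0 H]; exists e => // z /H.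
    by rewrite /preimage /= psiK.
  have /dn nA : exists2 e, 0 < e & [set z | d (psi y) z < e] `<=` psi @` A.
    exists e => // z dz; exists (phi z); last by rewrite phiK.
    by apply: H; rewrite /= phiK.
  have : nbhs y (psi @^-1` (psi @` A)) by exact: psic.
  by apply: filterS => z [w Aw /(can_inj psiK) <-].
Qed.

Lemma homeo_continuum : continuum R X -> continuum R Y.
Proof.
have phiT : phi @` [set: X] = [set: Y].
  by apply/seteqP; split=> // y _; exists (psi y).
have phiw : {within [set: X], continuous phi} by apply: continuous_subspaceT.
move=> [[x _] cX conX mX]; split; last exact: homeo_metrizable.
- by exists (phi x).
- by rewrite -phiT; exact: continuous_compact.
- by rewrite -phiT; exact: connected_continuous_connected.
Qed.

End Transport.

Section TransportTame.
Context {R : realType} {X Y : topologicalType}.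
Variables (phi : X -> Y) (psi : Y -> X).
Hypothesis phic : continuous phi.
Hypothesis psic : continuous psi.
Hypothesis phiK : cancel phi psi.
Hypothesis psiK : cancel psi phi.

(** The cardinals admissible for the image are admissible for the point, by the
    inverse homeomorphism. *)
Lemma homeo_order_ge (x : X) (U : Type) (B : set U) :
  order_ge x B -> order_ge (phi x) B.
Proof.
move=> H U' C le; apply: H; rewrite -(phiK x).
exact: (homeo_order_le psic phic psiK phiK).
Qed.

Lemma homeo_order_eq (x : X) (U : Type) (B : set U) :
  order_eq x B -> order_eq (phi x) B.
Proof.
by move=> [? ?]; split; [exact: (homeo_order_le phic psic)|exact: homeo_order_ge].
Qed.

Hypothesis hX : hausdorff_space X.
Hypothesis hY : hausdorff_space Y.

Lemma homeo_arc_int a : Defs.arc R a -> arc_int R (phi @` a) = phi @` arc_int R a.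
Proof.
move=> [h ph]; have ph' := homeo_arc_param phic psic phiK psiK ph.
by rewrite (arc_intE hX ph) (arc_intE hY ph') image_comp.
Qed.

Lemma homeo_tame_partition (P : set (set X)) : tame_partition R P ->
  tame_partition R [set phi @` a | a in P].
Proof.
move=> [cP fP tP cC]; split.
- exact: countable_image.
- move=> _ [a /fP[aa oa] <-]; split; first exact: (homeo_arc phic psic).
  by rewrite homeo_arc_int //; exact: (homeo_open psic).
- move=> _ _ [a Pa <-] [b Pb <-]; have [[aa _] [ab _]] := (fP a Pa, fP b Pb).
  rewrite !homeo_arc_int // => -[_ [[x ax <-] [y by_ /(can_inj phiK) e]]].
  by rewrite (tP a b) //; exists x; split=> //; rewrite -e.
- apply: countableS (countable_image phi cC) => y ny.
  exists (psi y); last exact: psiK.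
  move=> [a Pa ay]; apply: ny; exists (phi @` a); first by exists a.
  by exists (psi y) => //; rewrite psiK.
Qed.

End TransportTame.

Lemma homeo_tame_graph {R : realType} {X Y : topologicalType}
    (phi : X -> Y) (psi : Y -> X) : continuous phi -> continuous psi ->
  cancel phi psi -> cancel psi phi -> tame_graph R X -> tame_graph R Y.
Proof.
move=> phic psic phiK psiK [cX cc]; split.
  exact: (homeo_continuum phic psic).
apply: countableS (countable_image phi cc).
rewrite -(homeo_closure phic psic phiK psiK); apply: closureS.
move=> y [ey|by_]; exists (psi y); rewrite ?psiK //; [left|right].
  exact: (homeo_order_eq psic phic).
exact: (homeo_order_ge psic phic).
Qed.

(** * The pieces on which the model is affine *)

Lemma norm_add_between {R : realType} (a b c : R) :
  `|a - c| = `|a - b| + `|b - c| -> a <= b <= c \/ c <= b <= a.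
Proof.
have [ab|ba] := leP a b; have [bc|cb] := leP b c => E.
- by left.
- right; move: E; rewrite (ler0_norm (x := a - b)) ?subr_le0 //.
  rewrite (gtr0_norm (x := b - c)) ?subr_gt0 //.
  by case: (ger0P (a - c)) => ? ?; apply/andP; split; lra.
- right; move: E; rewrite (gtr0_norm (x := a - b)) ?subr_gt0 //.
  rewrite (ler0_norm (x := b - c)) ?subr_le0 //.
  by case: (ger0P (a - c)) => ? ?; apply/andP; split; lra.
- by right; rewrite !ltW.
Qed.

Section Pieces.
Context {R : realType} {G : topologicalType}.
Hypothesis hG : hausdorff_space G.
Variables (f : G -> G) (P : set (set G)) (lam : R) (v : set G -> R).
Variable s : set G -> G -> R.
Hypothesis fc : continuous f.
Hypothesis mP : countable_Markov_partition R f P.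
Hypothesis charts : length_charts f P lam v s.

Let tP : tame_partition R P. Proof. by case: mP. Qed.
Local Notation D := (covered f P).
Local Notation skel := (skeleton (R := R) P).

Lemma chartP i : P i -> [/\ {within i, continuous (s i)}, {in i &, injective (s i)},
  s i @` i = `[0, v i]%classic & forall x, i x -> (0 < s i x < v i <-> arc_int R i x)].
Proof. by case: charts => H _ _; exact: H. Qed.

Lemma chart_inj i x y : P i -> i x -> i y -> s i x = s i y -> x = y.
Proof. by move=> /chartP[_ si _ _] ix iy; apply: si; exact/mem_set. Qed.

Lemma chart_inverse i : P i -> exists h : R -> G,
  [/\ {within `[0, v i], continuous h},
      forall t, `[0, v i]%classic t -> i (h t) /\ s i (h t) = t &
      forall x, i x -> h (s i x) = x].
Proof.
move=> Pi; have [sc sinj si _] := chartP Pi; have [g pg] := tame_arc tP Pi.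
suff /choice[h hP] : forall t, exists x, `[0, v i]%classic t -> i x /\ s i x = t.
  have hs x : i x -> h (s i x) = x.
    move=> ix; have [|ih e] := hP (s i x); first by rewrite -si; exists x.
    exact: (chart_inj Pi).
  exists h; split=> //; rewrite -si.
  apply: (compact_inj_homeo _ _ sc hs).
    exact: Rhausdorff.
  have [gc gi _] := pg; rewrite -gi; apply: continuous_compact gc _.
  exact: segment_compact.
move=> t; have [t01|nt] := pselect (`[0, v i]%classic t); last by exists (g 0).
by move: (t01); rewrite -{1}si => -[x ix <-]; exists x.
Qed.

(** Halves are needed because an arc becomes a tent, which is straight on either
    half only: on a piece both the point and its image move on straight lines. *)
Definition piece (i : set G) (u : bool) (j : set G) (w : bool) : set G :=
  [set x | [/\ i x, in_half v i u (s i x), j (f x) & in_half v j w (s j (f x))]].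

Definition half_itv (i : set G) (u : bool) : interval R :=
  if u then `[v i / 2, v i] else `[0, v i / 2].

Lemma in_halfE i u t : in_half v i u t = (t \in half_itv i u).
Proof. by rewrite /in_half /half_itv; case: u; rewrite in_itv. Qed.

Lemma half_itv_closed i u : closed [set` half_itv i u].
Proof. by rewrite /half_itv; case: u; exact: segment_closed. Qed.

Lemma piece_closed i u j w : P i -> P j -> closed (piece i u j w).
Proof.
move=> Pi Pj; have [sci _ _ _] := chartP Pi; have [scj _ _ _] := chartP Pj.
have [[gi pgi] [gj pgj]] := (tame_arc tP Pi, tame_arc tP Pj).
have cli := arc_param_closed hG pgi; have clj := arc_param_closed hG pgj.
have c1 := (within_closedP _ cli).1 sci _ (half_itv_closed (i := i) (u := u)).
have c2 := (within_closedP _ clj).1 scj _ (half_itv_closed (i := j) (u := w)).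
have c3 : closed (f @^-1` (j `&` s j @^-1` [set` half_itv j w])).
  by apply: preimage_closed => // x _; exact: fc.
rewrite (_ : piece i u j w = (i `&` s i @^-1` [set` half_itv i u]) `&`
   f @^-1` (j `&` s j @^-1` [set` half_itv j w])); first exact: closedI.
apply/seteqP; split=> x /=; rewrite /piece /= !in_halfE.
  by move=> [].
by move=> [[? ?] [? ?]].
Qed.

Lemma piece_scaling i u j w x y : P i -> D i j ->
  piece i u j w x -> piece i u j w y ->
  `|s j (f x) - s j (f y)| = lam * `|s i x - s i y|.
Proof. by move=> Pi Dij [ix _ jx _] [iy _ jy _]; case: charts => _ H _; exact: H. Qed.

(** Distances in the target are those in the source times [lam], so the image of
    a point between two others lies between their images. *)
Lemma piece_convex i u j w x y z : P i -> D i j ->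
  piece i u j w x -> piece i u j w y -> i z -> s i x <= s i z <= s i y ->
  piece i u j w z.
Proof.
move=> Pi Dij px py iz /andP[xz zy].
have [ix hx jx hjx] := px; have [iy hy jy hjy] := py.
have [_ H1 H2] := charts.
have jz : j (f z) by apply: (H2 i j Pi Dij x y z) => //; rewrite xz.
have e1 := H1 i j Pi Dij x z ix iz jx jz; have e2 := H1 i j Pi Dij z y iz iy jz jy.
have e3 := H1 i j Pi Dij x y ix iy jx jy.
have add : `|s j (f x) - s j (f y)| = `|s j (f x) - s j (f z)| + `|s j (f z) - s j (f y)|.
  rewrite e1 e2 e3 !ler0_norm ?subr_le0 //; first ring.
  exact: le_trans zy.
split=> //.
- move: hx hy; rewrite !in_halfE /half_itv.
  by case: (u); rewrite !in_itv /= => /andP[? ?] /andP[? ?]; apply/andP; split; lra.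
- have := norm_add_between add; rewrite !in_halfE /half_itv in hjx hjy *; move: hjx hjy.
  by case: (w); rewrite !in_itv /= => /andP[? ?] /andP[? ?] [] /andP[? ?];
    apply/andP; split; lra.
Qed.

Hypothesis cG : compact [set: G].

Lemma piece_segment i u j w x y : P i -> D i j ->
  piece i u j w x -> piece i u j w y -> x <> y ->
  exists a b : R, [/\ 0 <= a, a < b, b <= v i, s i @` piece i u j w = `[a, b]%classic &
    piece i u j w = i `&` s i @^-1` `[a, b]].
Proof.
move=> Pi Dij px py xy; have [Pj _] := Dij.
have cp : compact (piece i u j w).
  by apply: (subclosed_compact _ cG) => //; exact: piece_closed.
have [sc _ si _] := chartP Pi.
have pc : {within piece i u j w, continuous (s i)}.
  by apply: continuous_subspaceW sc => z [].
have p0 : piece i u j w !=set0 by exists x.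
have [m /set_mem pm mP'] := compact_EVT_min p0 cp pc.
have [n /set_mem pn nP] := compact_EVT_max p0 cp pc.
have {}mP' z : piece i u j w z -> s i m <= s i z by move=> /mem_set /mP'.
have {}nP z : piece i u j w z -> s i z <= s i n by move=> /mem_set /nP.
have [im _ _ _] := pm; have [in_ _ _ _] := pn.
have rng z : i z -> 0 <= s i z <= v i.
  move=> iz; have : (s i @` i) (s i z) by exists z.
  by rewrite si /= in_itv.
have E : piece i u j w = i `&` s i @^-1` `[s i m, s i n].
  apply/seteqP; split=> z.
    by move=> pz; split; [case: pz|rewrite /= in_itv /= mP' // nP].
  by move=> [iz /=]; rewrite in_itv /=; exact: piece_convex.
exists (s i m), (s i n); split=> //.
- by case/andP: (rng m im).
- rewrite lt_neqAle mP' // andbT; apply/eqP => e; apply: xy.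
  have [ix _ _ _] := px; have [iy _ _ _] := py.
  apply: (chart_inj Pi ix iy); apply/eqP; rewrite eq_le.
  by rewrite (le_trans (nP x px)) ?(le_trans (nP y py)) // -e ?mP'.
- by case/andP: (rng n in_).
apply/seteqP; split=> [_ [z pz <-]|t tmn]; first by rewrite /= in_itv /= mP' // nP.
have : (s i @` i) t.
  rewrite si /=; move: tmn; rewrite /= !in_itv /= => /andP[mt tn].
  have /andP[? _] := rng m im; have /andP[_ ?] := rng n in_.
  by apply/andP; split; lra.
by move=> [z iz e]; exists z => //; rewrite E; split; rewrite //= e.
Qed.

Lemma piece_free_arc i u j w x y : P i -> D i j ->
  piece i u j w x -> piece i u j w y -> x <> y ->
  free_arc R (piece i u j w).
Proof.
move=> Pi Dij px py xy.
have [a [b [a0 ab bv sp pE]]] := piece_segment Pi Dij px py xy.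
have [h [hc hs hK]] := chart_inverse Pi.
have sub : `[a, b] `<=` `[0, v i].
  by move=> t /=; rewrite !in_itv /= => /andP[? ?]; apply/andP; split; lra.
have hE : h @` `[a, b] = piece i u j w.
  rewrite pE; apply/seteqP; split=> [_ [t tab <-]|z [iz sz]].
    by have [it st] := hs t (sub t tab); split; rewrite //= st.
  by exists (s i z) => //; exact: hK.
have hi : {in `[a, b] &, injective h}.
  move=> t t' /sub tv /sub tv' e.
  by rewrite -(hs t tv).2 e (hs t' tv').2.
have [ph pint] := arc_of_segment hG ab (continuous_subspaceW sub hc) hi.
rewrite hE in ph pint; split; first by eexists; exact: ph.
have [sc _ _ sint] := chartP Pi.
have oI : open `]a, b[%classic by exact: itv_open.
have [V oV eV] := within_openP sc oI.
have oi := tame_int_open tP Pi.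
rewrite pint (_ : _ @` _ = arc_int R i `&` V); first exact: openI.
apply/seteqP; split=> [_ [t tab <-]|z [zi Vz]].
  have tab' : `[a, b]%classic t by exact: subset_itv_oo_cc.
  have [it st] := hs t (sub t tab').
  split; last by have [] : (i `&` V) (h t) by rewrite -eV; split; rewrite //= st.
  apply/(sint _ it); rewrite st; move: tab; rewrite /= in_itv /= => /andP[? ?].
  by apply/andP; split; lra.
have iz := arc_int_subset zi.
have [_ sz] : (i `&` s i @^-1` `]a, b[) z by rewrite eV.
by exists (s i z) => //; exact: hK.
Qed.

(** Arcs meet in the skeleton and halves in a point; where the difference is in
    the target, injectivity of the map on arcs brings it back. *)
Lemma piece_meet_countable i u j w i' u' j' w' : P i -> P i' -> D i j -> D i' j' ->
  ~ (i = i' /\ u = u' /\ j = j' /\ w = w') ->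
  countable (piece i u j w `&` piece i' u' j' w').
Proof.
move=> Pi Pi' Dij Dij' ne; have [[Pj _] [Pj' _]] := (Dij, Dij').
have cskel := skeleton_countable hG tP.
have finj := markov_inj mP Pi.
have half_meet l (t t' : bool) z : t <> t' -> in_half v l t z -> in_half v l t' z ->
    z = v l / 2.
  by case: t; case: t' => // _ /andP[? ?] /andP[? ?]; apply/eqP; rewrite eq_le; apply/andP.
have sinj l (z : R) : P l -> countable (l `&` s l @^-1` [set z]).
  move=> Pl; apply: countable_preimage_inj; last exact: countable1.
  by have [_ si _ _] := chartP Pl.
have [ii'|ii'] := pselect (i = i'); last first.
  apply: countableS cskel => x [[ix _ _ _] [ix' _ _ _]].
  exact: (tame_meet_skeleton hG tP Pi Pi' ii').
have [jj'|jj'] := pselect (j = j'); last first.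
  apply: countableS (countable_preimage_inj finj cskel) => x [[ix _ jx _] [_ _ jx' _]].
  by split=> //; exact: (tame_meet_skeleton hG tP Pj Pj' jj').
subst i' j'; have [uu'|uu'] := pselect (u = u'); last first.
  apply: countableS (sinj i (v i / 2) Pi) => x [[ix h _ _] [_ h' _ _]].
  by split=> //; exact: half_meet uu' h h'.
have ww' : w <> w' by move=> ww'; apply: ne.
apply: countableS (countable_preimage_inj finj (sinj j (v j / 2) Pj)).
move=> x [[ix _ jx h] [_ _ _ h']]; split=> //; split=> //.
exact: half_meet ww' h h'.
Qed.

(** Empty pieces and pieces consisting of one point are not arcs; they are
    countably many and can be dropped. *)
Definition pieces : set (set G) := [set q | exists i u j w,
  [/\ P i, D i j, q = piece i u j w & exists x y, [/\ q x, q y & x <> y]]].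

Lemma pieces_tame : tame_partition R pieces.
Proof.
have [cP _ _ _] := tP; have cskel := skeleton_countable hG tP.
pose I := ((P `*` [set: bool]) `*` (P `*` [set: bool])).
pose F (z : (set G * bool) * (set G * bool)) := piece z.1.1 z.1.2 z.2.1 z.2.2.
have cI : countable I.
  by do 2?apply: countableX => //; apply: countableP.
split.
- apply: (@countableS _ _ (F @` I)); last exact: countable_image.
  move=> q [i [u [j [w [Pi [Pj ?] -> _]]]]].
  by exists ((i, u), (j, w)).
- by move=> q [i [u [j [w [Pi Dij -> [x [y [px py xy]]]]]]]]; exact: piece_free_arc xy.
- move=> q q' Qq Qq' [x [xq xq']].
  have [i [u [j [w [Pi Dij qE [y [z [qy qz yz]]]]]]]] := Qq.
  have [i' [u' [j' [w' [Pi' Dij' qE' [y' [z' [qy' qz' yz']]]]]]]] := Qq'.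
  have [same|ne] := pselect (i = i' /\ u = u' /\ j = j' /\ w = w').
    by rewrite qE qE'; have [-> [-> [-> ->]]] := same.
  have [aq oq] : free_arc R q by rewrite qE in qy qz *; exact: piece_free_arc yz.
  have [aq' oq'] : free_arc R q' by rewrite qE' in qy' qz' *; exact: piece_free_arc yz'.
  exfalso; apply: (open_meets_arc_uncountable aq' oq).
    by exists x; split=> //; exact: (arc_int_subset xq').
  apply: countableS (piece_meet_countable Pi Pi' Dij Dij' ne) => t [tq tq'].
  by rewrite -qE -qE'; split=> //; exact: (arc_int_subset tq).
- pose N := [set z | I z /\ ~ exists x y, [/\ F z x, F z y & x <> y]].
  have cN : countable (\bigcup_(z in N) F z).
    apply: bigcup_countable; first by apply: countableS cI => z [].
    move=> z [_ nz]; have [->|/set0P[x zx]] := eqVneq (F z) set0.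
      exact: countable0.
    apply: countableS (countable1 x) => y zy; apply: contrapT => yx.
    by apply: nz; exists y, x.
  have cM : countable (\bigcup_(i in P) (i `&` f @^-1` skel)).
    by apply: bigcup_countable => // i Pi; exact: (countable_preimage_inj (markov_inj mP Pi)).
  apply: (@countableS _ _ (skel `|` (\bigcup_(i in P) (i `&` f @^-1` skel) `|`
     \bigcup_(z in N) F z))); last by do 2?apply: countableU.
  move=> x nx; have [|[i Pi xi]] := tame_skeletonP (R := R) P x; first by left.
  have ix := arc_int_subset xi; right.
  have [|[j Pj fj]] := tame_skeletonP (R := R) P (f x); first by left; exists i.
  right; have jx := arc_int_subset fj.
  have Dij : D i j.
    split=> //; have [_ _ H] := mP; by apply: H => //; exists (f x).
  have half l y : P l -> l y -> exists t, in_half v l t (s l y).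
    move=> Pl ly; have [_ _ sl _] := chartP Pl.
    have : (s l @` l) (s l y) by exists y.
    rewrite sl /= in_itv /= => /andP[h0 h1].
    by have [h|/ltW h] := leP (s l y) (v l / 2); [exists false|exists true]; apply/andP.
  have [u hu] := half i x Pi ix; have [w hw] := half j (f x) Pj jx.
  have Fx : F ((i, u), (j, w)) x by [].
  exists ((i, u), (j, w)) => //; split; first by [].
  move=> ex; apply: nx; exists (piece i u j w) => //.
  by exists i, u, j, w.
Qed.

End Pieces.

(** * The affine model of a map with an eigenvector *)

Section Lines.
Context {R : realType}.
Implicit Types A D : 'rV[R]_3.

Definition sqnorm (D : 'rV[R]_3) : R := \sum_(k < 3) D ord0 k ^+ 2.

Lemma sqnorm_gt0_neq D : 0 < sqnorm D -> D != 0.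
Proof.
apply: contraTneq => ->; rewrite /sqnorm big1 ?ltxx // => k _.
by rewrite mxE expr0n.
Qed.

Lemma sqnormZ (c : R) D : sqnorm (c *: D) = c ^+ 2 * sqnorm D.
Proof. by rewrite /sqnorm mulr_sumr; apply: eq_bigr => k _; rewrite mxE exprMn. Qed.

Lemma euclidean_distE A D : euclidean_dist A D = Num.sqrt (sqnorm (A - D)).
Proof. by congr Num.sqrt; apply: eq_bigr => k _; rewrite !mxE. Qed.

Lemma euclidean_dist_line A D (a b : R) :
  euclidean_dist (A + a *: D) (A + b *: D) = `|b - a| * Num.sqrt (sqnorm D).
Proof.
rewrite euclidean_distE (_ : _ - _ = (a - b) *: D); last first.
  by rewrite opprD addrACA subrr add0r -scalerBl.
by rewrite sqnormZ sqrtrM ?sqr_ge0 // sqrtr_sqr distrC.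
Qed.

Lemma line_param_inj A D (a b : R) : D != 0 -> A + a *: D = A + b *: D -> a = b.
Proof.
move=> D0 /addrI /eqP; rewrite -subr_eq0 -scalerBl scaler_eq0 (negbTE D0) orbF.
by rewrite subr_eq0 => /eqP.
Qed.

Lemma line_convex A D (a b t : R) :
  (1 - t) *: (A + a *: D) + t *: (A + b *: D) = A + ((1 - t) * a + t * b) *: D.
Proof. by apply/rowP => k; rewrite !mxE; ring. Qed.

Lemma line_segment_param (X : Type) (q : set X) (sg : X -> R) (F : X -> 'rV[R]_3)
    A D (a b : R) : a < b -> D != 0 -> sg @` q = `[a, b]%classic ->
  (forall x, q x -> F x = A + sg x *: D) ->
  line_segment (F @` q) (A + a *: D) (A + b *: D).
Proof.
move=> ab D0 sq FE; split.
  by move=> /(line_param_inj D0) e; move: ab; rewrite e ltxx.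
apply/seteqP; split=> [_ [x qx <-]|_ [t /= /[!in_itv]/= /andP[t0 t1] <-]].
  have : (sg @` q) (sg x) by exists x.
  rewrite sq /= in_itv /= => /andP[ax xb].
  exists ((sg x - a) / (b - a)); last first.
    rewrite line_convex FE //; congr (_ + _ *: _); field.
    by rewrite subr_eq0 gt_eqF.
  rewrite /= in_itv /= divr_ge0 ?subr_ge0 ?(ltW ab) //=.
  by rewrite ler_pdivrMr ?subr_gt0 // mul1r lerD2r.
have : `[a, b]%classic ((1 - t) * a + t * b).
  by rewrite /= in_itv /=; apply/andP; split; nra.
rewrite -sq => -[x qx e]; exists x => //.
by rewrite FE // e line_convex.
Qed.

End Lines.

(** Between the ends of the interval the triangle inequality is an equality, so
    each value is determined by the values at the ends. *)
Lemma scaling_affine {R : realType} (X : Type) (q : set X) (sg u : X -> R)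
    (a b lam : R) : a < b -> sg @` q = `[a, b]%classic -> 0 <= lam ->
  (forall x y, q x -> q y -> `|u x - u y| = lam * `|sg x - sg y|) ->
  exists c e : R, e ^+ 2 = lam ^+ 2 /\ forall x, q x -> u x = c + e * sg x.
Proof.
move=> ab sq l0 H.
have [x0 q0 s0] : (sg @` q) a by rewrite sq /= in_itv /= lexx ltW.
have [x1 q1 s1] : (sg @` q) b by rewrite sq /= in_itv /= lexx ltW.
have rng x : q x -> a <= sg x /\ sg x <= b.
  move=> qx; have : (sg @` q) (sg x) by exists x.
  by rewrite sq /= in_itv /= => /andP.
have h01 := H x1 x0 q1 q0; rewrite s0 s1 (gtr0_norm (x := b - a)) ?subr_gt0 // in h01.
have main x : q x -> u x0 <= u x1 /\ u x = u x0 + lam * (sg x - a) \/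
                     u x1 <= u x0 /\ u x = u x0 - lam * (sg x - a).
  move=> qx; have [ax xb] := rng x qx.
  have hx0 := H x x0 qx q0; have hx1 := H x1 x q1 qx; rewrite s0 s1 in hx0 hx1.
  rewrite (ger0_norm (x := sg x - a)) ?subr_ge0 // in hx0.
  rewrite (ger0_norm (x := b - sg x)) ?subr_ge0 // in hx1.
  have E : `|u x1 - u x0| = `|u x1 - u x| + `|u x - u x0| by rewrite h01 hx0 hx1; ring.
  have [/andP[? ?]|/andP[? ?]] := norm_add_between E.
    right; split; first lra.
    by move: hx0; rewrite ler0_norm ?subr_le0 //; lra.
  left; split; first lra.
  by move: hx0; rewrite ger0_norm ?subr_ge0 //; lra.
have [le01|lt10] := leP (u x0) (u x1).
  have [l00|lp] := eqVneq lam 0.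
    exists (u x0), 0; rewrite l00; split=> // x qx.
    by have [[_ ->]|[_ ->]] := main x qx; rewrite l00; ring.
  exists (u x0 - lam * a), lam; split=> // x qx.
  have [[_ ->]|[ge _]] := main x qx; first ring.
  have e : u x1 = u x0 by apply/eqP; rewrite eq_le ge.
  move: h01; rewrite e subrr normr0 => /esym/eqP.
  by rewrite mulf_eq0 (negbTE lp) /= subr_eq0 gt_eqF.
exists (u x0 + lam * a), (- lam); split; first by rewrite sqrrN.
by move=> x qx; have [[le _]|[_ ->]] := main x qx; [lra|ring].
Qed.

Section AffineModel.
Context {R : realType} {G : topologicalType}.
Variables (f : G -> G) (P : set (set G)) (lam : R) (v : set G -> R).
Hypothesis gG : tame_graph R G.
Hypothesis fc : continuous f.
Hypothesis fleo : leo f.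
Hypothesis mP : countable_Markov_partition R f P.
Hypothesis lam1 : 1 < lam.
Hypothesis ev : eigenvector P (transition_matrix R f) lam v.

Lemma affine_model : exists (G' : set 'rV[R]_3) (g : G' -> G'),
  [/\ countably_affine_map g, constant_slope g lam & conjugate f g].
Proof.
have [[_ cG _ mG] _] := gG; have hG := metrizable_hausdorff mG.
have [tP _ _] := mP; have lam0 : 0 < lam by exact: lt_trans lam1.
have [s charts] := length_charts_exist hG fleo mP lam1 ev.
have v0 i (Pi : P i) := leo_eigenvector_gt0 hG fleo mP lam0 ev Pi.
have [S vS] := leo_eigenvector_summable hG fleo mP lam0 ev.
have P0 : P !=set0 by have [_ [i Pi _] _] := ev; exists i.
have [Phi [Phic Phii PhiL]] := tame_embedding cG mG tP vS v0 (chartP charts) P0.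
pose G' : set 'rV[R]_3 := range Phi.
pose phi (x : G) : G' := exist _ (Phi x) (mem_set (imageT Phi x)).
have phiv x : set_val (phi x) = Phi x by [].
have phic : continuous phi.
  apply/continuousP => U [V oV <-].
  have -> : phi @^-1` (set_val @^-1` V) = Phi @^-1` V by [].
  by apply: open_comp => // x _; exact: Phic.
have hG' : hausdorff_space G'.
  rewrite open_hausdorff => x y xy.
  have : set_val x != set_val y by apply: contra xy => /eqP/val_inj ->.
  have := @norm_hausdorff R 'rV[R]_3; rewrite open_hausdorff => /[apply].
  move=> [[A B] [/= /set_mem Ax /set_mem By] [oA oB /eqP AB]].
  exists (set_val @^-1` A, set_val @^-1` B); first by split; exact/mem_set.
  split=> /=; [by exists A|by exists B|].
  by rewrite -preimage_setI AB preimage_set0.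
have psiE (y : G') : exists x, phi x = y.
  by case: y => y yG; have /set_mem [x _ e] := yG; exists x; exact: val_inj.
have [psi psiK] := choice psiE.
have phiK : cancel phi psi.
  by move=> x; apply: Phii; rewrite -!phiv psiK.
have psic : continuous psi.
  have H : {within phi @` [set: G], continuous psi}.
    by apply: (compact_inj_homeo hG' cG) => //; exact: continuous_subspaceT.
  apply/continuous_subspace_setT.
  by rewrite (_ : setT = phi @` setT) //; apply/seteqP; split=> // y _; exists (psi y).
pose g (y : G') := phi (f (psi y)).
pose Q := pieces f P v s.
have tQ : tame_partition R Q := pieces_tame hG fc mP charts cG.
have tQ' := homeo_tame_partition phic psic phiK psiK hG hG' tQ.
(* On a piece both the embedding and its composition with the map are affine in
   the chart, with directions of length 1 and [lam]. *)
have data q : Q q -> exists (sg : G -> R) (A D B E : 'rV[R]_3) (a b : R),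
    [/\ a < b, sg @` q = `[a, b]%classic, sqnorm D = 1 /\ sqnorm E = lam ^+ 2,
        forall x, q x -> Phi x = A + sg x *: D &
        forall x, q x -> Phi (f x) = B + sg x *: E].
  move=> [i [u [j [w [Pi Dij qE [x [y [qx qy xy]]]]]]]]; have [Pj _] := Dij.
  rewrite qE in qx qy.
  have [a [b [_ ab _ sq _]]] := piece_segment hG fc mP charts cG Pi Dij qx qy xy.
  have [A [D [D1 AD]]] := PhiL i u Pi; have [A' [D' [D1' AD']]] := PhiL j w Pj.
  have [c [e [e2 ue]]] := scaling_affine ab sq (ltW lam0)
    (fun x y px py => piece_scaling charts Pi Dij px py).
  exists (s i), A, D, (A' + c *: D'), (e *: D'), a, b; rewrite qE; split=> //.
  - by split=> //; rewrite sqnormZ e2 [sqnorm D']D1' mulr1.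
  - by move=> z [iz hz _ _]; exact: AD.
  - move=> z pz; have [_ _ jz hz] := pz; rewrite AD' // ue //.
    by rewrite scalerDl scalerA addrA (mulrC e).
have imval (q : set G) : set_val @` (phi @` q) = Phi @` q by rewrite image_comp.
have gval (q : set G) : set_val @` (g @` (phi @` q)) = (Phi \o f) @` q.
  rewrite !image_comp; apply: eq_imagel => x _ /=.
  by rewrite /g phiK.
have lam20 : 0 < lam ^+ 2 by rewrite exprn_gt0.
have segs q : Q q -> [/\ is_segment (phi @` q), affine_on g (phi @` q),
    is_segment (g @` (phi @` q)) & slope_on g (phi @` q) lam].
  move=> Qq; have [sg [A [D [B [E [a [b [ab sq [D1 E1] FD FE]]]]]]]] := data q Qq.
  have D0 : D != 0 by apply: sqnorm_gt0_neq; rewrite D1.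
  have E0 : E != 0 by apply: sqnorm_gt0_neq; rewrite E1.
  have s1 := line_segment_param ab D0 sq FD.
  have s2 := @line_segment_param _ _ q sg (Phi \o f) B E a b ab E0 sq FE.
  have s1' : segment_of (phi @` q) (A + a *: D) (A + b *: D).
    by rewrite /segment_of imval.
  have s2' : segment_of (g @` (phi @` q)) (B + a *: E) (B + b *: E).
    by rewrite /segment_of gval.
  split; [by do 2?eexists; exact: s1'| |by do 2?eexists; exact: s2'|].
  - move=> _ _ _ t [x qx <-] [y qy <-] [z qz <-] _ zE.
    have {zE} : Phi z = (1 - t) *: Phi x + t *: Phi y := zE.
    rewrite (FD _ qx) (FD _ qy) (FD _ qz) line_convex => /(line_param_inj D0) e.
    have gE w : set_val (g (phi w)) = Phi (f w) by rewrite /g phiK.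
    by rewrite !gE (FE _ qx) (FE _ qy) (FE _ qz) e line_convex.
  - exists (A + a *: D), (A + b *: D), (B + a *: E), (B + b *: E); split=> //.
    rewrite !euclidean_dist_line D1 E1 sqrtr1 mulr1 sqrtr_sqr (gtr0_norm lam0).
    by rewrite mulrAC divff ?mul1r // normr_eq0 subr_eq0 gt_eqF.
have aQ : affine_partition g [set phi @` q | q in Q].
  split=> // _ [q Qq <-]; by have [] := segs q Qq.
exists G', g; split.
- split; last by eexists; exact: aQ.
    split; first exact: (homeo_tame_graph phic psic phiK psiK gG).
    by exists [set phi @` q | q in Q]; split=> // _ [q /segs[? _ _ _] <-].
  move=> y; apply: continuous_comp; last exact: phic.
  by apply: continuous_comp; [exact: psic|exact: fc].
- by eexists; [exact: aQ|move=> _ [q /segs[_ _ _ ?] <-]].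
exists phi; first by split=> //; exists psi.
by apply/funext => x; rewrite /g /= phiK.
Qed.

End AffineModel.

(** * Lebesgue measure up to countable sets *)

Section LebesgueAffine.
Context {R : realType}.
Local Notation leb := (@lebesgue_measure R).

Definition affine_map (a c : R) : measurableTypeR R -> measurableTypeR R :=
  fun t => a + c * t.

Lemma affine_map_measurable (a c : R) : measurable_fun setT (affine_map a c).
Proof.
apply: measurable_realfun.continuous_measurable_fun => t.
by apply: cvgD; [exact: cvg_cst|apply: cvgM; [exact: cvg_cst|exact: cvg_id]].
Qed.

HB.instance Definition _ (a c : R) :=
  isMeasurableFun.Build _ _ _ _ (affine_map a c) (affine_map_measurable a c).

Lemma affine_map_preimage (a c x y : R) : c != 0 ->
  lebesgue_measure (affine_map a c @^-1` `]x, y]) =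
  ((`|c|^-1)%:E * lebesgue_measure `]x, y]%classic)%E.
Proof.
move=> c0; have := c0; rewrite neq_lt => /orP[cn|cp].
- have -> : affine_map a c @^-1` `]x, y] = `[(y - a) / c, (x - a) / c[%classic.
    apply/seteqP; split=> t; rewrite /affine_map /= !in_itv /= => /andP[h1 h2];
      apply/andP; split.
    + by rewrite ler_ndivrMr //; lra.
    + by rewrite ltr_ndivlMr //; lra.
    + by move: h2; rewrite ltr_ndivlMr //; lra.
    + by move: h1; rewrite ler_ndivrMr //; lra.
  rewrite !lebesgue_measure_itv /= !lte_fin ltr_nM2r ?invr_lt0 // ltrD2r.
  case: ifP => _; last by rewrite mule0.
  by rewrite -!EFinD -EFinM ltr0_norm //; congr EFin; field.
- have -> : affine_map a c @^-1` `]x, y] = `](x - a) / c, (y - a) / c]%classic.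
    apply/seteqP; split=> t; rewrite /affine_map /= !in_itv /= => /andP[h1 h2];
      apply/andP; split.
    + by rewrite ltr_pdivrMr //; lra.
    + by rewrite ler_pdivlMr //; lra.
    + by move: h1; rewrite ltr_pdivrMr //; lra.
    + by move: h2; rewrite ler_pdivlMr //; lra.
  rewrite !lebesgue_measure_itv /= !lte_fin ltr_pM2r ?invr_gt0 // ltrD2r.
  case: ifP => _; last by rewrite mule0.
  by rewrite -!EFinD -EFinM gtr0_norm //; congr EFin; field.
Qed.

(** Both sides are measures that agree on intervals. *)
Lemma lebesgue_measure_affine (a c : R) (A : set R) : c != 0 -> measurable A ->
  (`|c|%:E * lebesgue_measure (affine_map a c @^-1` A))%E = lebesgue_measure A.
Proof.
move=> c0 mA; pose k := NngNum (normr_ge0 c).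
have := @lebesgue_measure_unique R (mscale k (pushforward lebesgue_measure (affine_map a c))).
move=> /(_ (affine_map_measurable a c)) H; rewrite (H _ A mA) //.
move=> {H} _ [[x y] _ <-].
change (leb `]x, y]%classic = (`|c|%:E * leb (affine_map a c @^-1` `]x, y]%classic))%E).
rewrite affine_map_preimage //.
by rewrite muleA -EFinM divff ?normr_eq0 // mul1e.
Qed.

Lemma countable_measurableR (A : set R) : countable A ->
  measurable (A : set (measurableTypeR R)).
Proof. by apply: countable_measurable => t; exact: measurable_set1. Qed.

Section CountableFamilies.
Context {I : choiceType}.
Variables (Q : set I) (B : I -> set R).
Hypothesis cQ : countable Q.
Hypothesis mB : forall i, Q i -> measurable (B i : set (measurableTypeR R)).

(** An injective numbering turns a countable family into a sequence, padded with
    empty sets. *)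
Lemma countable_family_sequence : exists F : nat -> set (measurableTypeR R),
  [/\ forall n, measurable (F n), \bigcup_n F n = \bigcup_(i in Q) B i,
      (trivIset Q B -> trivIset setT F) &
      (\sum_(0 <= n <oo) leb (F n) = \esum_(i in Q) leb (B i))%E].
Proof.
have /countable_injP[g gi] := cQ.
pose F n := \bigcup_(i in [set i | Q i /\ g i = n]) B i.
have FE i : Q i -> F (g i) = B i.
  move=> Qi; apply/seteqP; split=> [x [j [Qj e] jx]|x ix]; last by exists i.
  by rewrite -(gi j i) //; exact/mem_set.
have F0 n : ~ (g @` Q) n -> F n = set0.
  by move=> nn; apply/seteqP; split=> // x [i [Qi e] _]; apply: nn; exists i.
have mF n : measurable (F n : set (measurableTypeR R)).
  have [[i Qi <-]|/F0 ->] := pselect ((g @` Q) n); last exact: measurable0.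
  by rewrite FE //; exact: mB.
exists F; split=> //.
- apply/seteqP; split=> [x [n _ [i [Qi _] ix]]|x [i Qi ix]]; first by exists i.
  by exists (g i) => //; rewrite FE.
- move=> tB n m _ _ [x [[i [Qi <-] ix] [j [Qj <-] jx]]].
  by rewrite (tB i j) //; exists x.
- rewrite nneseries_esumT; last by move=> n; exact: measure_ge0.
  rewrite (_ : \esum_(n in [set: nat]) _ = \esum_(n in g @` Q) leb (F n)); last first.
    rewrite [RHS]esum_mkcond; apply: eq_esum => n _; case: ifPn => // /negP nn.
    by rewrite F0 ?measure0 // => gn; apply: nn; exact/mem_set.
  rewrite (@reindex_esum _ _ _ Q (g @` Q) g).
    by apply: eq_esum => i Qi; rewrite FE.
  split; [by move=> i Qi; exists i|exact: gi|by []].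
Qed.

Lemma leb_countable_le (S : set R) : measurable (S : set (measurableTypeR R)) ->
  countable (S `\` \bigcup_(i in Q) B i) -> (leb S <= \esum_(i in Q) leb (B i))%E.
Proof.
move=> mS cS; have [F [mF FU _ <-]] := countable_family_sequence.
have mU : measurable (\bigcup_n F n) by exact: bigcupT_measurable.
have cS' : countable (S `\` \bigcup_n F n) by rewrite FU.
rewrite -(setDUK (A := S `\` \bigcup_n F n) (B := S)); last by move=> x [].
rewrite setDD; apply: (@le_trans _ _ (leb (S `\` \bigcup_n F n) + leb (S `&` \bigcup_n F n))%E).
  apply: measureU2; first exact: measurableD.
  exact: measurableI.
rewrite (countable_lebesgue_measure0 cS') add0e.
apply: measure_sigma_subadditive => //; first exact: measurableI.
Qed.

End CountableFamilies.

(** All overlaps are contained in one countable set, whose removal makes the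
    family disjoint and changes no measure. *)
Lemma leb_countable_additive {I : choiceType} (Q : set I) (B : I -> set R) (S : set R) :
  countable Q -> (forall i, Q i -> measurable (B i : set (measurableTypeR R))) ->
  measurable (S : set (measurableTypeR R)) ->
  (forall i, Q i -> B i `<=` S) ->
  (forall i j, Q i -> Q j -> i <> j -> countable (B i `&` B j)) ->
  countable (S `\` \bigcup_(i in Q) B i) ->
  leb S = \esum_(i in Q) leb (B i).
Proof.
move=> cQ mB mS BS cB cS.
pose N := \bigcup_(i in Q) \bigcup_(j in [set j | Q j /\ i <> j]) (B i `&` B j).
have cN : countable N.
  apply: bigcup_countable => // i Qi; apply: bigcup_countable.
    by apply: countableS cQ => j [].
  by move=> j [Qj ij]; exact: cB.
have mN := countable_measurableR cN.
have N0 : leb N = 0%E by exact: countable_lebesgue_measure0.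
apply/eqP; rewrite eq_le leb_countable_le //=.
have mB' i : Q i -> measurable ((B i `\` N) : set (measurableTypeR R)).
  by move=> Qi; apply: measurableD => //; exact: mB.
have -> : \esum_(i in Q) leb (B i) = \esum_(i in Q) leb (B i `\` N).
  apply: eq_esum => i Qi; apply/eqP; rewrite eq_le; apply/andP; split.
    rewrite -{1}(setUIDK (B i) N).
    apply: (@le_trans _ _ (leb (B i `&` N) + leb (B i `\` N))%E).
      by apply: measureU2; [apply: measurableI => //; exact: mB|exact: mB'].
    rewrite countable_lebesgue_measure0 ?add0e //.
    by apply: countableS cN => x [].
  apply: le_measure; [exact: (mem_set (mB' i Qi))|exact: (mem_set (mB i Qi))|by move=> x []].
have [F [mF FU tF <-]] := countable_family_sequence cQ mB'.
rewrite -(measure_semi_bigcup (lebesgue_measure : {measure set (measurableTypeR R) -> \bar R}) mF).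
- apply: le_measure; [by apply/mem_set; exact: bigcupT_measurable|exact/mem_set|].
  by rewrite FU => x [i Qi [ix _]]; exact: (BS i).
- apply: tF => i j Qi Qj [x [[ix nx] [jx _]]]; apply: contrapT => ij.
  by apply: nx; exists i => //; exists j.
- exact: bigcupT_measurable.
Qed.

End LebesgueAffine.

(** * Length measured along a family of segments *)

Lemma esum_exchange {R : realType} {I J : choiceType} (A : set I) (B : set J)
    (a : I -> J -> \bar R) : (forall i j, A i -> B j -> 0 <= a i j)%E ->
  \esum_(i in A) \esum_(j in B) a i j = \esum_(j in B) \esum_(i in A) a i j.
Proof.
move=> a0; rewrite esum_esum // esum_esum; last by move=> j i Bj Ai; exact: a0.
rewrite (@reindex_esum _ _ _ (A `*`` (fun=> B)) (B `*`` (fun=> A))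
  (fun ij => (ij.2, ij.1))) //.
split=> [[i j] [Ai Bj]|[i j] [i' j'] _ _ /= [-> ->]|[j i] [Bj Ai]] //.
by exists (i, j).
Qed.

Section Lengths.
Context {R : realType} {G : topologicalType}.
Hypothesis cG : compact [set: G].
Hypothesis hG : hausdorff_space G.
Variable Psi : G -> 'rV[R]_3.
Hypothesis Psic : continuous Psi.
Hypothesis Psii : injective Psi.
Local Notation leb := (@lebesgue_measure R).
Implicit Types (A D : 'rV[R]_3) (Y Z W : set G).

(** Subsets of the space are measured along the segment from [A] to [A + D], by
    the parameters of the points of their images on it. *)
Definition trace A D Y : set R :=
  [set t | t \in `[0, 1] /\ (Psi @` Y) (A + t *: D)].

Definition on_line A D Y := forall x, Y x -> exists2 t, t \in `[0, 1] & Psi x = A + t *: D.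

Definition seglen A D Y : \bar R := ((Num.sqrt (sqnorm D))%:E * leb (trace A D Y))%E.

Lemma seglen_ge0 A D Y : (0 <= seglen A D Y)%E.
Proof. by apply: mule_ge0; [rewrite lee_fin sqrtr_ge0|exact: measure_ge0]. Qed.

Lemma trace_measurable A D Y : closed Y -> measurable (trace A D Y : set (measurableTypeR R)).
Proof.
move=> cY; have cP : closed (Psi @` Y).
  apply: compact_closed; first exact: norm_hausdorff.
  apply: continuous_compact; first exact: continuous_subspaceT.
  exact: (subclosed_compact cY cG).
apply: measurable_realfun.closed_measurable.
have -> : trace A D Y = `[0, 1]%classic `&` (fun t => A + t *: D) @^-1` (Psi @` Y).
  by apply/seteqP; split.
apply: closedI; first exact: segment_closed.
apply: preimage_closed => // t _; apply: cvgD; first exact: cvg_cst.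
by apply: cvgZr_tmp; exact: cvg_id.
Qed.

Lemma trace_countable A D Y : D != 0 -> countable Y -> countable (trace A D Y).
Proof.
move=> D0 cY; have inj : {in [set: R] &, injective (fun t => A + t *: D)}.
  by move=> t u _ _; exact: line_param_inj.
apply: countableS (countable_preimage_inj inj (countable_image Psi cY)).
by move=> t [].
Qed.

Lemma trace_setI A D Y Z : trace A D (Y `&` Z) = trace A D Y `&` trace A D Z.
Proof.
apply/seteqP; split=> [t [t01 [x [Yx Zx] e]]|t [[t01 [x Yx e]] [_ [z Zz e']]]].
  by split; split=> //; exists x.
split=> //; exists x => //; split=> //.
by rewrite (_ : x = z) //; apply: Psii; rewrite e e'.
Qed.

Lemma trace_on_line A D Y : D != 0 -> on_line A D Y ->
  trace A D Y = [set t | (Psi @` Y) (A + t *: D)].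
Proof.
move=> D0 l; apply/seteqP; split=> [t []|t /= Yt] //; split=> //.
have [x Yx e] := Yt; have [u u01 e'] := l x Yx.
by move: e; rewrite e' => /(line_param_inj D0) <-.
Qed.

(** Two distinct common points make the parametrizations of two lines differ by
    an affine change, whose factor is compensated by the lengths of the
    directions; a set with fewer points has no length. *)
Lemma seglen_independent A D A' D' Y : 0 < sqnorm D -> 0 < sqnorm D' -> closed Y ->
  on_line A D Y -> on_line A' D' Y -> seglen A D Y = seglen A' D' Y.
Proof.
move=> n0 n0' cY l l'; have D0 := sqnorm_gt0_neq n0; have D0' := sqnorm_gt0_neq n0'.
have [[x [y [Yx Yy xy]]]|sub] := pselect (exists x y, [/\ Y x, Y y & x <> y]); last first.
  have cY' : countable Y.
    have [->|/set0P[x Yx]] := eqVneq Y set0; first exact: countable0.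
    by apply: countableS (countable1 x) => y Yy; apply: contrapT => yx; apply: sub; exists y, x.
  by rewrite /seglen !countable_lebesgue_measure0 ?mule0 //; exact: trace_countable.
have [al _ ex] := l x Yx; have [be _ ey] := l y Yy.
have [al' _ ex'] := l' x Yx; have [be' _ ey'] := l' y Yy.
have ab : be != al by apply/eqP => e; apply: xy; apply: Psii; rewrite ex ey e.
have ab' : be' - al' != 0.
  by rewrite subr_eq0; apply/eqP => e; apply: xy; apply: Psii; rewrite ex' ey' e.
pose c := (be - al) / (be' - al').
have c0 : c != 0 by rewrite mulf_neq0 ?invr_neq0 // subr_eq0.
have DE : D' = c *: D.
  have : (be' - al') *: D' = (be - al) *: D.
    have <- : (A' + be' *: D') - (A' + al' *: D') = (be' - al') *: D'.
      by rewrite opprD addrACA subrr add0r -scalerBl.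
    by rewrite -ey' -ex' ey ex opprD addrACA subrr add0r -scalerBl.
  move=> /(congr1 (fun z => (be' - al')^-1 *: z)).
  by rewrite !scalerA mulVf // scale1r mulrC.
pose a := al - al' * c.
have AE : A' = A + a *: D.
  apply/(addIr (al' *: D')); rewrite -ex' ex DE scalerA -addrA -scalerDl.
  by congr (_ + _ *: _); rewrite /a; ring.
have tE : trace A' D' Y = affine_map a c @^-1` trace A D Y.
  rewrite !trace_on_line //; apply/seteqP; split=> t /=;
  by rewrite AE DE scalerA -addrA -scalerDl /affine_map mulrC.
rewrite /seglen -(lebesgue_measure_affine a c0 (trace_measurable A D cY)) -tE.
rewrite muleA -EFinM; congr (_%:E * _)%E.
by rewrite DE sqnormZ sqrtrM ?sqr_ge0 // sqrtr_sqr mulrC.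
Qed.

Variable Q : set (set G).
Hypothesis tQ : tame_partition R Q.
Variables (a d : set G -> 'rV[R]_3).
Hypothesis d0 : forall q, Q q -> 0 < sqnorm (d q).
Hypothesis qE : forall q, Q q -> Psi @` q = [set a q + t *: d q | t in `[0, 1]%classic].

(** One-dimensional measure on the space, which up to countably many points is
    the union of the segments in [Q]. *)
Definition ell Y : \bar R := \esum_(q in Q) seglen (a q) (d q) Y.

Lemma ell_ge0 Y : (0 <= ell Y)%E.
Proof. by apply: esum_ge0 => q _; exact: seglen_ge0. Qed.

Lemma tame_closed q : Q q -> closed q.
Proof. by move=> /(tame_arc tQ)[h ph]; exact: (arc_param_closed hG ph). Qed.

Lemma tame_meet_countable q q' : Q q -> Q q' -> q <> q' -> countable (q `&` q').
Proof.
move=> Qq Qq' ne; apply: countableS (skeleton_countable hG tQ).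
exact: (tame_meet_skeleton hG tQ).
Qed.

Lemma on_own_line q : Q q -> on_line (a q) (d q) q.
Proof.
move=> Qq x qx; have : (Psi @` q) (Psi x) by exists x.
by rewrite qE // => -[t t01 <-]; exists t.
Qed.

Lemma trace_own q Y : Q q -> trace (a q) (d q) Y = trace (a q) (d q) (Y `&` q).
Proof.
move=> Qq; rewrite trace_setI; apply/esym/setIidPl => t [t01 _]; split=> //.
by rewrite qE //; exists t.
Qed.

(** Cut into its intersections with the segments of the family, each measurable
    along either line. *)
Lemma ell_segment A D Y : 0 < sqnorm D -> closed Y -> on_line A D Y ->
  ell Y = seglen A D Y.
Proof.
move=> n0 cY l; have D0 := sqnorm_gt0_neq n0; have [cQ _ _ cC] := tQ.
have cYq q : Q q -> closed (Y `&` q) by move=> Qq; apply: closedI => //; exact: tame_closed.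
have -> : ell Y = \esum_(q in Q) seglen A D (Y `&` q).
  apply: eq_esum => q Qq; rewrite {1}/seglen (trace_own _ Qq) -/(seglen _ _ _).
  apply: seglen_independent => //; [exact: d0|exact: cYq| |].
    by move=> x [_ qx]; exact: on_own_line.
  by move=> x [Yx _]; exact: l.
rewrite /seglen esum_pZl ?sqrtr_gt0 //; congr (_ * _)%E; apply/esym.
apply: leb_countable_additive => //.
- by move=> q Qq; apply: trace_measurable; exact: cYq.
- exact: trace_measurable.
- by move=> q Qq; rewrite trace_setI => t [].
- move=> q q' Qq Qq' ne; rewrite -trace_setI; apply: trace_countable => //.
  by apply: countableS (tame_meet_countable Qq Qq' ne) => x [[_ ?] [_ ?]].
- apply: countableS (trace_countable A D0 cC) => t [[t01 [x Yx e]] nt].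
  split=> //; exists x => // -[q Qq qx]; apply: nt; exists q => //; split=> //.
  by exists x.
Qed.

Section Families.
Context {I : choiceType}.
Variables (K : set I) (F : I -> set G) (W : set G).
Hypothesis cK : countable K.
Hypothesis cF : forall i, K i -> closed (F i).
Hypothesis cW : closed W.
Hypothesis WF : countable (W `\` \bigcup_(i in K) F i).

Let rest q : Q q -> countable (trace (a q) (d q) W `\` \bigcup_(i in K) trace (a q) (d q) (F i)).
Proof.
move=> Qq; have D0 := sqnorm_gt0_neq (d0 Qq).
apply: countableS (trace_countable (a q) D0 WF) => t [[t01 [x Wx e]] nt].
split=> //; exists x => //; split=> // -[i Ki Fx]; apply: nt; exists i => //.
by split=> //; exists x.
Qed.

Lemma ell_exchange : \esum_(i in K) ell (F i) =
  \esum_(q in Q) ((Num.sqrt (sqnorm (d q)))%:E *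
    \esum_(i in K) leb (trace (a q) (d q) (F i)))%E.
Proof.
rewrite /ell esum_exchange; last by move=> i q _ _; exact: seglen_ge0.
apply: eq_esum => q Qq; rewrite -esum_pZl //.
by rewrite sqrtr_gt0; exact: d0.
Qed.

Lemma ell_countable_le : (ell W <= \esum_(i in K) ell (F i))%E.
Proof.
rewrite ell_exchange; apply: le_esum => q Qq.
apply: lee_wpmul2l; first by rewrite lee_fin sqrtr_ge0.
apply: leb_countable_le => //; last exact: rest.
- by move=> i Ki; apply: trace_measurable; exact: cF.
- exact: trace_measurable.
Qed.

Lemma ell_countable_additive : (forall i, K i -> F i `<=` W) ->
  (forall i j, K i -> K j -> i <> j -> countable (F i `&` F j)) ->
  ell W = \esum_(i in K) ell (F i).
Proof.
move=> FW Fij; rewrite ell_exchange; apply: eq_esum => q Qq; congr (_ * _)%E.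
apply: leb_countable_additive => //; last exact: rest.
- by move=> i Ki; apply: trace_measurable; exact: cF.
- exact: trace_measurable.
- by move=> i Ki t [t01 [x Fx e]]; split=> //; exists x => //; exact: (FW i).
- move=> i j Ki Kj ij; rewrite -trace_setI.
  by apply: trace_countable; [exact: (sqnorm_gt0_neq (d0 Qq))|exact: Fij].
Qed.

End Families.

Lemma ell_le Y Z : closed Y -> closed Z -> Y `<=` Z -> (ell Y <= ell Z)%E.
Proof.
move=> cY cZ YZ; apply: le_esum => q Qq.
apply: lee_wpmul2l; first by rewrite lee_fin sqrtr_ge0.
apply: le_measure; try by apply: mem_set; exact: trace_measurable.
by move=> t [t01 [x Yx e]]; split=> //; exists x => //; exact: YZ.
Qed.

Lemma ell_arc q : Q q -> ell q = (Num.sqrt (sqnorm (d q)))%:E.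
Proof.
move=> Qq; rewrite (ell_segment (d0 Qq) (tame_closed Qq) (on_own_line Qq)).
rewrite /seglen (_ : trace _ _ _ = `[0, 1]%classic).
  by rewrite lebesgue_measure_itv /= lte_fin ltr01 -EFinD subr0 mule1.
apply/seteqP; split=> [t []|t t01] //; split=> //.
by rewrite qE //; exists t.
Qed.

Variables (f : G -> G) (b e : set G -> 'rV[R]_3) (lam : R).
Hypothesis fc : continuous f.
Hypothesis lam0 : 0 < lam.
Hypothesis eE : forall q, Q q -> sqnorm (e q) = lam ^+ 2 * sqnorm (d q).
Hypothesis fE : forall q x t, Q q -> q x -> t \in `[0, 1] ->
  Psi x = a q + t *: d q -> Psi (f x) = b q + t *: e q.

Lemma image_closed Y : closed Y -> closed (f @` Y).
Proof.
move=> cY; apply: compact_closed => //; apply: continuous_compact.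
  exact: continuous_subspaceT.
exact: (subclosed_compact cY cG).
Qed.

(** An affine map carries parameters to the same parameters, so only the length
    of the direction changes. *)
Lemma ell_image_arc q Y : Q q -> closed Y -> Y `<=` q ->
  ell (f @` Y) = (lam%:E * ell Y)%E.
Proof.
move=> Qq cY Yq; have e0 : 0 < sqnorm (e q) by rewrite eE // mulr_gt0 ?exprn_gt0 ?d0.
have E0 := sqnorm_gt0_neq e0.
have lY : on_line (a q) (d q) Y by move=> x /Yq; exact: on_own_line.
have lf : on_line (b q) (e q) (f @` Y).
  by move=> _ [x Yx <-]; have [t t01 xt] := lY x Yx; exists t => //; exact: (fE Qq (Yq x Yx) t01 xt).
rewrite (ell_segment (d0 Qq) cY lY) (ell_segment e0 (image_closed cY) lf) /seglen.
rewrite eE // sqrtrM ?sqr_ge0 // sqrtr_sqr gtr0_norm // EFinM -muleA.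
congr (_ * (_ * leb _))%E; apply/seteqP; split=> t [t01].
  move=> [_ [x Yx <-] ext]; split=> //; have [u u01 xu] := lY x Yx.
  by move: ext; rewrite (fE Qq (Yq x Yx) u01 xu) => /(line_param_inj E0) <-; exists x.
by move=> [x Yx xt]; split=> //; exists (f x); [exists x|exact: (fE Qq (Yq x Yx) t01 xt)].
Qed.

Lemma ell_pieces Y : closed Y -> ell Y = \esum_(q in Q) ell (Y `&` q).
Proof.
move=> cY; have [cQ _ _ cC] := tQ.
apply: (@ell_countable_additive _ Q (fun q => Y `&` q)) => //.
- by move=> q Qq; apply: closedI => //; exact: tame_closed.
- apply: countableS cC => x [Yx nx] [q Qq qx]; apply: nx; exists q => //.
- by move=> q q' Qq Qq' ne; apply: countableS (tame_meet_countable Qq Qq' ne) => x [[_ ?] [_ ?]].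
Qed.

Lemma ell_image_pieces Y : closed Y ->
  \esum_(q in Q) ell (f @` (Y `&` q)) = (lam%:E * ell Y)%E.
Proof.
move=> cY; rewrite (ell_pieces cY) -esum_pZl //; last by move=> q _; exact: ell_ge0.
apply: eq_esum => q Qq; apply: (ell_image_arc Qq) => //.
by apply: closedI => //; exact: tame_closed.
Qed.

Lemma ell_image_rest Y : countable (f @` Y `\` \bigcup_(q in Q) f @` (Y `&` q)).
Proof.
have [_ _ _ cC] := tQ; apply: countableS (countable_image f cC).
move=> _ [[x Yx <-] nx]; exists x => // -[q Qq qx].
by apply: nx; exists q => //; exists x.
Qed.

Lemma ell_image_le Y : closed Y -> (ell (f @` Y) <= lam%:E * ell Y)%E.
Proof.
move=> cY; have [cQ _ _ _] := tQ; rewrite -ell_image_pieces //.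
apply: (@ell_countable_le _ Q (fun q => f @` (Y `&` q))) => //.
- by move=> q Qq; apply: image_closed; apply: closedI => //; exact: tame_closed.
- exact: image_closed.
- exact: ell_image_rest.
Qed.

Lemma ell_image_inj Y : closed Y -> {in Y &, injective f} ->
  ell (f @` Y) = (lam%:E * ell Y)%E.
Proof.
move=> cY fi; have [cQ _ _ _] := tQ; rewrite -ell_image_pieces //.
apply: (@ell_countable_additive _ Q (fun q => f @` (Y `&` q))) => //.
- by move=> q Qq; apply: image_closed; apply: closedI => //; exact: tame_closed.
- exact: image_closed.
- exact: ell_image_rest.
- by move=> q Qq; apply: image_subset => x [].
- move=> q q' Qq Qq' ne.
  apply: countableS (countable_image f (tame_meet_countable Qq Qq' ne)).
  move=> _ [[x [Yx qx] <-] [y [Yy qy] exy]]; exists x => //; split=> //.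
  by rewrite (_ : x = y) //; apply: fi; [exact/mem_set|exact/mem_set|].
Qed.

(** Some iterate maps a segment of the family onto the space, and each step
    multiplies lengths by at most [lam]. *)
Lemma ell_finite : leo f -> Q !=set0 -> (ell setT < +oo)%E.
Proof.
move=> fleo [q Qq]; have [|n nG] := fleo _ (tame_int_open tQ Qq).
  have [E|/set0P //] := eqVneq (arc_int R q) set0.
  by case: (tame_int_uncountable hG tQ Qq); rewrite E.
have H m : closed (iter m f @` q) /\ (ell (iter m f @` q) <= (lam ^+ m)%:E * ell q)%E.
  elim: m => [|m [cm IH]].
    by rewrite [X in closed X]image_id [X in ell X]image_id mul1e; split=> //; exact: tame_closed.
  have -> : iter m.+1 f @` q = f @` (iter m f @` q) by rewrite image_comp.
  split; first exact: image_closed.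
  apply: le_trans (ell_image_le cm) _; rewrite exprS EFinM -muleA.
  by apply: lee_wpmul2l => //; rewrite lee_fin ltW.
have [_ h] := H n; apply: le_lt_trans (le_lt_trans h _).
  apply: ell_le; [by []|by have [] := H n|].
  by rewrite -nG; apply: image_subset; exact: arc_int_subset.
by rewrite ell_arc // -EFinM ltry.
Qed.

Variable P : set (set G).
Hypothesis mP : countable_Markov_partition R f P.
Hypothesis fleo : leo f.

(** The length of the image of an arc is [lam] times the length of the arc, and
    also the sum of the lengths of the arcs covered. Not all lengths vanish, as
    the total length is that of the space. *)
Lemma length_eigenvector : Q !=set0 ->
  eigenvector P (transition_matrix R f) lam (fun i => fine (ell i)).
Proof.
move=> Q0; have [tP _ Mk] := mP; have lt := ell_finite fleo Q0.
have cl i : P i -> closed i by move=> /(tame_arc tP)[h ph]; exact: (arc_param_closed hG ph).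
have [cP _ _ cC] := tP.
have fin i : P i -> (fine (ell i))%:E = ell i.
  move=> Pi; rewrite fineK // ge0_fin_numE ?ell_ge0 //; apply: le_lt_trans lt.
  by apply: ell_le; [exact: cl|by []|exact: subsetT].
have meet i j : P i -> P j -> i <> j -> countable (i `&` j).
  move=> Pi Pj ij; apply: countableS (skeleton_countable hG tP).
  exact: (tame_meet_skeleton hG tP).
apply/(eigenvector_covered f P lam _); split.
- by move=> i Pi; rewrite -lee_fin fin // ell_ge0.
- apply: contrapT => nex; have [q Qq] := Q0.
  have E : ell setT = \esum_(i in P) ell i.
    apply: (@ell_countable_additive _ P id) => //.
    by rewrite setTD.
  have Z : ell setT = 0%E.
    rewrite E esum1 // => i Pi; rewrite -fin //; congr EFin.
    by apply: contrapT => ni; apply: nex; exists i => //; apply/eqP.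
  have := @ell_le q setT (tame_closed Qq) closedT (fun _ _ => Logic.I).
  rewrite Z ell_arc // lee_fin leNgt sqrtr_gt0 d0 //.
- move=> i Pi; rewrite EFinM fin // -ell_image_inj; [|exact: cl|exact: (markov_inj mP)].
  rewrite (eq_esum (b := ell)); last by move=> j [Pj _]; rewrite fin.
  apply/esym; apply: (@ell_countable_additive _ (covered f P i) id).
  + by apply: countableS cP => j [].
  + by move=> j [Pj _]; exact: cl.
  + by apply: image_closed; exact: cl.
  + apply: countableS (skeleton_countable hG tP) => y [iy ny].
    by have [] := image_covered mP Pi iy.
  + by move=> j [].
  + by move=> j k [Pj _] [Pk _]; exact: meet.
Qed.

End Lengths.

(** * The eigenvector of a map of constant slope *)

Section SegmentLength.
Context {R : realType}.
Implicit Types a b c d e : 'rV[R]_3.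

Lemma sqnormBC a b : sqnorm (a - b) = sqnorm (b - a).
Proof. by rewrite -opprB -scaleN1r sqnormZ sqrrN expr1n mul1r. Qed.

Lemma sqnorm_gt0 d : d != 0 -> 0 < sqnorm d.
Proof.
move=> d0; rewrite lt_neqAle sumr_ge0 ?andbT; last by move=> k _; exact: sqr_ge0.
apply: contra d0 => /eqP/esym/eqP.
rewrite psumr_eq0; last by move=> k _; exact: sqr_ge0.
move=> /allP H; apply/eqP/rowP => k; rewrite mxE; apply/eqP.
by rewrite -sqrf_eq0; apply: (H k); rewrite mem_index_enum.
Qed.

Lemma segment_combE a b (t : R) : (1 - t) *: a + t *: b = a + t *: (b - a).
Proof. by apply/rowP => k; rewrite !mxE; ring. Qed.

Lemma segment_diff_le (S : set 'rV[R]_3) c d e b :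
  S c -> S d -> S `<=` [set b + t *: e | t in `[0, 1]%classic] ->
  sqnorm (d - c) <= sqnorm e.
Proof.
move=> Sc Sd sub; have [t /= t01 <-] := sub c Sc; have [u /= u01 <-] := sub d Sd.
rewrite opprD addrACA subrr add0r -scalerBl sqnormZ.
have e0 : 0 <= sqnorm e by apply: sumr_ge0 => k _; exact: sqr_ge0.
rewrite -[leRHS]mul1r ler_wpM2r //.
move: t01 u01; rewrite !in_itv /= => /andP[? ?] /andP[? ?].
by rewrite -real_normK ?num_real // expr_le1 // ler_norml; apply/andP; split; lra.
Qed.

(** Each of the two direction vectors is the other one times a factor of absolute
    value at most 1. *)
Lemma segment_length_unique (S : set 'rV[R]_3) c d b e :
  line_segment S c d -> S = [set b + t *: e | t in `[0, 1]%classic] ->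
  sqnorm (d - c) = sqnorm e.
Proof.
move=> [_ Scd] Sbe.
have i0 : `[0, 1]%classic (0 : R) by rewrite /= in_itv /= lexx ler01.
have i1 : `[0, 1]%classic (1 : R) by rewrite /= in_itv /= lexx ler01.
have Sc : S c by rewrite Scd; exists 0; rewrite // subr0 scale1r scale0r addr0.
have Sd : S d by rewrite Scd; exists 1; rewrite // subrr scale1r scale0r add0r.
have Sb : S b by rewrite Sbe; exists 0; rewrite // scale0r addr0.
have Se : S (b + e) by rewrite Sbe; exists 1; rewrite // scale1r.
apply/eqP; rewrite eq_le; apply/andP; split.
  by apply: (segment_diff_le Sc Sd (b := b)); rewrite -Sbe.
have -> : e = (b + e) - b by rewrite addrC addKr.
apply: (segment_diff_le Sb Se (b := c)); rewrite Scd => _ [t t01 <-].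
by exists t => //; rewrite segment_combE.
Qed.

End SegmentLength.

Section ConstantSlope.
Context {R : realType} {G : topologicalType}.
Variables (f : G -> G) (P : set (set G)) (lam : R).
Hypothesis gG : tame_graph R G.
Hypothesis fCMM : CMM R f.
Hypothesis fleo : leo f.
Hypothesis mP : countable_Markov_partition R f P.
Hypothesis lam0 : 0 < lam.

(** The affine partition of the model is pulled back to the space and serves as
    the family of segments along which lengths are measured. *)
Lemma constant_slope_eigenvector (G' : set 'rV[R]_3) (g : G' -> G') :
  constant_slope g lam -> conjugate f g ->
  exists v : set G -> R, eigenvector P (transition_matrix R f) lam v.
Proof.
move=> [Q [tQ segs] slopes] [phi [phic [psi [psic phiK psiK]]] cj].
have [[_ cG _ mG] _] := gG; have hG := metrizable_hausdorff mG.
have hG' : hausdorff_space G'.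
  exact: (metrizable_hausdorff (homeo_metrizable phic psic phiK psiK mG)).
have [fc [P1 infP1 [tP1 _ _]] _] := fCMM.
have tQ0 := homeo_tame_partition psic phic psiK phiK hG' hG tQ.
pose Q0 := [set psi @` q | q in Q].
pose Psi x := set_val (phi x).
have Psic : continuous Psi.
  by move=> x; apply: continuous_comp; [exact: phic|exact: initial_continuous].
have Psii : injective Psi by move=> x y /val_inj /(can_inj phiK).
have Q0n : Q0 !=set0.
  have [E|/set0P //] := eqVneq Q0 set0.
  have [a Pa] := infinite_setN0 infP1; case: (tame_int_uncountable hG tP1 Pa).
  have [_ _ _] := tQ0; rewrite -/Q0 E bigcup_set0 setC0.
  exact: countableS.
(* For a segment: its origin and direction, and those of its image. *)
pose good_data (q0 : set G) (z : ('rV[R]_3 * 'rV[R]_3) * ('rV[R]_3 * 'rV[R]_3)) :=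
  [/\ 0 < sqnorm z.1.2,
      Psi @` q0 = [set z.1.1 + t *: z.1.2 | t in `[0, 1]%classic],
      sqnorm z.2.2 = lam ^+ 2 * sqnorm z.1.2 &
      forall x t, q0 x -> t \in `[0, 1] -> Psi x = z.1.1 + t *: z.1.2 ->
        Psi (f x) = z.2.1 + t *: z.2.2].
have data q0 : Q0 q0 -> exists z, good_data q0 z.
  move=> [q Qq <-]; have [_ aff _] := segs q Qq.
  have [a [b [c [d [[ab qE] gE slE]]]]] := slopes q Qq.
  have i0 : `[0, 1]%classic (0 : R) by rewrite /= in_itv /= lexx ler01.
  have i1 : `[0, 1]%classic (1 : R) by rewrite /= in_itv /= lexx ler01.
  have [xa qa va] : (set_val @` q) a by rewrite qE; exists 0; rewrite // subr0 scale1r scale0r addr0.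
  have [xb qb vb] : (set_val @` q) b by rewrite qE; exists 1; rewrite // subrr scale1r scale0r add0r.
  have affE z t : q z -> t \in `[0, 1] -> set_val z = a + t *: (b - a) ->
      set_val (g z) = set_val (g xa) + t *: (set_val (g xb) - set_val (g xa)).
    move=> qz t01 ez; rewrite -segment_combE; apply: aff => //.
    by rewrite va vb segment_combE.
  have ba : b - a != 0 by rewrite subr_eq0; apply/eqP => e; exact: ab.
  have qE' : set_val @` q = [set a + t *: (b - a) | t in `[0, 1]%classic].
    by rewrite qE; apply: eq_imagel => t _; rewrite segment_combE.
  have gqE : set_val @` (g @` q) =
      [set set_val (g xa) + t *: (set_val (g xb) - set_val (g xa)) | t in `[0, 1]%classic].
    apply/seteqP; split=> [_ [_ [z qz <-] <-]|_ [t t01 <-]].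
      have : (set_val @` q) (set_val z) by exists z.
      by rewrite qE' => -[t t01 ez]; exists t => //; rewrite -(affE z t).
    have : (set_val @` q) (a + t *: (b - a)) by rewrite qE'; exists t.
    move=> [z qz ez]; exists (g z); first by exists z.
    exact: affE.
  exists ((a, b - a), (set_val (g xa), set_val (g xb) - set_val (g xa))); split=> /=.
  - exact: sqnorm_gt0.
  - rewrite -qE' image_comp; apply: eq_imagel => z _ /=.
    by rewrite /Psi psiK.
  - rewrite -(segment_length_unique gE gqE) slE.
    rewrite !euclidean_distE expr_div_n !sqr_sqrtr; last 2 first.
    + by rewrite sqnormBC ltW // sqnorm_gt0.
    + by apply: sumr_ge0 => k _; exact: sqr_ge0.
    rewrite (sqnormBC c) (sqnormBC a) divfK //.
    by rewrite gt_eqF // sqnorm_gt0.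
  - move=> _ t [z qz <-] t01; rewrite /Psi psiK => /(affE z t qz t01) <-.
    congr set_val; have := congr1 (fun h => h (psi z)) cj.
    by rewrite /= psiK.
have /choice[w wP] : forall q0, exists z, Q0 q0 -> good_data q0 z.
  move=> q0; have [/data[z zP]|n] := pselect (Q0 q0); first by exists z.
  by exists ((0, 0), (0, 0)).
exists (fun i => fine (ell Psi Q0 (fun q => (w q).1.1) (fun q => (w q).1.2) i)).
apply: (@length_eigenvector _ _ cG hG Psi Psic Psii Q0 tQ0 _ _ _ _ f
  (fun q => (w q).2.1) (fun q => (w q).2.2) lam fc lam0) => //.
- by move=> q Qq; have [] := wP q Qq.
- by move=> q Qq; have [] := wP q Qq.
- by move=> q Qq; have [] := wP q Qq.
- by move=> q x t Qq; have [_ _ _] := wP q Qq; exact.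
Qed.

End ConstantSlope.

Theorem corollary3p3 (R : realType) (G : topologicalType) (f : G -> G)
    (P : set (set G)) (lambda : R) :
  tame_graph R G -> CMM R f -> leo f ->
  countable_Markov_partition R f P ->
  1 < lambda ->
  (exists (G' : set 'rV[R]_3) (g : G' -> G'),
     [/\ countably_affine_map g, constant_slope g lambda & conjugate f g]) <->
  (exists v : set G -> R, eigenvector P (transition_matrix R f) lambda v).
Proof.
move=> gG fCMM fleo mP lam1; split=> [[G' [g [_ sg cfg]]]|[v ev]].
  exact: (constant_slope_eigenvector gG fCMM fleo mP (lt_trans ltr01 lam1) sg cfg).
by have [fc _ _] := fCMM; exact: (affine_model gG fc fleo mP lam1 ev).
Qed.
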